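(* Let $p\ge2$, $X_0\in L^p_\omega H$, let the coefficient assumption stated in the context hold, and assume that there exist constants $\tau_0\in(0,1]$, $N_0\in\mathbb R$ and $N_0^*>0$ such that for all $\tau\in(0,\tau_0)$ and $u\in\dot H^1$, $$2\langle F_\tau(u),u\rangle_{V^*,V}+\tau\|F_\tau(u)\|^2+(p-1)\|G_\tau(u)\|_{\mathcal L_2^0}^2\le N_0-N_0^*\|u\|^2.$$ Then there exist positive constants $T_1,T_2$ and $\tau_1\in(0,1]$ such that for any $\tau\in(0,\tau_1)$, the tamed-FEM $(Y_n^h)$ defined in the context satisfies $$\mathbb E\big[\|Y_n^h\|^p\,\big|\,\mathcal F_{t_{n-1}}\big]\le T_1\tau+(1-T_2\tau)\|Y_{n-1}^h\|^p,\qquad n\in\mathbb N_+.$$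
   Context: Domain and spaces. $d\in\{1,2,3\}$, $\mathcal O\subset\mathbb R^d$ is a bounded open domain with piecewise smooth boundary, $A=-\Delta$ with homogeneous Dirichlet boundary condition. $\dot H^1=\operatorname{Dom}(A^{1/2})$ with norm $\|u\|_1=\|A^{1/2}u\|$, $\dot H^{-1}$ its dual with respect to the $L^2$ inner product. $H=U=L^2(\mathcal O)$ with norm $\|\cdot\|$, $V=\dot H^1$, $V^*=\dot H^{-1}$, $L^r_\xi:=L^r(\mathcal O)$. Standing assumption on $q$: $q>1$ if $d=1,2$ and $q\in(1,3]$ if $d=3$, such that the embeddings $\dot H^1\hookrightarrow L_\xi^{2(q+1)}\hookrightarrow L_\xi^{q+2}\hookrightarrow L^2_\xi\hookrightarrow L_\xi^{(q+2)^*}\hookrightarrow L_\xi^{(2(q+1))^*}\hookrightarrow\dot H^{-1}$ hold ($r^*$ is the conjugate exponent of $r$). Noise. $(\Omega,\mathcal F,\mathbb P)$ is a complete probability space with a normal filtration $\mathbb F=\{\mathcal F_t\}_{t\ge 0}$; $Q$ is a self-adjoint positive semidefinite trace-class operator on $U$ with eigenpairs $\{(q_m,g_m)\}$, $\{g_m\}$ an orthonormal basis of $U$, $C_Q:=\sum_mq_m\|g_m\|_{L^\infty_\xi}^2<\infty$ and $\sum_mq_m\|\nabla g_m\|_{L^\infty_\xi}^2<\infty$. $W=\sum_m\sqrt{q_m}g_m\beta_m$ is a $Q$-Wiener process, $U_0=Q^{1/2}U$, $\mathcal L_2^0:=HS(U_0;H)$ (Hilbert--Schmidt operators). Initial data are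 $\mathcal F_0$-measurable; $L^p_\omega H=L^p(\Omega;H)$. Coefficient assumption. $f,g:\mathbb R\to\mathbb R$ are continuously differentiable and there are constants $p\ge2$, $L_0,L_1\in\mathbb R$, $L_2>0$, $L_3,L_4,L_5\ge0$ such that for all $\xi,\eta\in\mathbb R$: $2(\xi-\eta)[f(\xi)-f(\eta)]+C_Q(p-1)|g(\xi)-g(\eta)|^2\le L_0|\xi-\eta|^2$; $f'(\xi)\le L_1-L_2|\xi|^q$; $|f'(\xi)|\le L_3(1+|\xi|^q)$; $|g'(\xi)|^2\le L_4+L_5|\xi|^{q/2}$. Tamed operators. For $\tau\in(0,1)$, $f_\tau,g_\tau:\mathbb R\to\mathbb R$ are given (tamed) functions and $F_\tau(u)(\xi)=f_\tau(u(\xi))$, $(G_\tau(u)g_m)(\xi)=g_\tau(u(\xi))g_m(\xi)$ are the associated Nemytskii operators. Tamed-FEM. $h\in(0,1)$, $\mathcal T_h$ is a regular family of quasi-uniform partitions of $\mathcal O$ with maximal mesh size $h$, $V_h\subset\dot H^1$ is the space of continuous piecewise linear functions over $\mathcal T_h$ vanishing on $\partial\mathcal O$. $A_h:V_h\to V_h$ and $\mathcal P_h:\dot H^{-1}\to V_h$ are defined by $\langle A_hu^h,v^h\rangle=-\langle\nabla u^h,\nabla v^h\rangle$ and $\langle\mathcal P_hu,v^h\rangle=\langle u,v^h\rangle_{V^*,V}$. With step size $\tau\in(0,1)$, $t_n=n\tau$, $\delta_{n-1}W=W(t_n)-W(t_{n-1})$, the tamed-FEM is the $V_h$-valued sequence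 with $Y_0^h=\mathcal P_hX_0$ and $$Y_n^h=Y_{n-1}^h+\tau A_hY_n^h+\tau\mathcal P_hF_\tau(Y_{n-1}^h)+\mathcal P_hG_\tau(Y_{n-1}^h)\,\delta_{n-1}W,\quad n\in\mathbb N_+.$$ Constants are independent of $h$, $\tau$ and $n$. *)

(* Defs.v *)
From HB Require Import structures.
From mathcomp Require Import all_boot all_order all_algebra.
From mathcomp Require Import all_classical all_reals all_analysis.
From mathcomp Require Import measurable_realfun lra.
Set Implicit Arguments.
Unset Strict Implicit.
Unset Printing Implicit Defensive.
Import Order.TTheory GRing.Theory Num.Theory.
Import numFieldNormedType.Exports.
Local Open Scope classical_set_scope.
Local Open Scope ring_scope.

Section LebesgueRd.
Local Open Scope ereal_scope.
Context {R : realType}.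
Local Notation tupleR d := (d.-tuple (measurableTypeR R)).

Definition tcons d (p : measurableTypeR R * tupleR d) : tupleR d.+1 :=
  [tuple of p.1 :: p.2].

Lemma measurable_tcons d : measurable_fun setT (@tcons d).
Proof. exact: measurable_cons. Qed.

Fixpoint lebesgue_tuple d : set (tupleR d) -> \bar R :=
  match d with
  | 0 => \d_([tuple] : tupleR 0)
  | d'.+1 => pushforward (lebesgue_measure \x @lebesgue_tuple d') (@tcons d')
  end.
Arguments lebesgue_tuple : clear implicits.

Lemma sigma_finite_tcons d
    (m1 : {sigma_finite_measure set (measurableTypeR R) -> \bar R})
    (m2 : {sigma_finite_measure set (tupleR d) -> \bar R}) :
  sigma_finite setT (pushforward (m1 \x m2) (@tcons d)).
Proof.
have /sigma_finiteP[F [TF ndF Foo]] := sigma_finiteT m1.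
have /sigma_finiteP[G [TG ndG Goo]] := sigma_finiteT m2.
pose g (t : tupleR d.+1) : (measurableTypeR R * tupleR d)%type :=
  (thead t, [tuple of behead t]).
have mg : measurable_fun setT g.
  by apply/measurable_fun_pairP; split; [exact: measurable_tnth|
    exact: measurable_behead].
have fK : cancel (@tcons d) g.
  by move=> [x t]; rewrite /g /tcons /=; congr pair; exact/val_inj.
exists (fun n => g @^-1` (F n `*` G n)) => [|k].
  rewrite -preimage_bigcup (_ : \bigcup_n _ = setT) ?preimage_setT//.
  rewrite -subTset => -[x y] _.
  have [n _ Fnx] : (\bigcup_n F n) x by rewrite -TF.
  have [k _ Gky] : (\bigcup_n G n) y by rewrite -TG.
  exists (maxn n k) => //; split.
    by move: x Fnx; exact/subsetPset/ndF/leq_maxl.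
  by move: y Gky; exact/subsetPset/ndG/leq_maxr.
have [mFk Fk] := Foo k; have [mGk Gk] := Goo k; split.
  by rewrite -[X in measurable X]setTI; apply: mg => //; exact: measurableX.
rewrite /pushforward (_ : _ @^-1` _ = F k `*` G k).
  by rewrite product_measure1E// lte_mul_pinfty// ge0_fin_numE.
by apply/seteqP; split => x; rewrite /preimage/mkset fK.
Qed.

Lemma lebesgue_tuple_sfm d :
  {m : {sigma_finite_measure set (tupleR d) -> \bar R} |
    m = lebesgue_tuple d :> (set _ -> _)}.
Proof.
elim: d => [|d [m mE]]; first by exists (\d_([tuple] : tupleR 0)).
pose mu := measure_function_pushforward__canonical__measure_function_Measure
  (lebesgue_measure \x m) (@measurable_tcons d).
pose b := Measure_isSigmaFinite.Build _ _ _ mu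
  (@sigma_finite_tcons d lebesgue_measure m).
pose M : {sigma_finite_measure set (tupleR d.+1) -> \bar R} :=
  HB.pack (pushforward (lebesgue_measure \x m) (@tcons d)) mu b.
by exists (M (@measurable_tcons d)); rewrite /= mE.
Qed.

(* R^d is 'rV[R]_d with its Borel sets; Lebesgue measure is the d-fold product
   measure, transported from d-tuples to row vectors. *)
Definition borelRd d := g_sigma_algebraType (@open 'rV[R]_d).

Definition row_of_tuple d (t : tupleR d) : borelRd d := \row_i tnth t i.

Lemma measurable_row_of_tuple d : measurable_fun setT (@row_of_tuple d).
Proof.
apply: (measurability (@open 'rV[R]_d : set (set (borelRd d))))
  => // _ [U oU <-]; rewrite setTI.
pose box (q : 'rV[rat]_d) (k : nat) : set (tupleR d) :=
  \bigcap_(i in [set: 'I_d])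
    (fun t : tupleR d => tnth t i) @^-1` ball (ratr (q ord0 i) : R) k.+1%:R^-1%R.
have mbox q k : measurable (box q k).
  apply: fin_bigcap_measurable => // i _.
  rewrite -[X in measurable X]setTI; apply: measurable_tnth => //.
  rewrite ball_itv; exact: measurable_itv.
pose I : countType := ('rV[rat]_d * nat)%type.
pose B (n : nat) : set (tupleR d) :=
  if @unpickle I n is Some (q, k) then
    if `[< box q k `<=` @row_of_tuple d @^-1` U >] then box q k else set0
  else set0.
rewrite (_ : _ @^-1` U = \bigcup_n B n).
  apply: bigcup_measurable => n _; rewrite /B.
  case: unpickle => [[q k]|//]; case: ifPn => // _; exact: mbox.
apply/seteqP; split => [t Ut|t [n _]]; last first.
  by rewrite /B; case: unpickle => [[q k]|//]; case: asboolP => // + bt; exact.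
have [e /= e0 eU] : exists2 e : R, (0 < e)%R & ball (row_of_tuple t) e `<=` U.
  by have /nbhs_ballP[e e0 eU] := open_nbhs_nbhs (conj oU Ut); exists e.
have [k ke] : exists k : nat, (k.+1%:R^-1 < e / 2 :> R)%R.
  have := near_infty_natSinv_lt (PosNum (divr_gt0 e0 (ltr0n R 2 : 0 < 2%:R :> R)%R)).
  by move=> [N _ /(_ N (leqnn N))]; exists N.
have k0 : (0 < k.+1%:R^-1 :> R)%R by rewrite invr_gt0.
pose x (i : 'I_d) : R := tnth t i.
have /all_sig[q qP] : forall i : 'I_d, {q : rat | `|ratr q - x i| < k.+1%:R^-1}%R.
  move=> i; apply: cid.
  have [|q] := @rat_in_itvoo R (x i - k.+1%:R^-1)%R (x i + k.+1%:R^-1)%R.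
    by rewrite ltrD2l gt0_cp.
  rewrite in_itv/= => /andP[h1 h2]; exists q.
  by rewrite distrC ltr_distlC h1.
exists (@pickle I (\row_i q i, k)) => //.
rewrite /B pickleK; case: asboolP => [_ i _ /=|]; first by rewrite mxE; exact: qP.
case=> t' bt'; apply: eU; split => // i j.
rewrite !mxE; have := bt' j Logic.I; rewrite /= mxE /ball/=.
have := qP j; rewrite -/(x j); set y : R := tnth t' j => h1 h2.
rewrite distrC in h1; rewrite -(subrKA (ratr (q j))).
rewrite (le_lt_trans (ler_normD _ _))//.
by rewrite [ltRHS](splitr e) ltrD// (lt_trans _ ke).
Qed.

Definition lebesgue_Rd d : set (borelRd d) -> \bar R :=
  pushforward (lebesgue_tuple d) (@row_of_tuple d).

Lemma lebesgue_Rd_measureE d :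
  {m : {measure set (borelRd d) -> \bar R} |
    m = @lebesgue_Rd d :> (set _ -> _)}.
Proof.
have [m mE] := lebesgue_tuple_sfm d.
exists (measure_function_pushforward__canonical__measure_function_Measure
  m (@measurable_row_of_tuple d)).
by rewrite /lebesgue_Rd -mE.
Qed.

Let lebesgue_Rd0 d : @lebesgue_Rd d set0 = 0.
Proof. by have [m <-] := lebesgue_Rd_measureE d; rewrite measure0. Qed.

Let lebesgue_Rd_ge0 d A : 0 <= @lebesgue_Rd d A.
Proof. by have [m <-] := lebesgue_Rd_measureE d; exact: measure_ge0. Qed.

Let lebesgue_Rd_semi_sigma_additive d : semi_sigma_additive (@lebesgue_Rd d).
Proof.
have [m <-] := lebesgue_Rd_measureE d; exact: measure_semi_sigma_additive.
Qed.

HB.instance Definition _ d := isMeasure.Build _ _ _ (@lebesgue_Rd d)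
  (lebesgue_Rd0 d) (@lebesgue_Rd_ge0 d) (@lebesgue_Rd_semi_sigma_additive d).

Let lebesgue_Rd_sigma_finite d : sigma_finite setT (@lebesgue_Rd d).
Proof.
have [m mE] := lebesgue_tuple_sfm d.
have [F UF mF] := sigma_finiteT m.
pose g (x : borelRd d) : tupleR d := [tuple x ord0 i | i < d].
have fK : cancel (@row_of_tuple d) g.
  by move=> t; apply: eq_from_tnth => i; rewrite tnth_mktuple mxE.
have mg : measurable_fun setT g.
  apply/measurable_fun_tnthP => i.
  rewrite (_ : _ \o _ = fun x : 'rV[R]_d => x ord0 i); last first.
    by apply/funext => x /=; rewrite tnth_mktuple.
  apply: (measurability _ (RGenOpens.measurableE R)) => _ [_ [a [b ->] <-]].
  rewrite setTI; apply: sub_sigma_algebra.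
  apply: open_comp => [? _|]; [exact: coord_continuous|exact: interval_open].
exists (fun n => g @^-1` F n) => [|n].
  by rewrite -preimage_bigcup -UF preimage_setT.
have [mFn Fn] := mF n; split.
  by rewrite -[X in measurable X]setTI; exact: mg.
rewrite /lebesgue_Rd /pushforward -mE (_ : _ @^-1` _ = F n)//.
by apply/seteqP; split => x; rewrite /preimage/mkset fK.
Qed.

HB.instance Definition _ d := Measure_isSigmaFinite.Build _ _ _ (@lebesgue_Rd d)
  (@lebesgue_Rd_sigma_finite d).
End LebesgueRd.
Arguments borelRd : clear implicits.
Arguments lebesgue_Rd : clear implicits.

Section FunctionSpaces.
Context {R : realType} {d : nat}.
Local Notation E := 'rV[R]_d.
Local Notation mu := (lebesgue_Rd R d).
Implicit Types (D : set E) (u v w phi : E -> R) (G : E -> E).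

(* The norm of the library on 'rV[R]_d is the maximum norm. *)
Definition enorm (x : E) : R := Num.sqrt (\sum_i x ord0 i ^+ 2).

Definition L2 D u : Prop :=
  measurable_fun (D : set (borelRd R d)) (u : borelRd R d -> R) /\
  (\int[mu]_(x in D) (u x ^+ 2)%:E < +oo)%E.

Definition ip D u v : R := \int[mu]_(x in D) (u x * v x).

Definition normL2 D u : R := Num.sqrt (ip D u u).

Definition normLinf D u : \bar R := ('N[mu]_(+oo)[EFin \o (u \_ D)])%E.

Definition ae_eq_on D u v : Prop := {ae mu, forall x, D x -> u x = v x}.

Definition L2_cvg D (us : nat -> E -> R) u : Prop :=
  (\int[mu]_(x in D) ((us k x - u x) ^+ 2)%:E @[k --> \oo] --> 0)%E.

Definition partial (i : 'I_d) u : E -> R := fun x => 'D_(delta_mx ord0 i) u x.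

Definition partials (s : seq 'I_d) u : E -> R := foldr partial u s.

Definition smooth u : Prop := forall s : seq 'I_d,
  continuous (partials s u) /\
  forall (i : 'I_d) (x : E), derivable (partials s u) x (delta_mx ord0 i).

Definition test_fun D phi : Prop :=
  smooth phi /\
  exists K : set E, [/\ compact K, K `<=` D & forall x, ~ K x -> phi x = 0].

(* [u] belongs to the H^1-closure of the test functions, with gradient [G]. *)
Definition H10_grad D u G : Prop :=
  [/\ L2 D u, forall i : 'I_d, L2 D (fun x => G x ord0 i) &
   exists phi : nat -> E -> R,
    [/\ forall k, test_fun D (phi k), L2_cvg D phi u &
     forall i, L2_cvg D (fun k => partial i (phi k)) (fun x => G x ord0 i)]].

(* Graph of A = - Laplacian with homogeneous Dirichlet condition:
   Dom A = {u in H^1_0 | Laplacian u in L^2}. *)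
Definition dirichlet_laplacian D u w : Prop :=
  L2 D w /\ exists G, H10_grad D u G /\
    forall phi, test_fun D phi ->
      \sum_(i < d) ip D (fun x => G x ord0 i) (partial i phi) = ip D w phi.

(* Graph of A^(1/2).  On a bounded domain the eigenfunctions of A are total in
   L^2, so A^(1/2) u = w means that the coefficient of w along each
   eigenfunction e of A, with A e = lam e, is sqrt lam times that of u. *)
Definition sqrt_laplacian D u w : Prop :=
  [/\ L2 D u, L2 D w &
   forall (lam : R) (e : E -> R),
     dirichlet_laplacian D e (fun x => lam * e x) ->
     ip D w e = Num.sqrt lam * ip D u e].

Definition dotH1 D u : Prop := exists w, sqrt_laplacian D u w.

(* The duality pairing of dotH^(-1) and dotH^1 extends the L^2 inner product. *)
Definition pairing D w v : R := ip D w v.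

Definition weak_grad D u G : Prop :=
  (forall i : 'I_d, measurable_fun (D : set (borelRd R d))
     ((fun x => G x ord0 i) : borelRd R d -> R)) /\
  forall phi (i : 'I_d), test_fun D phi ->
    ip D u (partial i phi) = - ip D (fun x => G x ord0 i) phi.

(* Equal to +oo when there is no essentially bounded weak gradient. *)
Definition grad_normLinf D u : \bar R :=
  ereal_inf [set normLinf D (fun x => enorm (G x)) | G in weak_grad D u].

Definition orthonormal_basis D (g : nat -> E -> R) : Prop :=
  [/\ forall m, L2 D (g m),
      forall m n, ip D (g m) (g n) = (m == n)%:R &
      forall u, L2 D u -> (forall m, ip D u (g m) = 0) -> ae_eq_on D u (fun=> 0)].

End FunctionSpaces.

Section Domain.
Context {R : realType} {d : nat}.
Local Notation E := 'rV[R]_d.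
Implicit Type D : set E.

Definition unit_cube (k : nat) : set 'rV[R]_k :=
  [set y | forall i, 0 <= y ord0 i <= 1].
Arguments unit_cube : clear implicits.

(* The boundary is a finite union of smoothly parametrized patches. *)
Definition piecewise_smooth_boundary D : Prop :=
  exists (N : nat) (phi : 'I_N -> 'rV[R]_d.-1 -> E),
    (forall k, [/\ forall i : 'I_d, smooth (fun y => phi k y ord0 i),
       {in unit_cube d.-1 &, injective (phi k)} &
       {in unit_cube d.-1, forall y, \rank (jacobian (phi k) y) = d.-1}]) /\
    closure D `\` D = \bigcup_k (phi k @` unit_cube d.-1).

Definition bounded_domain D : Prop :=
  [/\ open D, connected D, D !=set0, bounded_set D & piecewise_smooth_boundary D].

End Domain.

Section FiniteElements.
Context {R : realType} {d : nat}.
Local Notation E := 'rV[R]_d.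

Definition ref_simplex : set E :=
  [set x | (forall i, 0 <= x ord0 i) /\ \sum_i x ord0 i <= 1].

Definition barycentric (x : E) (j : option 'I_d) : R :=
  if j is Some i then x ord0 i else 1 - \sum_i x ord0 i.

Definition ref_face (J : set (option 'I_d)) : set E :=
  [set x | ref_simplex x /\ forall j, ~ J j -> barycentric x j = 0].

(* A cell is the image of the reference simplex under its cell map. *)
Record mesh := Mesh {
  ncells : nat;
  cell_map : 'I_ncells -> E -> E }.

Definition cell (T : mesh) (k : 'I_(ncells T)) : set E :=
  cell_map k @` ref_simplex.

Definition bilipschitz_on (S : set E) (f : E -> E) : Prop :=
  exists c C : R, [/\ 0 < c, 0 < C & forall x y, S x -> S y ->
    c * enorm (x - y) <= enorm (f x - f y) <= C * enorm (x - y)].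

Definition affine_on (S : set E) (f : E -> E) : Prop :=
  exists (B : 'M[R]_d) (b : E), forall x, S x -> f x = x *m B + b.

(* Face-to-face partition into simplices; since the boundary may be curved, the
   cells that meet it may be curved simplices. *)
Definition partition_of (D : set E) (T : mesh) : Prop :=
  [/\ forall k : 'I_(ncells T), bilipschitz_on ref_simplex (cell_map k),
      forall k : 'I_(ncells T), cell k `<=` D ->
        affine_on ref_simplex (cell_map k),
      \bigcup_(k : 'I_(ncells T)) cell k = closure D &
      forall k l : 'I_(ncells T), k != l ->
        exists J J' : set (option 'I_d),
          [/\ J <> setT, J' <> setT,
              cell k `&` cell l = cell_map k @` ref_face J &
              cell k `&` cell l = cell_map l @` ref_face J']].

Definition diameter (K : set E) : R :=
  sup [set r | exists x y, [/\ K x, K y & r = enorm (x - y)]].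

Definition mesh_size (T : mesh) (h : R) : Prop :=
  (forall k : 'I_(ncells T), diameter (cell k) <= h) /\
  exists k : 'I_(ncells T), diameter (cell k) = h.

Definition has_inball (K : set E) (r : R) : Prop :=
  exists x : E, [set y | enorm (y - x) < r] `<=` K.

(* [Hs] is the set of mesh sizes for which the family has a member. *)
Definition regular_quasiuniform_family (D : set E) (Hs : set R)
    (T : R -> mesh) : Prop :=
  [/\ Hs `<=` `]0, 1[,
      forall h, Hs h -> partition_of D (T h) /\ mesh_size (T h) h,
      exists2 sigma : R, 0 < sigma & forall h, Hs h ->
        forall k : 'I_(ncells (T h)),
          exists r, [/\ 0 < r, has_inball (cell k) r &
                     diameter (cell k) <= sigma * r] &
      exists2 kappa : R, 0 < kappa & forall h, Hs h ->
        forall k : 'I_(ncells (T h)), h <= kappa * diameter (cell k)].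

(* Elements of V_h are represented by their extension by zero to R^d. *)
Definition Vh (D : set E) (T : mesh) (v : E -> R) : Prop :=
  [/\ dotH1 D v, continuous v, forall x, ~ D x -> v x = 0 &
      forall k : 'I_(ncells T), exists (a : E) (b : R),
        forall x, cell k x -> v x = \sum_i a ord0 i * x ord0 i + b].

(* z = A_h y; gradients of elements of V_h are taken pointwise, which is
   meaningful in the interior of each cell. *)
Definition is_Ah (D : set E) (T : mesh) (y z : E -> R) : Prop :=
  Vh D T z /\ forall v, Vh D T v ->
    ip D z v = - (\sum_(i < d) ip D (partial i y) (partial i v)).

(* y = P_h w *)
Definition is_Ph (D : set E) (T : mesh) (w y : E -> R) : Prop :=
  Vh D T y /\ forall v, Vh D T v -> ip D y v = pairing D w v.

End FiniteElements.

Section Probability.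
Context {dO : measure_display} {Omega : measurableType dO} {R : realType}.
Variable P : probability Omega R.

Definition normal_filtration (F : R -> set (set Omega)) : Prop :=
  [/\ forall t, 0 <= t -> sigma_algebra setT (F t) /\ F t `<=` measurable,
      forall s t, 0 <= s <= t -> F s `<=` F t,
      forall t, 0 <= t -> \bigcap_(s in [set s | t < s]) F s `<=` F t &
      forall A, P.-negligible A -> F 0 A].

Definition sub_measurable (G : set (set Omega)) (X : Omega -> R) : Prop :=
  forall B : set R, measurable B -> G (X @^-1` B).

Definition is_cond_exp (G : set (set Omega)) (X Z : Omega -> R) : Prop :=
  [/\ P.-integrable setT (EFin \o X), sub_measurable G Z,
      P.-integrable setT (EFin \o Z) &
      forall A, G A ->
        (\int[P]_(w in A) (Z w)%:E = \int[P]_(w in A) (X w)%:E)%E].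

(* Independent standard Brownian motions relative to the filtration. *)
Definition brownian_family (F : R -> set (set Omega))
    (beta : nat -> R -> Omega -> R) : Prop :=
  [/\ forall m t, 0 <= t -> sub_measurable (F t) (beta m t),
      forall m, {ae P, forall w, beta m 0 w = 0},
      forall m, {ae P, forall w,
        {within `[0, +oo[, continuous (fun t => beta m t w)}},
      forall m s t (B : set R), 0 <= s < t -> measurable B ->
        P [set w | B (beta m t w - beta m s w)] =
        normal_prob 0 (Num.sqrt (t - s)) B &
      forall s t (M : nat) (A : set Omega) (B : nat -> set R),
        0 <= s < t -> F s A -> (forall m, measurable (B m)) ->
        fine (P (A `&` \bigcap_(m in `I_M)
                   [set w | B m (beta m t w - beta m s w)])) =
        fine (P A) *
        \prod_(m < M) fine (P [set w | B m (beta m t w - beta m s w)])].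

End Probability.

Section Noise.
Context {R : realType} {d : nat}.
Local Notation E := 'rV[R]_d.
Local Notation mu := (lebesgue_Rd R d).
Implicit Types (D : set E) (qe : nat -> R) (ge : nat -> E -> R).

(* Self-adjoint positive semidefinite trace-class operators on L^2, acting on
   representatives, with eigenpairs (qe m, ge m). *)
Definition covariance_operator D (Q : (E -> R) -> E -> R) qe ge : Prop :=
  [/\ [/\ forall u, L2 D u -> L2 D (Q u),
          forall u v, L2 D u -> L2 D v -> ae_eq_on D u v ->
            ae_eq_on D (Q u) (Q v) &
          forall (a : R) u v, L2 D u -> L2 D v ->
            ae_eq_on D (Q (fun x => a * u x + v x))
                       (fun x => a * Q u x + Q v x)],
      forall u v, L2 D u -> L2 D v -> ip D (Q u) v = ip D u (Q v),
      forall u, L2 D u -> 0 <= ip D (Q u) u,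
      orthonormal_basis D ge /\
        (forall m, ae_eq_on D (Q (ge m)) (fun x => qe m * ge m x)) &
      (\sum_(0 <= m <oo) (ip D (Q (ge m)) (ge m))%:E < +oo)%E].

Definition CQ D qe ge : \bar R :=
  (\sum_(0 <= m <oo) (qe m)%:E * normLinf D (ge m) ^+ 2)%E.

Definition noise_regularity D qe ge : Prop :=
  (CQ D qe ge < +oo)%E /\
  (\sum_(0 <= m <oo) (qe m)%:E * grad_normLinf D (ge m) ^+ 2 < +oo)%E.

(* The functions sqrt (qe m) ge m with qe m != 0 form an orthonormal basis of
   U_0 = Q^(1/2) U. *)
Definition HS_norm2 D qe ge (L : (E -> R) -> E -> R) : \bar R :=
  (\sum_(0 <= m <oo)
     \int[mu]_(x in D) (L (fun y => Num.sqrt (qe m) * ge m y) x ^+ 2)%:E)%E.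

Definition hilbert_schmidt D qe ge (L : (E -> R) -> E -> R) : Prop :=
  (forall m, L2 D (L (fun y => Num.sqrt (qe m) * ge m y))) /\
  (HS_norm2 D qe ge L < +oo)%E.

Context {dO : measure_display} {Omega : measurableType dO}.
Variable P : probability Omega R.

(* Measurability for the Borel sets of the separable space L^2, which are
   generated by the open balls. *)
Definition L2_random_variable D (G : set (set Omega)) (X : Omega -> E -> R) :=
  (forall w, L2 D (X w)) /\
  forall a r, L2 D a -> G [set w | normL2 D (fun x => X w x - a x) < r].

Definition Q_wiener D (F : R -> set (set Omega)) qe ge
    (beta : nat -> R -> Omega -> R) (W : R -> Omega -> E -> R) : Prop :=
  [/\ brownian_family P F beta,
      forall t, 0 <= t -> L2_random_variable D (F t) (W t),
      {ae P, forall w, forall t, 0 <= t ->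
        normL2 D (fun x => W s w x - W t w x)
          @[s --> within [set s | 0 <= s] (nbhs t)] --> 0} &
      forall t, 0 <= t ->
        (\int[P]_w ((normL2 D (fun x => W t w x -
            \sum_(m < M) Num.sqrt (qe m) * beta m t w * ge m x)%R) ^+ 2)%:E
          @[M --> \oo] --> 0)%E].

Definition Lp_initial D (F : R -> set (set Omega)) (p : R)
    (X0 : Omega -> E -> R) : Prop :=
  L2_random_variable D (F 0) X0 /\
  (\int[P]_w (normL2 D (X0 w) `^ p)%:E < +oo)%E.

End Noise.

Section Equation.
Context {R : realType} {d : nat}.
Local Notation E := 'rV[R]_d.

Definition C1 (f : R -> R) : Prop :=
  (forall x, derivable f x 1) /\ continuous (derive1 f).

Definition coefficient_assumption (cQ p q : R) (f g : R -> R) : Prop :=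
  [/\ C1 f, C1 g & exists L0 L1 L2 L3 L4 L5 : R,
    [/\ 0 < L2, 0 <= L3, 0 <= L4, 0 <= L5 &
     [/\ forall x y, 2 * (x - y) * (f x - f y) + cQ * (p - 1) * `|g x - g y| ^+ 2
                       <= L0 * `|x - y| ^+ 2,
         forall x, derive1 f x <= L1 - L2 * `|x| `^ q,
         forall x, `|derive1 f x| <= L3 * (1 + `|x| `^ q) &
         forall x, `|derive1 g x| ^+ 2 <= L4 + L5 * `|x| `^ (q / 2)]]].

Definition F_op (ft : R -> R) (u : E -> R) : E -> R := fun x => ft (u x).

Definition G_op (gt : R -> R) (u : E -> R) (z : E -> R) : E -> R :=
  fun x => gt (u x) * z x.

Definition tamed_dissipativity (D : set E) (qe : nat -> R) (ge : nat -> E -> R)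
    (p : R) (ft gt : R -> R -> R) : Prop :=
  exists tau0 N0 N0s : R, [/\ 0 < tau0 <= 1, 0 < N0s &
    forall tau u, 0 < tau < tau0 -> dotH1 D u ->
      [/\ L2 D (F_op (ft tau) u), hilbert_schmidt D qe ge (G_op (gt tau) u) &
          2 * pairing D (F_op (ft tau) u) u
            + tau * normL2 D (F_op (ft tau) u) ^+ 2
            + (p - 1) * fine (HS_norm2 D qe ge (G_op (gt tau) u))
          <= N0 - N0s * normL2 D u ^+ 2]].

Context {dO : measure_display} {Omega : measurableType dO}.
Variable P : probability Omega R.

Definition tamed_FEM (D : set E) (T : mesh) (tau : R) (ft gt : R -> R)
    (W : R -> Omega -> E -> R) (X0 : Omega -> E -> R)
    (Y : nat -> Omega -> E -> R) : Prop :=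
  [/\ forall n w, Vh D T (Y n w),
      {ae P, forall w, is_Ph D T (X0 w) (Y 0%N w)} &
      forall n, (0 < n)%N -> {ae P, forall w,
        exists a b c : E -> R,
          [/\ is_Ah D T (Y n w) a,
              is_Ph D T (F_op ft (Y n.-1 w)) b,
              is_Ph D T (G_op gt (Y n.-1 w)
                (fun x => W (n%:R * tau) w x - W (n.-1%:R * tau) w x)) c &
              forall x, Y n w x =
                Y n.-1 w x + tau * a x + tau * b x + c x]}].

End Equation.

(* Main.v *)
(* In an L^2-orthonormal basis of V_h the scheme becomes a finite-dimensional
   recursion.  As A_h is nonpositive, the implicit part of a step does not
   increase the norm of the explicit part y + tau F(y) + G(y) dW.  Given the past,
   the latter is a Gaussian perturbation a + xi of a = y + tau F(y), for which
     E (|a + xi|^2)^(p/2) <= (|a|^2 + (p - 1) E |xi|^2)^(p/2);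
   this is proved one Brownian motion at a time, by exhibiting a supermartingale,
   and extended to the whole noise by Fatou's lemma.  Dissipativity bounds the
   right-hand side by ((1 - N0s tau) |y|^2 + N0 tau)^(p/2), and convexity of
   x^(p/2) with weights 1 - N0s tau and N0s tau gives the claim with T2 = N0s. *)

Require Import Defs.
From HB Require Import structures.
From mathcomp Require Import all_boot all_order all_algebra.
From mathcomp Require Import all_classical all_reals all_analysis.
From mathcomp Require Import measurable_realfun ring lra.
Set Implicit Arguments.
Unset Strict Implicit.
Unset Printing Implicit Defensive.
Import Order.TTheory GRing.Theory Num.Theory.
Import numFieldNormedType.Exports.
Local Open Scope classical_set_scope.
Local Open Scope ring_scope.

(** * Moments of Gaussian perturbations *)

(** The moment bound must carry exactly the factor p - 1 of the dissipativity hypothesis; a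
    Burkholder-type constant could not be absorbed there. This is why a supermartingale is built by
    hand, with [r = p / 2] and [2 r - 1 = p - 1]. Three obstacles shape the rest. The series of W
    converges only in mean square, while G(y) multiplies it by a possibly unbounded function of x;
    the coordinates of G(y) dW are therefore reached along a subsequence fast enough for dominated
    convergence in x. Adaptedness is no clause of [tamed_FEM]: it is derived by induction on the
    step, and since the scheme holds only almost surely, this rests on the null sets contained in
    the filtration. Finally, gradients are pointwise, with a default value where a derivative fails
    to exist, and cells may be curved; the discrete Laplacian is controlled through the affine
    slopes on the cells. The conditional inequality is recovered by integrating over every event of
    the past, so the moment estimates are stated over an event [A]. *)

Lemma Rintegral_derivative_eq0 (R : realType) (g G : R -> R) :
  (forall x : R, is_derive x (1 : R) G (g x)) -> continuous g ->
  lebesgue_measure.-integrable setT (EFin \o g) ->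
  G n%:R @[n --> \oo] --> 0 -> G (- n%:R) @[n --> \oo] --> 0 ->
  \int[lebesgue_measure]_x g x = 0.
Proof.
move=> dG cg ig Gp Gm.
pose B (n : nat) : set R := `[- n%:R, n%:R]%classic.
pose f_ n : R -> \bar R := (EFin \o g) \_ (B n).
have mg : measurable_fun setT (EFin \o g) by exact: measurable_int ig.
have mB n : measurable (B n : set (measurableTypeR R)) by exact: measurable_itv.
have cG : continuous G.
  move=> x; apply/differentiable_continuous/derivable1_diffP.
  exact: (@ex_derive _ _ _ _ _ _ _ (dG x)).
have [] := @dominated_convergence _ _ _ (@lebesgue_measure R) setT measurableT
  f_ (EFin \o g) (abse \o (EFin \o g)).
- move=> n; apply/(measurable_restrictT _ (mB n)) => //.
  exact: measurable_funTS.
- exact: mg.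
- apply: aeW => x _; apply: cvg_near_cst.
  near=> n; rewrite /f_ patchE mem_set//=.
  rewrite /B/= in_itv/= -ler_norml.
  near: n; exact: nbhs_infty_ger.
- exact: integrable_abse.
- apply: aeW => x n _; rewrite /f_ patchE; case: ifP => _ //=.
  by rewrite normr0 lee_fin normr_ge0.
- move=> _ _ cv.
(* The index starts at 1 because the fundamental theorem of calculus is applied on a nondegenerate
   interval. *)
have intB n : (\int[lebesgue_measure]_x f_ n.+1 x =
    (G n.+1%:R - G (- n.+1%:R))%:E)%E.
  rewrite /f_ -integral_mkcond /= EFinB.
  rewrite (@continuous_FTC2 _ g G)//.
  - by rewrite ltrNl (lt_trans _ (ltr0Sn _ _))// oppr_lt0 ltr0Sn.
  - exact: continuous_subspaceT.
  - split; [move=> x _; exact: (@ex_derive _ _ _ _ _ _ _ (dG x))| |];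
      [exact/cvg_at_right_filter/cG|exact/cvg_at_left_filter/cG].
  - by move=> x _; rewrite derive1E; exact: (@derive_val _ _ _ _ _ _ _ (dG x)).
have cv2 : (\int[lebesgue_measure]_x f_ n.+1 x)%E @[n --> \oo] --> 0%E.
  under eq_fun do rewrite intB.
  apply: cvg_EFin; first exact: nearW.
  rewrite /comp/= -(subr0 0).
  move: Gp Gm; rewrite -(cvg_shiftS (fun n => G n%:R)).
  rewrite -(cvg_shiftS (fun n => G (- n%:R))); exact: cvgB.
have cv1 := cv; rewrite -cvg_shiftS in cv1.
have e : (\int[lebesgue_measure]_x (EFin \o g) x)%E = 0%E.
  exact: cvg_unique cv1 cv2.
by rewrite /Rintegral e.
Unshelve. all: by end_near. Qed.

(** The change of variables produces a Radon-Nikodym derivative; it agrees almost everywhere with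
    [normal_pdf] because both have the same integral over every measurable set. *)
Lemma ge0_integral_normal_prob (R : realType) (s : R) (f : R -> \bar R) :
  s != 0 -> measurable_fun setT f -> (forall x, 0 <= f x)%E ->
  (\int[normal_prob 0 s]_x f x =
   \int[lebesgue_measure]_x (f x * (normal_pdf 0 s x)%:E))%E.
Proof.
move=> s0 mf f0.
have dom := @normal_prob_dominates R 0 s.
rewrite -(Radon_Nikodym_SigmaFinite.change_of_variables dom)//.
apply: ge0_ae_eq_integral => //.
- apply: emeasurable_funM => //; apply: measurable_int.
  exact: Radon_Nikodym_SigmaFinite.f_integrable.
- apply: emeasurable_funM => //; apply/measurableT_comp => //.
  exact: measurable_normal_pdf.
- by move=> x _; rewrite mule_ge0//; exact: Radon_Nikodym_SigmaFinite.f_ge0.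
- by move=> x _; rewrite mule_ge0// lee_fin normal_pdf_ge0.
- apply: ae_eqe_mul2l; apply: integral_ae_eq => //=.
  + exact: Radon_Nikodym_SigmaFinite.f_integrable.
  + by apply/measurableT_comp => //; exact: measurable_normal_pdf.
  + by move=> E _ mE; rewrite -Radon_Nikodym_SigmaFinite.f_integral.
Qed.

Lemma quadratic_ge0 (R : realFieldType) (a b c y : R) : 0 <= a -> 0 <= c ->
  b ^+ 2 <= a * c -> 0 <= a + 2 * b * y + c * y ^+ 2.
Proof.
move=> a0 c0 bac; have [c1|] := ltP 0 c.
  rewrite -(pmulr_rge0 _ c1).
  have -> : c * (a + 2 * b * y + c * y ^+ 2) =
    (b + c * y) ^+ 2 + (a * c - b ^+ 2) by ring.
  by rewrite addr_ge0 ?sqr_ge0// subr_ge0.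
move=> c1; have c2 : c = 0 by apply/eqP; rewrite eq_le c1 c0.
have b0 : b = 0.
  by apply/eqP; rewrite -sqrf_eq0 eq_le sqr_ge0 andbT (le_trans bac)// c2 mulr0.
by rewrite b0 c2 mulr0 !mul0r !addr0.
Qed.

(** * Polynomial growth against a Gaussian density *)

Section gaussian_weight.
Context {R : realType}.
Variables (s : R) (s0 : 0 < s).
Local Notation mu := (@lebesgue_measure R).

(** Equals [(1 + x^2) (C (1 + x^2))^r], with the power spelled as in [E] below. It is the common
    majorant, up to constants, of [E], of its derivative in [u] and of the field used in the
    integration by parts. *)
Definition growth (C r x : R) := (1 + x ^+ 2) * expR (r * ln (C * (1 + x ^+ 2))).

Lemma growth_ge0 C r x : 0 <= growth C r x.
Proof. by rewrite mulr_ge0 ?expR_ge0// addr_ge0 ?sqr_ge0. Qed.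

(** Doubling the standard deviation leaves room in the exponent: with [X = 1 / (8 s^2)] the two
    Gaussians have exponents [-4 X x^2] and [-X x^2], and the logarithm of the polynomial factor
    costs only [X x^2] plus a constant. *)
Lemma growth_normal_pdf_le C r : 0 < C -> 0 <= r -> exists2 M, 0 <= M &
  forall x, growth C r x * normal_pdf 0 s x <= M * normal_fun 0 (2 * s) x.
Proof.
(* Chosen so that [(r + 1) ln (eta (1 + x^2))] is at most [X (1 + x^2)] by [ln y < y]. *)
move=> C0 r0; pose eta := 8^-1 / (s ^+ 2 * (r + 1)).
have eta0 : 0 < eta by rewrite divr_gt0// mulr_gt0 ?exprn_gt0// ltr_wpDl.
exists (expR (r * ln C + (8^-1 / s ^+ 2) - (r + 1) * ln eta) * normal_peak s).
  by rewrite mulr_ge0 ?expR_ge0 ?normal_peak_ge0.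
move=> x; rewrite normal_pdfE ?gt_eqF// /growth.
have y0 : 0 < 1 + x ^+ 2 by rewrite ltr_pwDl// sqr_ge0.
rewrite mulrCA -[leRHS]mulrA [leRHS]mulrCA ler_wpM2l ?normal_peak_ge0//.
rewrite /normal_fun subr0 -{1}(lnK y0) -!expRD ler_expR.
rewrite lnM ?posrE//.
have : ln (eta * (1 + x ^+ 2)) < eta * (1 + x ^+ 2).
  by apply: ln_sublinear; rewrite mulr_gt0.
rewrite lnM ?posrE// => h.
have h2 : (r + 1) * (ln eta + ln (1 + x ^+ 2)) <= 8^-1 / s ^+ 2 * (1 + x ^+ 2).
  have -> : 8^-1 / s ^+ 2 * (1 + x ^+ 2) = (r + 1) * (eta * (1 + x ^+ 2)).
    by rewrite /eta; field; rewrite !gt_eqF// ltr_wpDl.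
  by rewrite ler_wpM2l ?addr_ge0// ltW.
have -> : - x ^+ 2 / (s ^+ 2 *+ 2) = - (4 * (8^-1 / s ^+ 2 * x ^+ 2)).
  by field; rewrite gt_eqF.
have -> : - x ^+ 2 / ((2 * s) ^+ 2 *+ 2) = - (8^-1 / s ^+ 2 * x ^+ 2).
  by field; rewrite gt_eqF.
have : 0 <= 8^-1 / s ^+ 2 * x ^+ 2 by rewrite mulr_ge0 ?sqr_ge0// divr_ge0 ?sqr_ge0.
by move: h2; set X := 8^-1 / s ^+ 2; set L := ln (1 + _); lra.
Qed.

Lemma continuous_growth C r : 0 < C -> continuous (growth C r).
Proof.
move=> C0; suff d (x : R) : derivable (growth C r) x (1 : R).
  by move=> x; exact/differentiable_continuous/derivable1_diffP/d.
have y0 : 0 < C * (1 + x ^+ 2).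
  by rewrite mulr_gt0// ltr_pwDl// sqr_ge0.
have dQ : is_derive x (1 : R) (fun x => C * (1 + x ^+ 2)) (2 * C * x).
  by apply: is_derive_eq; rewrite /GRing.scale/=; ring.
have dl := @is_derive1_comp _ _ (fun x => C * (1 + x ^+ 2)) _ _ _
  (is_derive1_ln y0) dQ.
by apply: ex_derive.
Qed.

Lemma integrable_growth C r : 0 < C -> 0 <= r ->
  mu.-integrable setT (fun x => (growth C r x * normal_pdf 0 s x)%:E).
Proof.
move=> C0 r0; have [M M0 HM] := growth_normal_pdf_le C0 r0.
have s2 : 2 * s != 0 by rewrite gt_eqF// mulr_gt0.
apply: (@le_integrable _ _ R mu setT measurableT _
    (fun x : R => ((M / normal_peak (2 * s))%:E * (normal_pdf 0 (2 * s) x)%:E)%E)) => //.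
- apply/measurable_EFinP/measurable_funM; last exact: measurable_normal_pdf.
  apply: continuous_measurable_fun; exact: continuous_growth.
- move=> x _ /=; rewrite lee_fin !ger0_norm.
  + rewrite (le_trans (HM x))// normal_pdfE// mulrA divfK//.
    by rewrite gt_eqF// normal_peak_gt0.
  + by rewrite mulr_ge0 ?normal_pdf_ge0// divr_ge0// normal_peak_ge0.
  + by rewrite mulr_ge0 ?normal_pdf_ge0 ?growth_ge0.
- by apply: integrableZl => //; exact: integrable_normal_pdf.
Qed.

Lemma cvg_normal_fun : normal_fun 0 s n%:R @[n --> \oo] --> 0.
Proof.
have h (n : nat) : 0 <= normal_fun 0 s n%:R <= expR (- n%:R * (s ^+ 2 *+ 2)^-1).
  rewrite expR_ge0/= ler_expR subr0 ler_wpM2r ?invr_ge0 ?mulrn_wge0 ?sqr_ge0//.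
  by rewrite lerN2 -natrX ler_nat; case: n => // n; rewrite expnS leq_pmulr.
apply: (@squeeze_cvgr _ _ _ _ (fun=> 0) (fun n => expR (- n%:R * (s ^+ 2 *+ 2)^-1))).
- exact: nearW.
- exact: cvg_cst.
- have c0 : 0 < (s ^+ 2 *+ 2)^-1 by rewrite invr_gt0 mulrn_wgt0// exprn_gt0.
  under eq_fun do rewrite mulNr.
  apply: (@cvg_comp _ _ _ (fun n : nat => n%:R : R)
    (fun x => expR (- (x * (s ^+ 2 *+ 2)^-1))) _ (pinfty_nbhs R)).
    exact: cvgr_idn.
  apply: (@cvg_comp _ _ _ (fun x : R => x * (s ^+ 2 *+ 2)^-1)
    (fun x => expR (- x)) _ (pinfty_nbhs R)); last exact: cvgr_expR.
  exact: (gt0_cvgMly c0 cvg_id).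
Qed.

End gaussian_weight.

(** * The one-dimensional Gaussian moment inequality *)

Section gaussian_quadratic.
Context {R : realType}.
Variables (s r a b c e : R).
Hypotheses (s0 : 0 < s) (r1 : 1 <= r) (a0 : 0 <= a) (c0 : 0 <= c)
  (bac : b ^+ 2 <= a * c) (e0 : 0 < e).
Local Notation mu := (@lebesgue_measure R).
Local Notation phi := (normal_pdf 0 s).

Let K := (2 * r - 1) * s ^+ 2 * c.

Let K0 : 0 <= K.
Proof. by rewrite mulr_ge0// mulr_ge0 ?sqr_ge0//; have := r1; lra. Qed.

(* With B a Brownian motion of variance s^2, the r-th power of
   q (t, B_t) = a + e + 2 b B_t + c B_t^2 + (2 r - 1) s^2 c (1 - t) is a
   supermartingale; Q u x is q at time u^2 in the state u x. *)
Let Q (u x : R) : R :=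
  a + e + 2 * b * u * x + c * u ^+ 2 * x ^+ 2 + K * (1 - u ^+ 2).
Let B (u x : R) : R := b + c * u * x.
Let E (u x : R) : R := expR (r * ln (Q u x)).
(** Differentiation under the integral takes place on an open interval containing [[0, 1]]. Past
    [u = 1] the term [K (1 - u^2)] turns negative; [v] is close enough to 1 for it to stay above
    [- e / 2], so half of the regularization [e] keeps [Q] away from 0. *)
Let v : R := 1 + e / (6 * (K + 1) + e).

Let v1 : 1 < v.
Proof. by rewrite ltrDl divr_gt0//; have := K0; have := e0; lra. Qed.

Let Kv (u : R) : -1 < u < v -> - (e / 2) <= K * (1 - u ^+ 2).
Proof.
move=> /andP[u1 uv]; have k1 : 0 < 6 * (K + 1) + e by have := K0; have := e0; lra.
have [u1'|u1'] := leP u 1.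
  have : 0 <= K * (1 - u ^+ 2) by rewrite mulr_ge0//; nra.
  by have := e0; lra.
pose d := v - 1; have d1 : 0 < d by rewrite subr_gt0.
have dE : d * (6 * (K + 1) + e) = e by rewrite /d /v addrC addKr divfK// gt_eqF.
have d2 : d < 1 by rewrite /d /v addrC addKr ltr_pdivrMr//; have := K0; lra.
have ud : u < 1 + d by rewrite /d addrC subrK.
have h : u ^+ 2 - 1 <= 3 * d by nra.
have : K * (u ^+ 2 - 1) <= K * (3 * d) by rewrite ler_wpM2l.
have : 6 * (K * d) <= e by have := mulr_gt0 d1 e0; lra.
by lra.
Qed.

Let u_abs (u : R) : -1 < u < v -> `|u| <= 2.
Proof.
move=> /andP[u1 uv]; have : v <= 2.
  rewrite /v; have : e / (6 * (K + 1) + e) <= 1.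
    by rewrite ler_pdivrMr; have := K0; have := e0; try lra.
  by lra.
by rewrite ler_norml; lra.
Qed.

Let u_sqr (u : R) : -1 < u < v -> u ^+ 2 <= 4.
Proof. by move=> /u_abs h; rewrite -real_normK ?num_real//; have := normr_ge0 u; nra. Qed.

Let Q_ge (u x : R) : -1 < u < v -> e / 2 <= Q u x.
Proof.
move=> /Kv; rewrite /Q; have := quadratic_ge0 (u * x) a0 c0 bac.
rewrite exprMn !mulrA; lra.
Qed.

Let Q_gt0 (u x : R) : -1 < u < v -> 0 < Q u x.
Proof. by move=> /Q_ge => /(_ x); apply: lt_le_trans; rewrite divr_gt0. Qed.

Let B2_le (u x : R) : -1 < u <= 1 -> B u x ^+ 2 <= c * Q u x.
Proof.
move=> /andP[u1 u2].
have -> : c * Q u x = B u x ^+ 2 + (a * c - b ^+ 2) + c * e + c * K * (1 - u ^+ 2).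
  by rewrite /Q /B; ring.
have : 0 <= c * K * (1 - u ^+ 2).
  by rewrite mulr_ge0 ?(mulr_ge0 c0)//; move: u1 u2; nra.
have : 0 <= c * e by rewrite mulr_ge0// ltW.
have := bac; lra.
Qed.

(** Crude constants read off from [|u| <= 2]: [C1] bounds [Q] and [C2] bounds [B] as well as the
    [u]-derivative of [Q], each relative to [1 + x^2]. *)
Let C1 := a + e + 2 * `|b| + 4 * c + K.
Let C2 := 2 * `|b| + 4 * c + 4 * K.

Let C1_gt0 : 0 < C1.
Proof. by have := e0; have := a0; have := c0; have := K0; have := normr_ge0 b; rewrite /C1; lra. Qed.

Let C2_ge0 : 0 <= C2.
Proof. by have := c0; have := K0; have := normr_ge0 b; rewrite /C2; lra. Qed.

Let bx_le x : `|b * x| *+ 2 <= `|b| * (1 + x ^+ 2).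
Proof.
rewrite normrM -mulrnAr ler_wpM2l// -(@real_normK _ x) ?num_real//.
by have := sqr_ge0 (`|x| - 1); nra.
Qed.

Let cux_le (u x : R) : -1 < u < v -> `|c * u * x ^+ 2| <= 2 * c * (1 + x ^+ 2).
Proof.
move=> /u_abs hu; rewrite 2!normrM (ger0_norm c0) (@ger0_norm _ (x ^+ 2)) ?sqr_ge0//.
rewrite mulrC [leRHS]mulrC; have := sqr_ge0 x; have := c0; move: hu.
set y := x ^+ 2; set w := `|u| => hu c0' y0.
have : c * w <= 2 * c by nra.
have : 0 <= c * w by rewrite mulr_ge0// normr_ge0.
by nra.
Qed.

Let Q_le (u x : R) : -1 < u < v -> Q u x <= C1 * (1 + x ^+ 2).
Proof.
move=> uv; have hu := u_abs uv; have hu2 := u_sqr uv.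
have x0 := sqr_ge0 x.
have h1 : 2 * b * u * x <= 2 * `|b| * (1 + x ^+ 2).
  apply: (le_trans (ler_norm _)).
  have -> : 2 * b * u * x = u * ((b * x) *+ 2) by ring.
  rewrite normrM normrMn -mulrA.
  by apply: ler_pM => //; rewrite mulrn_wge0.
have h2 : c * u ^+ 2 * x ^+ 2 <= 4 * c * (1 + x ^+ 2).
  have : c * u ^+ 2 <= 4 * c by have := c0; nra.
  by have := c0; nra.
have h3 : K * (1 - u ^+ 2) <= K * (1 + x ^+ 2).
  by rewrite ler_wpM2l//; have := sqr_ge0 u; lra.
have h4 : a + e <= (a + e) * (1 + x ^+ 2) by have := a0; have := e0; nra.
rewrite /Q /C1 !mulrDl; move: h1 h2 h3 h4; rewrite !mulrDl; lra.
Qed.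

Let xB_le (u x : R) : -1 < u < v -> 2 * `|x * B u x| + 2 * K * `|u| <= C2 * (1 + x ^+ 2).
Proof.
move=> uv; have hu := u_abs uv; have h1 := bx_le x; have h2 := cux_le x uv.
have h3 : `|x * B u x| <= `|b * x| + `|c * u * x ^+ 2|.
  have -> : x * B u x = b * x + c * u * x ^+ 2 by rewrite /B; ring.
  exact: ler_normD.
have h4 : K * `|u| <= 2 * K * (1 + x ^+ 2).
  by have := sqr_ge0 x; have := K0; have := normr_ge0 u; nra.
by rewrite /C2 !mulrDl; move: h1 h2 h3 h4; have := c0; have := normr_ge0 b; have := sqr_ge0 x; nra.
Qed.

Let r0 : 0 <= r. Proof. exact: le_trans r1. Qed.

Let E_le (u x : R) : -1 < u < v -> (1 + x ^+ 2) * E u x <= growth C1 r x.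
Proof.
move=> uv; rewrite /growth ler_wpM2l ?addr_ge0 ?sqr_ge0// ler_expR ler_wpM2l//.
rewrite ler_ln ?posrE ?Q_gt0 ?Q_le//.
by rewrite (lt_le_trans (Q_gt0 x uv))// Q_le.
Qed.

Let E_le1 (u x : R) : -1 < u < v -> E u x <= growth C1 r x.
Proof.
move=> uv; apply: le_trans (E_le x uv).
by rewrite ler_peMl ?expR_ge0// lerDl sqr_ge0.
Qed.

Let invQ_le (u x : R) : -1 < u < v -> (Q u x)^-1 <= 2 / e.
Proof.
move=> uv; rewrite -[leRHS]invrK invf_div lef_pV2 ?posrE ?divr_gt0 ?Q_gt0//.
exact: Q_ge.
Qed.

Let dE_x (u x : R) : -1 < u < v ->
  is_derive x (1 : R) (E u) (E u x * r * (2 * u * B u x) / Q u x).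
Proof.
move=> uv; have dQ : is_derive x (1 : R) (Q u) (2 * u * B u x).
  by rewrite /Q; apply: is_derive_eq; rewrite /GRing.scale/= /B; ring.
have dl := is_derive1_comp (is_derive1_ln (Q_gt0 x uv)) dQ.
have dr : is_derive x (1 : R) (fun y => r * ln (Q u y)) (r * ((Q u x)^-1 * (2 * u * B u x))).
  exact: is_deriveZ.
have de := is_derive1_comp (is_derive_expR _) dr.
by apply: is_derive_eq; rewrite /E; ring.
Qed.

Let dE_u (u x : R) : -1 < u < v ->
  is_derive u (1 : R) (E ^~ x) (E u x * r * (2 * x * B u x - 2 * K * u) / Q u x).
Proof.
move=> uv; have dQ : is_derive u (1 : R) (Q ^~ x) (2 * x * B u x - 2 * K * u).
  by rewrite /Q; apply: is_derive_eq; rewrite /GRing.scale/= /B; ring.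
have dl := @is_derive1_comp _ _ (Q ^~ x) _ _ _ (is_derive1_ln (Q_gt0 x uv)) dQ.
have dr : is_derive u (1 : R) (fun y => r * ln (Q y x)) (r * ((Q u x)^-1 * (2 * x * B u x - 2 * K * u))).
  exact: is_deriveZ.
have de := is_derive1_comp (is_derive_expR _) dr.
by apply: is_derive_eq; rewrite /E; ring.
Qed.

(** The field for Gaussian integration by parts: [x * h u x] is the part of the [u]-derivative of
    [E] that carries the factor [x]. *)
Let h (u x : R) := 2 * r * (E u x * B u x / Q u x).
Let dh (u x : R) :=
  2 * r * (E u x / Q u x ^+ 2 * (u * (2 * (r - 1) * B u x ^+ 2 + c * Q u x))).

Let dh_x (u x : R) : -1 < u < v -> is_derive x (1 : R) (h u) (dh u x).
Proof.
move=> uv; have Q0 : Q u x != 0 by rewrite gt_eqF// Q_gt0.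
have dQ : is_derive x (1 : R) (Q u) (2 * u * B u x).
  by rewrite /Q; apply: is_derive_eq; rewrite /GRing.scale/= /B; ring.
have dB : is_derive x (1 : R) (B u) (c * u).
  by rewrite /B; apply: is_derive_eq; rewrite /GRing.scale/=; ring.
have dV : is_derive x (1 : R) (fun y => (Q u y)^-1) (- (Q u x) ^- 2 * (2 * u * B u x)).
  exact: is_deriveV.
have dE := dE_x x uv.
rewrite /h; apply: is_derive_eq; rewrite /dh /GRing.scale/=; field.
exact: Q0.
Qed.

Let dphi (x : R) : is_derive x (1 : R) phi (- (x / s ^+ 2) * phi x).
Proof.
have s1 : s != 0 by rewrite gt_eqF.
rewrite normal_pdfE//.
have d : is_derive x (1 : R) (fun x => - (x - 0) ^+ 2 / (s ^+ 2 *+ 2)) (- (x / s ^+ 2)).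
  apply: is_derive_eq; rewrite /GRing.scale/=; field; exact: s1.
have de := @is_derive1_comp _ _ (fun x => - (x - 0) ^+ 2 / (s ^+ 2 *+ 2)) _ _ _
   (is_derive_expR _) d.
have dz := is_deriveZ (normal_peak s) de.
apply: (@is_derive_eq _ _ _ _ _ _ _ _ dz); rewrite /GRing.scale/= /normal_fun; ring.
Qed.

Let E_ge0 (u x : R) : 0 <= E u x. Proof. exact: expR_ge0. Qed.

Let E_bound (u x A : R) : -1 < u < v -> 0 <= A -> A <= C2 * (1 + x ^+ 2) ->
  E u x * A / Q u x <= C2 * (2 / e) * growth C1 r x.
Proof.
move=> uv A0 AC.
have : E u x * A / Q u x <= E u x * (C2 * (1 + x ^+ 2)) * (2 / e).
  apply: ler_pM; rewrite ?invr_ge0 ?(ltW (Q_gt0 x uv)) ?mulr_ge0// ?invQ_le//.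
  by rewrite ler_wpM2l.
move/le_trans; apply.
have -> : E u x * (C2 * (1 + x ^+ 2)) * (2 / e) =
  C2 * (2 / e) * ((1 + x ^+ 2) * E u x) by ring.
by rewrite ler_wpM2l ?E_le// mulr_ge0// divr_ge0// ltW.
Qed.

Let h_le (u x : R) : -1 < u < v -> `|h u x| <= 2 * r * (C2 * (2 / e) * growth C1 r x).
Proof.
move=> uv; rewrite /h normrM (@ger0_norm _ (2 * r)) ?mulr_ge0//.
rewrite ler_wpM2l ?mulr_ge0//.
rewrite normrM normfV normrM (ger0_norm (E_ge0 u x)) (gtr0_norm (Q_gt0 x uv)).
apply: E_bound => //; rewrite /B.
apply: (le_trans (ler_normD _ _)).
rewrite 2!normrM (ger0_norm c0) /C2.
have := u_abs uv; have := normr_ge0 x; have := normr_ge0 b; have := c0; have := K0.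
have := normr_ge0 u.
rewrite -(@real_normK _ x) ?num_real//; set X := `|x|; set U := `|u|; set bb := `|b|.
move=> U0 k0 cc b0 X0 U2.
have : U * X <= 2 * X by rewrite ler_wpM2r.
have : 2 * X <= 1 + X ^+ 2 by have := sqr_ge0 (X - 1); lra.
move=> h1 h2.
have h3 : c * U * X <= c * (1 + X ^+ 2) by rewrite -mulrA ler_wpM2l//; lra.
have h4 : bb <= bb * (1 + X ^+ 2) by rewrite ler_peMr// lerDl sqr_ge0.
have h5 : 0 <= K * (1 + X ^+ 2) by rewrite mulr_ge0// addr_ge0 ?sqr_ge0.
have h6 : 0 <= bb * (1 + X ^+ 2) by rewrite mulr_ge0// addr_ge0 ?sqr_ge0.
have h7 : 0 <= c * (1 + X ^+ 2) by rewrite mulr_ge0// addr_ge0 ?sqr_ge0.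
by rewrite !mulrDl; lra.
Qed.

Let xh_le (u x : R) : -1 < u < v ->
  `|x * h u x| <= 2 * r * (C2 * (2 / e) * growth C1 r x).
Proof.
move=> uv; rewrite /h mulrCA normrM (@ger0_norm _ (2 * r)) ?mulr_ge0//.
rewrite ler_wpM2l ?mulr_ge0//.
have -> : x * (E u x * B u x / Q u x) = E u x * (x * B u x) / Q u x by ring.
rewrite normrM normfV normrM (ger0_norm (E_ge0 u x)) (gtr0_norm (Q_gt0 x uv)).
apply: E_bound => //; apply: le_trans (xB_le x uv).
have := normr_ge0 (x * B u x); have := mulr_ge0 K0 (normr_ge0 u); lra.
Qed.

Let dE_le (u x : R) : -1 < u < v ->
  `|E u x * r * (2 * x * B u x - 2 * K * u) / Q u x| <=
  r * (C2 * (2 / e) * growth C1 r x).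
Proof.
move=> uv.
have -> : E u x * r * (2 * x * B u x - 2 * K * u) / Q u x =
  r * (E u x * (2 * (x * B u x) - 2 * K * u) / Q u x) by ring.
rewrite normrM (ger0_norm r0) ler_wpM2l//.
rewrite normrM normfV normrM (ger0_norm (E_ge0 u x)) (gtr0_norm (Q_gt0 x uv)).
apply: E_bound => //; apply: le_trans (xB_le x uv).
apply: (le_trans (ler_normB _ _)).
by rewrite (normrM 2) (normrM _ u) (@ger0_norm _ 2)// (@ger0_norm _ (2 * K))// mulr_ge0.
Qed.

Let dh_le (u x : R) : 0 < u < 1 ->
  `|dh u x| <= 2 * r * ((2 / e) * ((2 * r - 1) * c)) * growth C1 r x.
Proof.
move=> /andP[u0 u1]; have uv : -1 < u < v.
  by rewrite (lt_trans u1 v1) (lt_trans _ u0)// ltrN10.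
have Q0 := Q_gt0 x uv.
have -> : dh u x = 2 * r * ((Q u x)^-1 * (u * (2 * (r - 1) * (B u x ^+ 2 / Q u x) + c)) * E u x).
  by rewrite /dh; field; rewrite gt_eqF.
rewrite normrM (@ger0_norm _ (2 * r)) ?mulr_ge0// -[leRHS]mulrA ler_wpM2l ?mulr_ge0//.
have rr : 0 <= 2 * (r - 1) by rewrite mulr_ge0// subr_ge0.
have BQ : 0 <= B u x ^+ 2 / Q u x <= c.
  rewrite divr_ge0 ?sqr_ge0 ?(ltW Q0)//= ler_pdivrMr// B2_le//.
  by rewrite (lt_trans _ u0)//= ?ltW// ltrN10.
have S0 : 0 <= 2 * (r - 1) * (B u x ^+ 2 / Q u x) + c.
  by case/andP: BQ => BQ _; rewrite addr_ge0// mulr_ge0.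
rewrite ger0_norm; last first.
  by rewrite mulr_ge0// mulr_ge0 ?invr_ge0 ?(ltW Q0)// mulr_ge0// ltW.
apply: ler_pM => //; last exact: E_le1.
  by rewrite mulr_ge0 ?invr_ge0 ?(ltW Q0)// mulr_ge0// ltW.
apply: ler_pM; rewrite ?invr_ge0 ?(ltW Q0) ?invQ_le//.
  by rewrite mulr_ge0// ltW.
apply: (@le_trans _ _ (1 * (2 * (r - 1) * (B u x ^+ 2 / Q u x) + c))).
  by rewrite ler_wpM2r// ltW.
have : 2 * (r - 1) * (B u x ^+ 2 / Q u x) <= 2 * (r - 1) * c.
  by rewrite ler_wpM2l//; case/andP: BQ.
by rewrite mul1r; lra.
Qed.

Let normal_pdf_norm_le (f : R -> R) (M : R) : (forall x, `|f x| <= M * growth C1 r x) ->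
  exists N, forall x, `|f x * phi x| <= N * normal_fun 0 (2 * s) x.
Proof.
move=> fM; have [N N0 HN] := growth_normal_pdf_le s0 C1_gt0 r0.
exists (`|M| * N) => x; rewrite normrM (ger0_norm (normal_pdf_ge0 _ _ _)).
apply: (@le_trans _ _ (`|M| * (growth C1 r x * phi x))).
  rewrite mulrA ler_wpM2r ?normal_pdf_ge0// (le_trans (fM x))//.
  by rewrite ler_wpM2r ?growth_ge0// ler_norm.
by rewrite -[leRHS]mulrA ler_wpM2l.
Qed.

Let integrable_bound (f : R -> R) (M : R) : continuous f ->
  (forall x, `|f x| <= M * growth C1 r x) ->
  mu.-integrable setT (fun x : R => (f x * phi x)%:E).
Proof.
move=> cf fM.
apply: (@le_integrable _ _ R mu setT measurableT _
    (fun x : R => (M%:E * (growth C1 r x * phi x)%:E)%E)) => //.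
- apply/measurable_EFinP/measurable_funM; last exact: measurable_normal_pdf.
  exact: continuous_measurable_fun.
- move=> x _; rewrite /= lee_fin (normrM (f x)) mulrA (normrM (M * _)).
  by rewrite ler_wpM2r// (le_trans (fM x))// ler_norm.
- by apply: integrableZl => //; exact: integrable_growth.
Qed.

(** The condition on [y] covers both ends of the line, [y n = n] and [y n = - n]. *)
Let cvg_tail (f : R -> R) (M : R) (y : nat -> R) :
  (forall x, `|f x| <= M * growth C1 r x) ->
  (forall n, y n ^+ 2 = n%:R ^+ 2) ->
  - s ^+ 2 * (f (y n) * phi (y n)) @[n --> \oo] --> 0.
Proof.
move=> fM yn; have [N HN] := normal_pdf_norm_le fM.
rewrite -[X in _ --> X](mulr0 (- s ^+ 2)); apply: cvgM; first exact: cvg_cst.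
apply: norm_cvg0.
apply: (@squeeze_cvgr _ _ _ _ (fun=> 0) (fun n => N * normal_fun 0 (2 * s) n%:R)).
- apply: nearW => n; apply/andP; split; first exact: normr_ge0.
  by apply: (le_trans (HN _)); rewrite /normal_fun !subr0 yn.
- exact: cvg_cst.
- rewrite -[X in _ --> X](mulr0 N); apply: cvgM; first exact: cvg_cst.
  apply: cvg_normal_fun.
  by rewrite mulr_gt0.
Qed.

Let derive_continuous (f df : R -> R) :
  (forall x : R, is_derive x (1 : R) f (df x)) -> continuous f.
Proof.
move=> d x; apply/differentiable_continuous/derivable1_diffP.
exact: (@ex_derive _ _ _ _ _ _ _ (d x)).
Qed.

(** Stein's identity for the law N(0, s^2): the integrand is the derivative of [- s^2 h phi], which
    vanishes at both infinities. *)
Let stein (u : R) : 0 < u < 1 ->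
  mu.-integrable setT (fun x : R => ((x * h u x - s ^+ 2 * dh u x) * phi x)%:E) /\
  \int[mu]_x ((x * h u x - s ^+ 2 * dh u x) * phi x) = 0.
Proof.
move=> u01; have uv : -1 < u < v.
  by case/andP: u01 => u0 u1; rewrite (lt_trans u1 v1) (lt_trans _ u0)// ltrN10.
have dG (x : R) : is_derive x (1 : R) (fun x => - s ^+ 2 * (h u x * phi x))
    ((x * h u x - s ^+ 2 * dh u x) * phi x).
  have d1 := dh_x x uv; have d2 := dphi x.
  apply: is_derive_eq; rewrite /GRing.scale/=; field; by rewrite gt_eqF.
have cdh : continuous (dh u).
  have ddh (x : R) : derivable (dh u) x 1.
    have Q0 : Q u x != 0 by rewrite gt_eqF// Q_gt0.
    have dQ : is_derive x (1 : R) (Q u) (2 * u * B u x).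
      by rewrite /Q; apply: is_derive_eq; rewrite /GRing.scale/= /B; ring.
    have dB : is_derive x (1 : R) (B u) (c * u).
      by rewrite /B; apply: is_derive_eq; rewrite /GRing.scale/=; ring.
    have dQ2 : is_derive x (1 : R) (fun x => Q u x ^+ 2) (2 * Q u x * (2 * u * B u x)).
      by apply: is_derive_eq; rewrite /GRing.scale/=; ring.
    have dV : is_derive x (1 : R) (fun y => (Q u y ^+ 2)^-1)
        (- (Q u x ^+ 2) ^- 2 * (2 * Q u x * (2 * u * B u x))).
      by apply: is_deriveV; rewrite expf_neq0.
    have dE := dE_x x uv.
    by apply: ex_derive.
  by move=> x; exact/differentiable_continuous/derivable1_diffP/ddh.
have ch := derive_continuous (fun x => dh_x x uv).
have cf : continuous (fun x : R => x * h u x - s ^+ 2 * dh u x).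
  by move=> x; apply: cvgB; apply: cvgM; [exact: cvg_id|exact: ch|exact: cvg_cst|exact: cdh].
pose M := 2 * r * (C2 * (2 / e)) + s ^+ 2 * (2 * r * ((2 / e) * ((2 * r - 1) * c))).
have ig : mu.-integrable setT
    (fun x : R => ((x * h u x - s ^+ 2 * dh u x) * phi x)%:E).
  apply: (@integrable_bound _ M) => // x.
  rewrite /M [leRHS]mulrDl (le_trans (ler_normB _ _))// lerD//.
    by rewrite (le_trans (xh_le x uv))// !mulrA.
  rewrite normrM ger0_norm ?sqr_ge0// -[leRHS]mulrA ler_wpM2l ?sqr_ge0//.
  exact: dh_le.
split=> //; apply: (Rintegral_derivative_eq0 dG _ ig).
- move=> x; apply: cvgM; first exact: cf.
  by apply: continuous_normal_pdf; rewrite gt_eqF.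
- apply: (@cvg_tail _ (2 * r * (C2 * (2 / e)))) => // x.
  by rewrite (le_trans (h_le x uv))// !mulrA.
- apply: (@cvg_tail _ (2 * r * (C2 * (2 / e)))) => [x|n]; last by rewrite sqrrN.
  by rewrite (le_trans (h_le x uv))// !mulrA.
Qed.

Let F (u x : R) := E u x * phi x.
Let dF (u x : R) := E u x * r * (2 * x * B u x - 2 * K * u) / Q u x * phi x.

Let cE (u : R) : -1 < u < v -> continuous (E u).
Proof. by move=> uv; exact: derive_continuous (fun x => dE_x x uv). Qed.

Let is_derive_F (u x : R) : -1 < u < v -> is_derive u (1 : R) (F ^~ x) (dF u x).
Proof.
move=> uv; have d := dE_u x uv.
by rewrite /F; apply: is_derive_eq; rewrite /GRing.scale/= /dF; ring.
Qed.

Let intF (u : R) : -1 < u < v -> mu.-integrable setT (EFin \o F u).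
Proof.
move=> uv; apply: (@integrable_bound _ 1); first exact: cE.
by move=> x; rewrite mul1r ger0_norm ?expR_ge0// E_le1.
Qed.

Let M3 := r * (C2 * (2 / e)).

Let dF_le (u x : R) : -1 < u < v -> `|dF u x| <= M3 * growth C1 r x * phi x.
Proof.
move=> uv; rewrite normrM (ger0_norm (normal_pdf_ge0 _ _ _)).
by rewrite ler_wpM2r ?normal_pdf_ge0// (le_trans (dE_le x uv))// /M3 !mulrA.
Qed.

Let partial1F (u x : R) : -1 < u < v -> partial1of2 F u x = dF u x.
Proof.
move=> uv; rewrite partial1of2E.
exact: (@derive_val _ _ _ _ _ _ _ (is_derive_F x uv)).
Qed.

(** This is where [2 r - 1] is forced. After [x h] is exchanged for [s^2 dh], the terms in [c Q]
    combine with the derivative of [K (1 - u^2)] and leave [4 r (r - 1) s^2 u E / Q^2 (B^2 - c Q)],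
    which is nonpositive because [B^2 <= c Q]. *)
Let dF_le0 (u : R) : 0 < u < 1 -> \int[mu]_x dF u x <= 0.
Proof.
move=> u01; have [i1 s1] := stein u01.
have uv : -1 < u < v.
  by case/andP: u01 => u0 u1; rewrite (lt_trans u1 v1) (lt_trans _ u0)// ltrN10.
rewrite -s1; apply: le_Rintegral => //.
- apply: (@le_integrable _ _ R mu setT measurableT _
    (fun x : R => (M3%:E * (growth C1 r x * phi x)%:E)%E)) => //.
  + apply/measurable_EFinP/measurable_funM; last exact: measurable_normal_pdf.
    apply: continuous_measurable_fun => x.
    have Q0 : Q u x != 0 by rewrite gt_eqF// Q_gt0.
    have dQ : is_derive x (1 : R) (Q u) (2 * u * B u x).
      by rewrite /Q; apply: is_derive_eq; rewrite /GRing.scale/= /B; ring.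
    have cQ : {for x, continuous (Q u)}.
      by apply/differentiable_continuous/derivable1_diffP; apply: ex_derive.
    have cB : {for x, continuous (B u)}.
      apply/differentiable_continuous/derivable1_diffP.
      by rewrite /B; apply: ex_derive.
    apply: cvgM; last exact: cvgV.
    apply: cvgM; first by apply: cvgM; [exact: cE|exact: cvg_cst].
    apply: cvgB; last exact: cvg_cst.
    by apply: cvgM => //; apply: cvgM; [exact: cvg_cst|exact: cvg_id].
  + move=> x _; rewrite /= lee_fin (le_trans (dF_le x uv))// -mulrA.
    by rewrite ler_norm.
  + by apply: integrableZl => //; exact: integrable_growth.
- move=> x _; rewrite /dF ler_wpM2r ?normal_pdf_ge0//.
  have Q0 := Q_gt0 x uv.
  have -> : E u x * r * (2 * x * B u x - 2 * K * u) / Q u x =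
      x * h u x - s ^+ 2 * dh u x +
      4 * r * (r - 1) * s ^+ 2 * u * E u x / Q u x ^+ 2 * (B u x ^+ 2 - c * Q u x).
    by rewrite /h /dh /K; field; rewrite gt_eqF.
  rewrite gerDl mulr_ge0_le0//.
    rewrite mulr_ge0 ?invr_ge0 ?sqr_ge0// mulr_ge0// mulr_ge0//.
      by rewrite mulr_ge0 ?sqr_ge0// mulr_ge0 ?subr_ge0// mulr_ge0.
    by case/andP: u01 => /ltW.
  rewrite subr_le0 B2_le//.
  by case/andP: u01 => u0 u1; rewrite (lt_trans _ u0)//= ?ltW// ltrN10.
Qed.

Let Phi (u : R) := \int[mu]_x F u x.

(** The derivative of [Phi] is obtained under the integral sign on []-1, v[], with the majorant
    [growth * phi]; its sign is needed only inside []0, 1[]. *)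
Let Phi_le : Phi 1 <= Phi 0.
Proof.
pose G x := M3 * growth C1 r x * phi x.
have M30 : 0 <= M3 by rewrite mulr_ge0// mulr_ge0// divr_ge0// ltW.
have G0 x : 0 <= G x by rewrite mulr_ge0 ?normal_pdf_ge0// mulr_ge0 ?growth_ge0.
have iG : mu.-integrable setT (EFin \o G).
  rewrite (_ : EFin \o G = fun x : R => (M3%:E * (growth C1 r x * phi x)%:E)%E).
    by apply: integrableZl => //; exact: integrable_growth.
  by apply/funext => x; rewrite /G/= -mulrA EFinM.
have I (u : R) : `](-1), v[%classic u -> -1 < u < v by rewrite /= in_itv.
have H1 (u : R) : `](-1), v[%classic u -> mu.-integrable setT (EFin \o F u).
  by move/I; exact: intF.
have H2 (u : R) (y : measurableTypeR R) : `](-1), v[%classic u -> [set: measurableTypeR R] y ->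
    derivable (F ^~ y) u 1.
  by move=> /I uv _; apply: (@ex_derive _ _ _ _ _ _ _ (is_derive_F y uv)).
have H3 (u : R) (y : measurableTypeR R) : `](-1), v[%classic u -> [set: measurableTypeR R] y ->
    `|partial1of2 F u y| <= G y.
  by move=> /I uv _; rewrite partial1F// dF_le.
have dPhi (u : R) : -1 < u < v -> derivable Phi u 1.
  move=> uv; have Iu : `](-1), v[%classic u by rewrite /= in_itv.
  exact: (derivable_under_integral measurableT Iu H1 H2 G0 iG H3).
apply: (@ler0_derive1_le_cc _ Phi 0 1); rewrite ?in_itv/= ?lexx ?ler01//.
- move=> u; rewrite in_itv/= => /andP[u0 u1]; apply: dPhi.
  by rewrite (lt_trans u1 v1) (lt_trans _ u0)// ltrN10.
- move=> u; rewrite in_itv/= => u01.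
  have uv : -1 < u < v.
    by case/andP: u01 => u0 u1; rewrite (lt_trans u1 v1) (lt_trans _ u0)// ltrN10.
  have Iu : `](-1), v[%classic u by rewrite /= in_itv.
  rewrite (differentiation_under_integral measurableT Iu H1 H2 G0 iG H3).
  apply: le_trans (dF_le0 u01); rewrite le_eqVlt; apply/orP; left; apply/eqP.
  by apply: eq_Rintegral => x _; exact: partial1F.
- apply: continuous_in_subspaceT => u; rewrite inE/= in_itv/= => /andP[u0 u1].
  apply/differentiable_continuous/derivable1_diffP/dPhi.
  by rewrite (le_lt_trans u1 v1) (lt_le_trans _ u0)// ltrN10.
Qed.

(** At [u = 1] the compensator vanishes and [Q] is the given quadratic; at [u = 0] it is the
    constant [a + e + K]. Positivity of [Q] identifies [E] with a genuine power. *)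
Lemma expectation_quadratic_powR_regularized :
  (\int[mu]_x ((a + e + 2 * b * x + c * x ^+ 2) `^ r * phi x)%:E <=
   ((a + e + (2 * r - 1) * s ^+ 2 * c) `^ r)%:E)%E.
Proof.
have uv1 : -1 < (1 : R) < v by rewrite v1 andbT; lra.
have uv0 : -1 < (0 : R) < v by rewrite (lt_trans ltr01 v1) ltrN10.
have p0 : phi = fun x => phi x by [].
rewrite [leLHS](_ : _ = (Phi 1)%:E); last first.
  rewrite /Phi /Rintegral fineK; last exact: (integrable_fin_num measurableT (intF uv1)).
  apply: eq_integral => x _; rewrite /F/= /E /powR ifF; last first.
    apply/negbTE; rewrite gt_eqF//; have := Q_gt0 x uv1; rewrite /Q.
    by rewrite !expr1n !mulr1 subrr mulr0 addr0.
  by rewrite /Q !expr1n !mulr1 subrr mulr0 addr0.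
rewrite lee_fin; apply: (le_trans Phi_le).
have Q0 x : Q 0 x = a + e + K by rewrite /Q; ring.
rewrite /Phi /Rintegral.
have -> // : (\int[mu]_x (F 0 x)%:E)%E = ((a + e + K) `^ r)%:E.
transitivity (\int[mu]_x (((a + e + K) `^ r)%:E * (phi x)%:E))%E.
  apply: eq_integral => x _; rewrite /F /= /E Q0 /powR ifF ?EFinM//.
  by apply/negbTE; rewrite gt_eqF// -(Q0 0) Q_gt0.
rewrite integralZl//; last exact: integrable_normal_pdf.
by rewrite integral_normal_pdf mule1.
Qed.

End gaussian_quadratic.

(** The regularization is removed on the right side only: the left side is monotone in [e], so it
    suffices to let [e] tend to 0 along [1 / (n + 1)] in the upper bound. *)
Lemma expectation_quadratic_powR (R : realType) (s r a b c : R) :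
  0 < s -> 1 <= r -> 0 <= a -> 0 <= c -> b ^+ 2 <= a * c ->
  (\int[normal_prob 0 s]_x ((a + 2 * b * x + c * x ^+ 2) `^ r)%:E <=
   ((a + (2 * r - 1) * s ^+ 2 * c) `^ r)%:E)%E.
Proof.
move=> s0 r1 a0 c0 bac; have r0 : 0 <= r by exact: le_trans r1.
have mq (e : R) : measurable_fun setT (fun x : R => (a + e + 2 * b * x + c * x ^+ 2) `^ r).
  apply: (@measurableT_comp _ _ _ _ _ _ (fun y : R => y `^ r)).
    exact: measurable_powR.
  apply: continuous_measurable_fun => x.
  apply/differentiable_continuous/derivable1_diffP.
  by apply: ex_derive.
rewrite ge0_integral_normal_prob ?gt_eqF//; last 2 first.
- by apply/measurable_EFinP; have := mq 0; under eq_fun do rewrite addr0.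
- by move=> x; rewrite lee_fin powR_ge0.
set K := (2 * r - 1) * s ^+ 2 * c.
have K0 : 0 <= K by rewrite mulr_ge0// mulr_ge0 ?sqr_ge0//; lra.
have H (e : R) : 0 < e -> (\int[lebesgue_measure]_x (((a + 2 * b * x + c * x ^+ 2) `^ r)%:E *
    (normal_pdf 0 s x)%:E) <= ((a + e + K) `^ r)%:E)%E.
  move=> e0; apply: le_trans (expectation_quadratic_powR_regularized s0 r1 a0 c0 bac e0).
  apply: ge0_le_integral => //.
  - by move=> x _; rewrite mule_ge0 ?lee_fin ?powR_ge0 ?normal_pdf_ge0.
  - apply: emeasurable_funM; apply/measurable_EFinP; last exact: measurable_normal_pdf.
    by have := mq 0; under eq_fun do rewrite addr0.
  - apply/measurable_EFinP/measurable_funM; last exact: measurable_normal_pdf.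
    exact: mq.
  - move=> x _; rewrite -EFinM lee_fin ler_wpM2r ?normal_pdf_ge0//.
    have q0 := quadratic_ge0 x a0 c0 bac.
    rewrite ge0_ler_powR ?nnegrE//; first by have := e0; lra.
    by lra.
(* The limit uses differentiability of the power at [a + K], hence needs a positive base. If
   [a + K = 0] then [a], [b] and [c] all vanish and so does the integrand. *)
have [y0|y0] := ltP 0 (a + K); last first.
  have aE : a = 0 by apply/eqP; rewrite eq_le a0 andbT; lra.
  have KE : K = 0 by apply/eqP; rewrite eq_le K0 andbT; lra.
  have cE : c = 0.
    have s2 : s ^+ 2 != 0 by rewrite gt_eqF// exprn_gt0.
    apply/eqP; move/eqP : KE; rewrite /K mulf_eq0 mulf_eq0 (negbTE s2) orbF.
    by case/orP => // /eqP; lra.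
  have bE : b = 0.
    by apply/eqP; rewrite -sqrf_eq0 eq_le sqr_ge0 andbT (le_trans bac)// aE mul0r.
  rewrite (_ : integral _ _ _ = 0%E) ?lee_fin ?powR_ge0//.
  apply: integral0_eq => x _; rewrite aE bE cE !mulr0 !mul0r !addr0 powR0 ?mul0e//.
  by rewrite gt_eqF//; lra.
have cvK : ((a + n.+1%:R^-1 + K) `^ r) @[n --> \oo] --> (a + K) `^ r.
  have c1 : a + n.+1%:R^-1 + K @[n --> \oo] --> a + 0 + K.
    by apply: cvgD; [apply: cvgD; [exact: cvg_cst|exact: cvg_harmonic]|exact: cvg_cst].
  rewrite addr0 in c1.
  have dy : derivable (fun y : R => y `^ r) (a + K) (1 : R).
    by apply: derivable_powR; rewrite in_itv/= andbT.
  have cy : {for a + K, continuous (fun y : R => y `^ r)}.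
    exact/differentiable_continuous/derivable1_diffP.
  exact: (@cvg_comp _ _ _ (fun n => a + n.+1%:R^-1 + K) (fun y : R => y `^ r) _ _ _ c1 cy).
rewrite -[leRHS](_ : limn (fun n => ((a + n.+1%:R^-1 + K) `^ r)%:E) = _).
  apply: lime_ge.
    by apply/cvg_ex; eexists; apply: cvg_EFin; [exact: nearW|exact: cvK].
  by apply: nearW => n; apply: H; rewrite invr_gt0.
by apply/cvg_lim => //; apply: cvg_EFin; [exact: nearW|exact: cvK].
Qed.

(** The abstract form of Cauchy-Schwarz, applied later to sums over coordinates, to geometrically
    weighted sums and to the L^2 inner product. *)
Lemma discriminant_le (R : realFieldType) (a b c : R) : 0 <= c ->
  (forall x, 0 <= a + 2 * b * x + c * x ^+ 2) -> b ^+ 2 <= a * c.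
Proof.
rewrite le_eqVlt => /predU1P[<- h|c0 h].
  rewrite mulr0; have [->|b0] := eqVneq b 0; first by rewrite expr0n.
  (* For [c = 0] and [b != 0] the affine function takes the value -1 at this point. *)
  have := h (- (a + 1) / (2 * b)).
  have -> : a + 2 * b * (- (a + 1) / (2 * b)) + 0 * (- (a + 1) / (2 * b)) ^+ 2 = -1.
    by field.
  by rewrite oppr_ge0 ler10.
have := h (- (b / c)).
have -> : a + 2 * b * - (b / c) + c * (- (b / c)) ^+ 2 = (a * c - b ^+ 2) / c.
  by field; rewrite gt_eqF.
by rewrite pmulr_lge0 ?invr_gt0// subr_ge0.
Qed.

(** The joint law equals the product law, since the two agree on rectangles; Tonelli then integrates
    out [eta] first. *)
Lemma ge0_integral_independent (d d1 d2 : measure_display) (Omega : measurableType d)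
    (T1 : measurableType d1) (T2 : measurableType d2) (R : realType)
    (P : probability Omega R) (xi : {mfun Omega >-> T1}) (eta : {mfun Omega >-> T2})
    (f : T1 * T2 -> \bar R) :
  (forall A B, measurable A -> measurable B ->
    P (xi @^-1` A `&` eta @^-1` B) = (P (xi @^-1` A) * P (eta @^-1` B))%E) ->
  measurable_fun setT f -> (forall z, 0 <= f z)%E ->
  (\int[P]_w f (xi w, eta w) =
   \int[P]_w \int[distribution P eta]_y f (xi w, y))%E.
Proof.
move=> ind mf f0.
have mpair : measurable_fun setT (fun w => (xi w, eta w)).
  exact: measurable_fun_pair.
pose pmix := isMeasurableFun.Build _ _ _ _ _ mpair.
pose zeta : {mfun Omega >-> (T1 * T2)%type} := HB.pack (fun w => (xi w, eta w)) pmix.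
rewrite -(ge0_integral_distribution zeta mf f0).
pose m1 := distribution P xi; pose m2 := distribution P eta.
transitivity (\int[m1 \x m2]_z f z)%E.
  apply: eq_measure_integral.
  move=> A mA _; apply/esym; apply: (@product_measure_unique _ _ _ _ _ m1 m2) => //.
rewrite fubini_tonelli1//.
rewrite (@ge0_integral_distribution _ _ _ _ _ P xi)//.
  exact: measurable_fun_fubini_tonelli_F.
by move=> x; apply: integral_ge0 => y _.
Qed.

(** Passing to [g_sigma_algebraType G] makes the closure properties of measurable functions
    available for a sub-sigma-algebra. *)
Lemma sub_measurableP (d : measure_display) (Omega : measurableType d) (R : realType)
    (G : set (set Omega)) (X : Omega -> R) : sigma_algebra setT G ->
  sub_measurable G X <-> measurable_fun setT (X : g_sigma_algebraType G -> R).
Proof.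
move=> sG; split.
  move=> mX _ B mB; rewrite setTI; apply: sub_sigma_algebra; exact: mX.
move=> mX B mB; have := mX measurableT B mB.
by rewrite setTI measurable_g_measurableTypeE.
Qed.

(** * Gaussian families independent of a sigma-algebra *)

Section gaussian_independent_family.
Context {d : measure_display} {Omega : measurableType d} {R : realType}.
Variables (P : probability Omega R) (G : set (set Omega)) (X : nat -> Omega -> R)
  (s : R).
Hypotheses (s0 : 0 < s) (sG : sigma_algebra setT G) (Gm : G `<=` measurable).
Hypothesis mX : forall m, measurable_fun setT (X m).
Hypothesis lawX : forall m B, measurable B -> P (X m @^-1` B) = normal_prob 0 s B.
Hypothesis indX : forall M A (B : nat -> set R), G A -> (forall m, measurable (B m)) ->
  fine (P (A `&` \bigcap_(m in `I_M) X m @^-1` B m)) =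
  fine (P A) * \prod_(m < M) fine (P (X m @^-1` B m)).

(** A family closed under intersections that generates the joint sigma-algebra of [G] and the first
    [M] variables, that is, all that is known before [X M] is revealed. *)
Definition cylinders (M : nat) : set (set Omega) :=
  [set C | exists A (B : nat -> set R), [/\ G A, forall m, measurable (B m) &
    C = A `&` \bigcap_(m in `I_M) X m @^-1` B m]].

Local Notation OmegaM M := (g_sigma_algebraType (cylinders M)).

Let GT : G setT.
Proof. by have [G0 GC _] := sG; rewrite -(setD0 setT); exact: GC. Qed.

Let GI A B : G A -> G B -> G (A `&` B).
Proof.
move=> GA GB.
have := @measurableI _ (g_sigma_algebraType G) A B.
rewrite /measurable/= !(sigma_algebra_id sG); exact.
Qed.

Let cylinders_measurable M : cylinders M `<=` measurable.
Proof.
move=> C [A [B [GA mB ->]]]; apply: measurableI; first exact: Gm.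
apply: fin_bigcap_measurable; first exact: finite_II.
by move=> m _; rewrite -[X in measurable X]setTI; exact: mX.
Qed.

Let sigma_cylinders_measurable M : <<s cylinders M >> `<=` measurable.
Proof.
apply: smallest_sub; [exact: sigma_algebra_measurable|exact: cylinders_measurable].
Qed.

Let cylindersI M : setI_closed (cylinders M).
Proof.
move=> C1 C2 [A1 [B1 [GA1 mB1 ->]]] [A2 [B2 [GA2 mB2 ->]]].
exists (A1 `&` A2), (fun m => B1 m `&` B2 m); split.
- exact: GI.
- by move=> m; exact: measurableI.
- by rewrite setIACA -bigcapI.
Qed.

Let cylindersT M : cylinders M setT.
Proof.
exists setT, (fun=> setT); split => //.
by rewrite setTI; apply/seteqP; split => // w _ m _.
Qed.

Let PfinE A : measurable A -> P A = (fine (P A))%:E.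
Proof. by move=> mA; rewrite fineK// fin_num_measure. Qed.

(** The product formula is assumed on cylinders only. Both sides are finite measures in [C] agreeing
    on that generating family, hence on the sigma-algebra it generates. *)
Let indep_next M C B : <<s cylinders M >> C -> measurable B ->
  P (C `&` X M @^-1` B) = (P C * P (X M @^-1` B))%E.
Proof.
move=> sC mB.
have mXB : measurable (X M @^-1` B) by rewrite -[X in measurable X]setTI; exact: mX.
pose m1 := mrestr P mXB.
have PB0 : 0 <= fine (P (X M @^-1` B)) by exact: fine_ge0.
pose m2 := mscale (NngNum PB0) P.
suff : m1 C = m2 C.
  by rewrite /m1 /m2 /mrestr /mscale/= => ->; rewrite fineK ?fin_num_measure// muleC.
apply: (g_sigma_algebra_measure_unique (cylinders M) _ (fun=> setT)) => //.
- by apply/seteqP; split => // w _; exists 0%N.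
- move=> _ [A [B' [GA mB' ->]]].
  set D := A `&` _.
  change (P (D `&` X M @^-1` B) = ((fine (P (X M @^-1` B)))%:E * P D)%E).
  have mC : measurable D.
    by apply: cylinders_measurable; exists A, B'.
  pose B2 m := if (m < M)%N then B' m else B.
  have E1 : D `&` X M @^-1` B =
      A `&` \bigcap_(m in `I_M.+1) X m @^-1` B2 m.
    rewrite -setIA; congr (_ `&` _); apply/seteqP; split.
      move=> w [h hB] m /=; rewrite ltnS leq_eqVlt /B2 => /orP[/eqP ->|mM].
        by rewrite ltnn.
      by rewrite mM; exact: h.
    move=> w h; split; last by have := h M (ltnSn M); rewrite /B2 ltnn.
    by move=> m /= mM; have := h m (ltnW mM); rewrite /B2 mM.
  rewrite E1 PfinE; last by rewrite -E1; exact: measurableI.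
  rewrite (PfinE mC) -EFinM; congr EFin.
  rewrite indX//; last by move=> m; rewrite /B2; case: ifP.
  rewrite indX//.
  rewrite big_ord_recr/= {2}/B2 ltnn mulrA mulrC; congr (_ * (_ * _)).
  by apply: eq_bigr => m _; rewrite /B2 ltn_ord.
- move=> _; change (P (setT `&` X M @^-1` B) < +oo)%E.
  by rewrite ltey_eq fin_num_measure// setTI.
Qed.

Let GOmega (M : nat) (Y : Omega -> R) : sub_measurable G Y ->
  measurable_fun setT (Y : OmegaM M -> R).
Proof.
move=> mY _ B mB; rewrite setTI; apply: sub_sigma_algebra.
exists (Y @^-1` B), (fun=> setT); split => //; first exact: mY.
by rewrite (_ : \bigcap_(_ in _) _ = setT) ?setIT//; apply/seteqP; split => // w _ m _.
Qed.

Let XOmega (M m : nat) : (m < M)%N -> measurable_fun setT (X m : OmegaM M -> R).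
Proof.
move=> mM _ B mB; rewrite setTI; apply: sub_sigma_algebra.
exists setT, (fun k => if k == m then B else setT); split => //.
- by move=> k; case: ifP.
- rewrite setTI; apply/seteqP; split => [w Bw k _|w /(_ m mM)].
    by case: eqP => // ->.
  by rewrite eqxx.
Qed.

(** Given the past, [X M] is a fresh Gaussian and the coefficients are frozen, so the inner integral
    is exactly the one-dimensional inequality. *)
Let next_coordinate (M : nat) (r : R) (al be ga : Omega -> R) : 1 <= r ->
  measurable_fun setT (al : OmegaM M -> R) ->
  measurable_fun setT (be : OmegaM M -> R) ->
  measurable_fun setT (ga : OmegaM M -> R) ->
  (forall w, 0 <= al w) -> (forall w, 0 <= ga w) ->
  (forall w, be w ^+ 2 <= al w * ga w) ->
  (\int[P]_w ((al w + 2 * be w * X M w + ga w * X M w ^+ 2) `^ r)%:E <=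
   \int[P]_w ((al w + (2 * r - 1) * s ^+ 2 * ga w) `^ r)%:E)%E.
Proof.
move=> r1 mal mbe mga al0 ga0 bag.
have mid : measurable_fun setT (id : Omega -> OmegaM M).
  by move=> _ B mB; rewrite setTI; apply: (@sigma_cylinders_measurable M B mB).
(* The past is encoded as the identity of [Omega] with values in the coarser measurable space;
   functions measurable for the past are then functions of [xi]. *)
pose xi : {mfun Omega >-> OmegaM M} := HB.pack (id : Omega -> OmegaM M)
  (isMeasurableFun.Build _ _ _ _ _ mid).
have mXM : measurable_fun setT (X M : Omega -> measurableTypeR R) by exact: mX.
pose eta : {mfun Omega >-> measurableTypeR R} := HB.pack (X M : Omega -> measurableTypeR R)
  (isMeasurableFun.Build _ _ _ _ _ mXM).
pose f (z : OmegaM M * measurableTypeR R) : \bar R :=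
  ((al z.1 + 2 * be z.1 * z.2 + ga z.1 * z.2 ^+ 2) `^ r)%:E.
have mf : measurable_fun setT f.
  apply/measurable_EFinP.
  apply: (@measurableT_comp _ _ _ _ _ _ (fun y : R => y `^ r)); first exact: measurable_powR.
  have h1 : measurable_fun setT (fun z : OmegaM M * measurableTypeR R => z.1).
    exact: measurable_fst.
  have h2 : measurable_fun setT (fun z : OmegaM M * measurableTypeR R => z.2 : R).
    exact: measurable_snd.
  apply: measurable_funD; first apply: measurable_funD.
  - exact: (measurableT_comp mal h1).
  - apply: measurable_funM => //; apply: measurable_funM => //.
    exact: (measurableT_comp mbe h1).
  - apply: measurable_funM; first exact: (measurableT_comp mga h1).
    exact: measurable_funX.
have f0 z : (0 <= f z)%E by rewrite lee_fin powR_ge0.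
have := ge0_integral_independent (P := P) (xi := xi) (eta := eta) _ mf f0.
rewrite /f/= => -> //; last by move=> A B mA mB; exact: indep_next.
have toOmega (Y : Omega -> R) : measurable_fun setT (Y : OmegaM M -> R) ->
    measurable_fun setT Y.
  move=> mY _ B mB; rewrite setTI; apply: (@sigma_cylinders_measurable M).
  by have := mY measurableT B mB; rewrite setTI.
apply: ge0_le_integral => //.
- by move=> w _; apply: integral_ge0 => y _; rewrite lee_fin powR_ge0.
- have mF := @measurable_fun_fubini_tonelli_F _ _ _ _ _ (distribution P eta) f mf f0.
  move=> _ B mB; rewrite setTI; apply: (@sigma_cylinders_measurable M).
  by have := mF measurableT B mB; rewrite setTI.
- apply/measurable_EFinP.
  apply: (@measurableT_comp _ _ _ _ _ _ (fun y : R => y `^ r)); first exact: measurable_powR.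
  apply: measurable_funD; first exact: toOmega.
  by apply: measurable_funM => //; exact: toOmega.
- move=> w _.
  rewrite (eq_measure_integral (normal_prob 0 s)); last first.
    by move=> A mA _; exact: lawX.
  exact: expectation_quadratic_powR.
Qed.

(** Induction on the number of Gaussians, eliminating the last one. The extra summand [c],
    measurable for [G], makes the induction close: it absorbs the variance released by the variable
    just integrated out. *)
Let gaussian_moment_aux (K M : nat) (r : R) (a : 'I_K -> Omega -> R)
    (b : nat -> 'I_K -> Omega -> R) (c : Omega -> R) : 1 <= r ->
  (forall i, sub_measurable G (a i)) -> (forall m i, sub_measurable G (b m i)) ->
  sub_measurable G c -> (forall w, 0 <= c w) ->
  (\int[P]_w ((c w + \sum_i (a i w + \sum_(m < M) X m w * b m i w) ^+ 2) `^ r)%:E <=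
   \int[P]_w ((c w + \sum_i a i w ^+ 2 +
     (2 * r - 1) * s ^+ 2 * \sum_(m < M) \sum_i b m i w ^+ 2) `^ r)%:E)%E.
Proof.
move=> r1 ma mb; elim: M c => [|M IH] c mc c0.
  rewrite le_eqVlt; apply/orP; left; apply/eqP; apply: eq_integral => w _.
  rewrite big_ord0 mulr0 addr0; congr (((_ + _) `^ _)%:E).
  by apply: eq_bigr => i _; rewrite big_ord0 addr0.
pose u i w := a i w + \sum_(m < M) X m w * b m i w.
have mu i : measurable_fun setT (u i : OmegaM M -> R).
  apply: measurable_funD; first exact: GOmega.
  apply: measurable_sum => m; apply: measurable_funM; last exact: GOmega.
  exact: XOmega.
pose al w := c w + \sum_i u i w ^+ 2.
pose be w := \sum_i u i w * b M i w.
pose ga w := \sum_i b M i w ^+ 2.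
have ga0 w : 0 <= ga w by apply: sumr_ge0 => i _; exact: sqr_ge0.
have := @next_coordinate M r al be ga r1.
have -> : (\int[P]_w ((al w + 2 * be w * X M w + ga w * X M w ^+ 2) `^ r)%:E)%E =
  (\int[P]_w ((c w + \sum_i (a i w + \sum_(m < M.+1) X m w * b m i w) ^+ 2) `^ r)%:E)%E.
  apply: eq_integral => w _; congr ((_ `^ _)%:E).
  rewrite /al /be /ga mulr_sumr !mulr_suml -!addrA -!big_split/=; congr (_ + _).
  apply: eq_bigr => i _; rewrite big_ord_recr/= [X in _ = X ^+ 2]addrA -/(u i w); ring.
move=> /(_ _ _ _ _ _ _)/le_trans; apply.
- apply: measurable_funD; first exact: GOmega.
  by apply: measurable_sum => i; exact: measurable_funX.
- by apply: measurable_sum => i; apply: measurable_funM => //; exact: GOmega.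
- by apply: measurable_sum => i; apply: measurable_funX; exact: GOmega.
- by move=> w; rewrite addr_ge0// sumr_ge0// => i _; exact: sqr_ge0.
- by [].
(* Cauchy-Schwarz over the [K] coordinates gives the discriminant condition; the nonnegative [c]
   only enlarges [al]. *)
- move=> w; have cs : be w ^+ 2 <= (\sum_i u i w ^+ 2) * ga w.
    apply: discriminant_le => // x.
    have -> : \sum_i u i w ^+ 2 + 2 * be w * x + ga w * x ^+ 2 =
        \sum_i (u i w + b M i w * x) ^+ 2.
      rewrite /be /ga mulr_sumr !mulr_suml -!big_split/=.
      by apply: eq_bigr => i _; ring.
    by apply: sumr_ge0 => i _; exact: sqr_ge0.
  by rewrite (le_trans cs)// ler_wpM2r// lerDr.
pose c' w := c w + (2 * r - 1) * s ^+ 2 * ga w.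
have c'E w : al w + (2 * r - 1) * s ^+ 2 * ga w = c' w + \sum_i u i w ^+ 2.
  by rewrite /al /c' addrAC.
under eq_integral do rewrite c'E.
apply: (le_trans (IH c' _ _)).
- apply/(sub_measurableP _ sG); apply: measurable_funD; first exact/(sub_measurableP _ sG).
  apply: measurable_funM => //; apply: measurable_sum => i; apply: measurable_funX.
  exact/(sub_measurableP _ sG).
- move=> w; rewrite addr_ge0// mulr_ge0// mulr_ge0 ?sqr_ge0//; lra.
- rewrite le_eqVlt; apply/orP; left; apply/eqP; apply: eq_integral => w _.
  rewrite big_ord_recr/= mulrDr /c' -/(ga w); congr ((_ `^ _)%:E); ring.
Qed.

(** Localization to [A] multiplies [a] and [b] by the indicator of [A], which is measurable for [G]
    and idempotent, so that it comes out of the squares; [0] to the power [r] is 0 because [r] is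
    nonzero. *)
Lemma gaussian_moment_le (K M : nat) (r : R) (a : 'I_K -> Omega -> R)
    (b : nat -> 'I_K -> Omega -> R) (A : set Omega) : 1 <= r -> G A ->
  (forall i, sub_measurable G (a i)) -> (forall m i, sub_measurable G (b m i)) ->
  (\int[P]_(w in A) ((\sum_i (a i w + \sum_(m < M) X m w * b m i w) ^+ 2) `^ r)%:E <=
   \int[P]_(w in A) ((\sum_i a i w ^+ 2 +
     (2 * r - 1) * s ^+ 2 * \sum_(m < M) \sum_i b m i w ^+ 2) `^ r)%:E)%E.
Proof.
move=> r1 GA ma mb.
pose I w : R := \1_A w.
have r0 : r != 0 by rewrite gt_eqF// (lt_le_trans _ r1).
have II w : I w ^+ 2 = I w.
  by rewrite /I indicE; case: (w \in A); rewrite ?expr1n ?expr0n.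
have mI : sub_measurable G I.
  apply/(sub_measurableP _ sG); apply: measurable_indic.
  by rewrite /measurable/= (sigma_algebra_id sG).
have mIM (Y : Omega -> R) : sub_measurable G Y -> sub_measurable G (fun w => I w * Y w).
  move=> mY; apply/(sub_measurableP _ sG); apply: measurable_funM;
    exact/(sub_measurableP _ sG).
have patchI (Y : Omega -> R) w :
    ((fun w => (Y w `^ r)%:E) \_ A) w = ((I w * Y w) `^ r)%:E.
  rewrite patchE /I indicE; case: (w \in A); first by rewrite mul1r.
  by rewrite mul0r powR0.
rewrite integral_mkcond [leRHS]integral_mkcond.
under eq_integral do rewrite patchI.
under [leRHS]eq_integral do rewrite patchI.
have := @gaussian_moment_aux K M r (fun i w => I w * a i w)
  (fun m i w => I w * b m i w) (fun=> 0) r1.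
move=> /(_ _ _ _ _)/le_trans.
have -> : (\int[P]_w ((I w * \sum_i (a i w + \sum_(m < M) X m w * b m i w) ^+ 2) `^ r)%:E =
    \int[P]_w ((0 + \sum_i (I w * a i w + \sum_(m < M) X m w * (I w * b m i w)) ^+ 2) `^ r)%:E)%E.
  apply: eq_integral => w _; rewrite add0r mulr_sumr; congr ((_ `^ _)%:E).
  apply: eq_bigr => i _; rewrite -[X in X * _]II -exprMn mulrDr mulr_sumr; congr ((_ + _) ^+ 2).
  by apply: eq_bigr => m _; rewrite mulrCA.
apply.
- by move=> i; exact: mIM.
- by move=> m i; exact: mIM.
- by apply/(sub_measurableP _ sG); exact: measurable_cst.
- by [].
rewrite le_eqVlt; apply/orP; left; apply/eqP.
apply: eq_integral => w _; rewrite add0r; congr ((_ `^ _)%:E).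
rewrite mulrDr; congr (_ + _).
  by rewrite mulr_sumr; apply: eq_bigr => i _; rewrite exprMn II.
rewrite [RHS]mulrCA; congr (_ * _); rewrite mulr_sumr.
apply: eq_bigr => m _; rewrite mulr_sumr.
by apply: eq_bigr => i _; rewrite exprMn II.
Qed.

End gaussian_independent_family.

(** * The finite element space as a subspace of L^2 *)

Section L2_theory.
Context {R : realType} {d : nat}.
Local Notation E := 'rV[R]_d.
Local Notation mu := (lebesgue_Rd R d).
Variable D : set E.
Hypothesis mD : measurable (D : set (borelRd R d)).
Implicit Types (u v w : E -> R).

Lemma L2_integrableM u v : L2 D u -> L2 D v ->
  mu.-integrable D (fun x => (u x * v x)%:E).
Proof.
move=> [mu_ iu] [mv iv].
have i2 w : measurable_fun (D : set (borelRd R d)) (w : borelRd R d -> R) ->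
    (\int[mu]_(x in D) (w x ^+ 2)%:E < +oo)%E ->
    mu.-integrable D (fun x => (w x ^+ 2)%:E).
  move=> mw iw; apply/integrableP; split.
    by apply/measurable_EFinP; exact: measurable_funX.
  rewrite (@eq_integral _ _ _ mu D (fun x => (w x ^+ 2)%:E))// => x _.
  by rewrite gee0_abs// lee_fin sqr_ge0.
apply: (le_integrable mD _ _ (integrableD mD (i2 _ mu_ iu) (i2 _ mv iv))).
  by apply/measurable_EFinP; exact: measurable_funM.
move=> x _; rewrite /= lee_fin [leRHS]ger0_norm ?addr_ge0 ?sqr_ge0//.
rewrite normrM -(@real_normK _ (u x)) ?num_real// -(@real_normK _ (v x)) ?num_real//.
have := sqr_ge0 (`|u x| - `|v x|); have := normr_ge0 (u x); have := normr_ge0 (v x).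
by nra.
Qed.

Lemma L2_integrable_sqr u : L2 D u -> mu.-integrable D (fun x => (u x ^+ 2)%:E).
Proof. by move=> Lu; exact: (L2_integrableM Lu Lu). Qed.

Lemma L2_sqr u : L2 D u -> (\int[mu]_(x in D) (u x ^+ 2)%:E = (ip D u u)%:E)%E.
Proof.
move=> Lu; rewrite /ip /Rintegral fineK//.
exact: (integrable_fin_num mD (L2_integrableM Lu Lu)).
Qed.

Lemma ip_ge0 u : 0 <= ip D u u.
Proof. by apply: Rintegral_ge0 => x _; rewrite -expr2 sqr_ge0. Qed.

Lemma normL2_sqr u : normL2 D u ^+ 2 = ip D u u.
Proof. by rewrite sqr_sqrtr// ip_ge0. Qed.

Lemma normL2_ge0 u : 0 <= normL2 D u. Proof. exact: sqrtr_ge0. Qed.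

Lemma ipC u v : ip D u v = ip D v u.
Proof. by apply: eq_Rintegral => x _; rewrite mulrC. Qed.

Lemma eq_ip u u' v v' : {in D, u =1 u'} -> {in D, v =1 v'} -> ip D u v = ip D u' v'.
Proof. by move=> uu vv; apply: eq_Rintegral => x xD; rewrite uu ?vv. Qed.

Lemma L2_measurable u : L2 D u -> measurable_fun (D : set (borelRd R d)) (u : borelRd R d -> R).
Proof. by case. Qed.

Lemma L2_lin a u v : L2 D u -> L2 D v -> L2 D (fun x => a * u x + v x).
Proof.
move=> Lu Lv; have mu_ := L2_measurable Lu; have mv := L2_measurable Lv.
have mm : measurable_fun (D : set (borelRd R d)) (fun x : borelRd R d => a * u x + v x).
  by apply: measurable_funD => //; exact: measurable_funM.
split => //.
have i1 := integrableZl mD (2 * a ^+ 2) (L2_integrable_sqr Lu).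
have i2 := integrableZl mD 2 (L2_integrable_sqr Lv).
have /integrableP[_] := integrableD mD i1 i2; apply: le_lt_trans.
apply: ge0_le_integral => //.
- by move=> x _; rewrite lee_fin sqr_ge0.
- by apply/measurable_EFinP; exact: measurable_funX.
- apply: measurableT_comp => //; apply/measurable_EFinP; apply: measurable_funD.
    by apply: measurable_funM => //; exact: measurable_funX.
  by apply: measurable_funM => //; exact: measurable_funX.
- move=> x _; rewrite lee_fin ger0_norm; last first.
    by rewrite addr_ge0// mulr_ge0 ?sqr_ge0// mulr_ge0 ?sqr_ge0.
  by have := sqr_ge0 (a * u x - v x); nra.
Qed.

Lemma L2_0 : L2 D (fun=> 0).
Proof.
split; first exact: measurable_cst.
by rewrite (@eq_integral _ _ _ mu D (fun=> 0%E)) ?integral0// => x _; rewrite expr0n.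
Qed.

Lemma L2_scale a u : L2 D u -> L2 D (fun x => a * u x).
Proof.
move=> Lu; have := L2_lin a Lu L2_0.
by rewrite (_ : (fun x => a * u x + 0) = fun x => a * u x)//; apply/funext => x; rewrite addr0.
Qed.

Lemma L2_sum (I : Type) (s : seq I) (c : I -> R) (e : I -> E -> R) :
  (forall i, L2 D (e i)) -> L2 D (fun x => \sum_(i <- s) c i * e i x).
Proof.
move=> Le; elim: s => [|i s IH].
  rewrite (_ : (fun x => _) = fun=> 0); first exact: L2_0.
  by apply/funext => x; rewrite big_nil.
have := L2_lin (c i) (Le i) IH.
rewrite (_ : (fun x => c i * e i x + _) = fun x => \sum_(i <- i :: s) c i * e i x)//.
by apply/funext => x; rewrite big_cons.
Qed.

Lemma ip_lin a u v w : L2 D u -> L2 D v -> L2 D w ->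
  ip D (fun x => a * u x + v x) w = a * ip D u w + ip D v w.
Proof.
move=> Lu Lv Lw; rewrite /ip.
have i1 := L2_integrableM Lu Lw; have i2 := L2_integrableM Lv Lw.
have i1' : mu.-integrable D (EFin \o (fun x => a * (u x * w x))).
  exact: (integrableZl mD a i1).
rewrite -RintegralZl// -RintegralD//.
by apply: eq_Rintegral => x _; rewrite mulrDl mulrA.
Qed.

Lemma ip_linr a u v w : L2 D u -> L2 D v -> L2 D w ->
  ip D w (fun x => a * u x + v x) = a * ip D w u + ip D w v.
Proof. by move=> Lu Lv Lw; rewrite ipC ip_lin// !(ipC _ w). Qed.

Lemma ip0l v : ip D (fun=> 0) v = 0.
Proof.
rewrite /ip /Rintegral (@eq_integral _ _ _ mu D (fun=> 0%E)) ?integral0// => x _.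
by rewrite mul0r.
Qed.

Lemma ip_sum (I : Type) (s : seq I) (c : I -> R) (e : I -> E -> R) v :
  (forall i, L2 D (e i)) -> L2 D v ->
  ip D (fun x => \sum_(i <- s) c i * e i x) v = \sum_(i <- s) c i * ip D (e i) v.
Proof.
move=> Le Lv; elim: s => [|i s IH].
  rewrite big_nil -[RHS](ip0l v); apply: eq_ip => // x _.
  by rewrite big_nil.
rewrite big_cons -IH -ip_lin//; last exact: L2_sum.
by apply: eq_ip => // x _; rewrite big_cons.
Qed.

Lemma ip_CauchySchwarz u v : L2 D u -> L2 D v ->
  ip D u v ^+ 2 <= ip D u u * ip D v v.
Proof.
move=> Lu Lv; apply: discriminant_le; first exact: ip_ge0.
move=> x; have := ip_ge0 (fun y => x * v y + u y).
rewrite ip_lin ?ip_linr//; last exact: L2_lin.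
by rewrite (ipC v u); lra.
Qed.

Lemma ip_eq0 u v : L2 D u -> L2 D v -> ip D v v = 0 -> ip D u v = 0.
Proof.
move=> Lu Lv v0; apply/eqP; rewrite -sqrf_eq0 eq_le sqr_ge0 andbT.
by rewrite (le_trans (ip_CauchySchwarz Lu Lv))// v0 mulr0.
Qed.

Lemma L2_ae_eq0 u : L2 D u -> ip D u u = 0 -> {ae mu, forall x, D x -> u x = 0}.
Proof.
move=> Lu u0.
have : (\int[mu]_(x in D) `|(u x ^+ 2)%:E| = 0)%E.
  rewrite (@eq_integral _ _ _ mu D (fun x => (u x ^+ 2)%:E)); first by rewrite L2_sqr// u0.
  by move=> x _; rewrite gee0_abs// lee_fin sqr_ge0.
move/ae_eq_integral_abs => /(_ mD).
have mm : measurable_fun (D : set (borelRd R d)) (fun x : borelRd R d => (u x ^+ 2)%:E).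
  by apply/measurable_EFinP; apply: measurable_funX; exact: L2_measurable.
move=> /(_ mm).
apply: filterS => x h Dx; have /= := h Dx.
by case=> /eqP; rewrite sqrf_eq0 => /eqP.
Qed.

End L2_theory.

Section finite_element_space.
Context {R : realType} {d : nat}.
Local Notation E := 'rV[R]_d.
Local Notation mu := (lebesgue_Rd R d).
Variables (D : set E) (T : @mesh R d).
Hypothesis mD : measurable (D : set (borelRd R d)).
Hypothesis coverD : D `<=` \bigcup_(k : 'I_(ncells T)) cell k.
Implicit Types (u v w : E -> R).

Lemma dotH1_L2 u : dotH1 D u -> L2 D u.
Proof. by move=> [w []]. Qed.

Lemma Vh_L2 u : Vh D T u -> L2 D u.
Proof. by move=> [/dotH1_L2]. Qed.

Lemma dotH1_lin a u v : dotH1 D u -> dotH1 D v -> dotH1 D (fun x => a * u x + v x).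
Proof.
move=> [u' [Lu Lu' Hu]] [v' [Lv Lv' Hv]].
exists (fun x => a * u' x + v' x); split; [exact: L2_lin|exact: L2_lin|].
move=> lam e De; have Le : L2 D e by case: De => _ [G [[]]].
by rewrite !ip_lin// (Hu _ _ De) (Hv _ _ De); ring.
Qed.

Lemma Vh_lin a u v : Vh D T u -> Vh D T v -> Vh D T (fun x => a * u x + v x).
Proof.
move=> [Hu cu zu au] [Hv cv zv av]; split.
- exact: dotH1_lin.
- by move=> x; apply: (cvgD (cvgM (cvg_cst a) (cu x)) (cv x)).
- by move=> x Dx; rewrite zu// zv// mulr0 addr0.
- move=> k; have [a1 [b1 h1]] := au k; have [a2 [b2 h2]] := av k.
  exists (a *: a1 + a2), (a * b1 + b2) => x kx; rewrite h1// h2//.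
  rewrite mulrDr mulr_sumr addrACA -big_split/=; congr (_ + _).
  by apply: eq_bigr => i _; rewrite !mxE; ring.
Qed.

Lemma Vh_0 : Vh D T (fun=> 0).
Proof.
split => //.
- exists (fun=> 0); split; [exact: L2_0|exact: L2_0|].
  by move=> lam e _; rewrite ip0l mulr0.
- exact: cst_continuous.
- move=> k; exists 0, 0 => x _; rewrite addr0 big1// => i _.
  by rewrite mxE mul0r.
Qed.

Lemma Vh_sum (I : Type) (s : seq I) (c : I -> R) (e : I -> E -> R) :
  (forall i, Vh D T (e i)) -> Vh D T (fun x => \sum_(i <- s) c i * e i x).
Proof.
move=> He; elim: s => [|i s IH].
  rewrite (_ : (fun x => _) = fun=> 0); first exact: Vh_0.
  by apply/funext => x; rewrite big_nil.
have := Vh_lin (c i) (He i) IH.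
rewrite (_ : (fun x => c i * e i x + _) = fun x => \sum_(i <- i :: s) c i * e i x)//.
by apply/funext => x; rewrite big_cons.
Qed.

(** One slope vector and one constant per cell; an upper bound for the dimension of V_h is
    enough. *)
Let dofs := (ncells T * (d + 1))%N.

(** On [D] an element of V_h is determined by its affine coefficients on the cells, a row vector of
    length [dofs]. The matrix of more than [dofs] such rows has a nonzero left kernel vector, whose
    entries are the coefficients of the relation. *)
Lemma Vh_linear_dependence (K : nat) (e : 'I_K -> E -> R) :
  (forall i, Vh D T (e i)) -> (dofs < K)%N ->
  exists2 l : 'I_K -> R, exists i, l i != 0 &
    forall x, D x -> \sum_i l i * e i x = 0.
Proof.
move=> He dK.
have /choice[ab abP] : forall ik : 'I_K * 'I_(ncells T), exists ab : 'rV[R]_d * R,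
    forall x, cell ik.2 x -> e ik.1 x = \sum_i ab.1 ord0 i * x ord0 i + ab.2.
  by move=> [i k]; have [_ _ _ /(_ k)[a [b h]]] := He i; exists (a, b).
pose C : 'M[R]_(K, dofs) := \matrix_i
  mxvec (\matrix_k row_mx (ab (i, k)).1 (\row_(j < 1) (ab (i, k)).2)).
have rC : (\rank C < K)%N by rewrite (leq_ltn_trans _ dK)// rank_leq_col.
have : kermx C != 0.
  by rewrite -mxrank_eq0 mxrank_ker subn_eq0 -ltnNge.
case/matrix0Pn => i0 [j0 ne0].
pose l : 'rV_K := row i0 (kermx C).
have lC : l *m C = 0 by apply/sub_kermxP; exact: row_sub.
exists (fun i => l ord0 i); first by exists j0; rewrite mxE.
have lC0 (k : 'I_(ncells T)) (j : 'I_(d + 1)) :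
    \sum_i l ord0 i * (row_mx (ab (i, k)).1 (\row_(j < 1) (ab (i, k)).2)) ord0 j = 0.
  have := congr1 (fun A : 'rV_dofs => A ord0 (mxvec_index k j)) lC.
  rewrite !mxE => h; rewrite -[RHS]h; apply: eq_bigr => i _.
  by rewrite [C _ _]mxE mxvecE [X in _ = _ * X]mxE.
move=> x /coverD[k _ kx].
transitivity (\sum_i l ord0 i * (\sum_j (ab (i, k)).1 ord0 j * x ord0 j + (ab (i, k)).2)).
  by apply: eq_bigr => i _; rewrite (abP (i, k)).
under eq_bigr do rewrite mulrDr mulr_sumr.
rewrite big_split/= exchange_big/= [X in _ + X](_ : _ = 0); last first.
  rewrite -[RHS](lC0 k (rshift d ord0)); apply: eq_bigr => i _.
  by rewrite row_mxEr mxE.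
rewrite addr0 big1// => j _.
transitivity ((\sum_i l ord0 i * (ab (i, k)).1 ord0 j) * x ord0 j).
  by rewrite mulr_suml; apply: eq_bigr => i _; rewrite mulrA.
have := lC0 k (lshift 1 j); under eq_bigr do rewrite row_mxEl.
by move=> ->; rewrite mul0r.
Qed.

(** If no finite orthonormal system were total, each could be enlarged by a normalized orthogonal
    vector. Systems of every length would exist, and one of length [dofs + 1] contradicts linear
    dependence. *)
Lemma Vh_orthonormal_basis : exists (K : nat) (e : 'I_K -> E -> R),
  [/\ forall i, Vh D T (e i), forall i j, ip D (e i) (e j) = (i == j)%:R &
    forall v, Vh D T v -> (forall i, ip D v (e i) = 0) -> ip D v v = 0].
Proof.
apply: contrapT => nex.
have fam (n : nat) : exists e : nat -> E -> R, (forall i, Vh D T (e i)) /\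
    forall i j, (i < n)%N -> (j < n)%N -> ip D (e i) (e j) = (i == j)%:R.
  elim: n => [|n [e [He on]]]; first by exists (fun _ _ => 0); split => // _; exact: Vh_0.
  have [v [Hv orth v0]] : exists v, [/\ Vh D T v,
      forall i : 'I_n, ip D v (e i) = 0 & ip D v v <> 0].
    apply: contrapT => nv; apply: nex; exists n, (fun i => e i); split => //.
      by move=> i j; rewrite on.
    by move=> v Hv orth; apply: contrapT => v0; apply: nv; exists v.
  have vgt0 : 0 < ip D v v by rewrite lt_def ip_ge0 andbT; apply/eqP.
  pose c := (Num.sqrt (ip D v v))^-1.
  pose v' := fun x => c * v x + 0.
  have Hv' : Vh D T v' by apply: Vh_lin => //; exact: Vh_0.
  have ipv' w : L2 D w -> ip D v' w = c * ip D v w.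
    by move=> Lw; rewrite ip_lin ?ip0l ?addr0//; [exact: Vh_L2|exact: L2_0].
  exists (fun i => if (i < n)%N then e i else v'); split.
    by move=> i; case: ifP.
  have Lv := Vh_L2 Hv; have Lv' := Vh_L2 Hv'.
  have ve i : (i < n)%N -> ip D v' (e i) = 0.
    by move=> ni; rewrite ipv' ?(orth (Ordinal ni)) ?mulr0//; exact: Vh_L2.
  move=> i j; rewrite !ltnS => ni nj; case: ltnP => hi; case: ltnP => hj.
  - exact: on.
  - by rewrite ipC ve// (ltn_eqF (leq_trans hi hj)).
  - by rewrite ve// gtn_eqF// (leq_trans hj hi).
  - have -> : i = j by apply/eqP; rewrite eqn_leq (leq_trans ni hj) (leq_trans nj hi).
    rewrite eqxx ipv'// ipC ipv'// mulrA -expr2 exprVn sqr_sqrtr ?ip_ge0//.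
    by rewrite mulVf// gt_eqF.
have [e [He on]] := fam dofs.+1.
have [l [i li] l0] := Vh_linear_dependence (e := fun i : 'I_dofs.+1 => e i)
  (fun i => He i) (ltnSn _).
move/eqP: li; apply.
have : ip D (fun x => \sum_(j < dofs.+1) l j * e j x) (e i) = l i.
  rewrite ip_sum//; [|by move=> j; exact: Vh_L2|exact: Vh_L2].
  rewrite (bigD1 i)//= on// eqxx mulr1 big1 ?addr0// => j ji.
  by rewrite on// (_ : (j == i :> nat) = false) ?mulr0//; apply/negbTE.
move=> <-; rewrite -[RHS](ip0l D (e i)); apply: eq_ip => // x.
by rewrite inE => Dx; rewrite l0.
Qed.

End finite_element_space.

Section orthonormal_coordinates.
Context {R : realType} {d : nat}.
Local Notation E := 'rV[R]_d.
Local Notation mu := (lebesgue_Rd R d).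
Variables (D : set E) (T : @mesh R d).
Hypothesis mD : measurable (D : set (borelRd R d)).
Variables (K : nat) (e : 'I_K -> E -> R).
Hypothesis He : forall i, Vh D T (e i).
Hypothesis orth_e : forall i j, ip D (e i) (e j) = (i == j)%:R.
Hypothesis total_e : forall v, Vh D T v -> (forall i, ip D v (e i) = 0) -> ip D v v = 0.
Implicit Types (u v w : E -> R).

Let Le i : L2 D (e i). Proof. exact: Vh_L2. Qed.

Definition Vh_proj v : E -> R := fun x => \sum_i ip D v (e i) * e i x.

Lemma proj_L2 v : L2 D (Vh_proj v).
Proof. exact: L2_sum. Qed.

Lemma ip_proj u v : L2 D u -> ip D (Vh_proj v) u = \sum_i ip D v (e i) * ip D u (e i).
Proof.
by move=> Lu; rewrite /Vh_proj ip_sum//; apply: eq_bigr => i _; rewrite (ipC _ u).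
Qed.

Lemma ip_proj_e v i : ip D (Vh_proj v) (e i) = ip D v (e i).
Proof.
rewrite ip_proj// (bigD1 i)//= orth_e eqxx mulr1 big1 ?addr0// => j ji.
by rewrite orth_e eq_sym (negbTE ji) mulr0.
Qed.

Let res v : E -> R := fun x => -1 * Vh_proj v x + v x.

Let res_L2 v : L2 D v -> L2 D (res v).
Proof. by move=> Lv; apply: L2_lin => //; exact: proj_L2. Qed.

Let ip_res u v : L2 D u -> L2 D v -> ip D (res v) u = ip D v u - ip D (Vh_proj v) u.
Proof.
by move=> Lu Lv; rewrite ip_lin// ?mulN1r 1?addrC//; exact: proj_L2.
Qed.

Lemma Bessel v : L2 D v -> \sum_i ip D v (e i) ^+ 2 <= ip D v v.
Proof.
move=> Lv; have := ip_ge0 D (res v).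
rewrite ip_res//; last exact: res_L2.
rewrite (ipC _ v (res v)) (ipC _ (Vh_proj v) (res v)) !ip_res//; last exact: proj_L2.
rewrite (ipC _ v (Vh_proj v)) !ip_proj//; last exact: proj_L2.
have -> : \sum_i ip D v (e i) * ip D (Vh_proj v) (e i) = \sum_i ip D v (e i) ^+ 2.
  by apply: eq_bigr => i _; rewrite ip_proj_e expr2.
have -> : \sum_i ip D v (e i) * ip D v (e i) = \sum_i ip D v (e i) ^+ 2.
  by apply: eq_bigr => i _; rewrite expr2.
by lra.
Qed.

Let res_null v : Vh D T v -> ip D (res v) (res v) = 0.
Proof.
move=> Hv; apply: total_e.
  by apply: Vh_lin => //; exact: (Vh_sum mD _ (fun i => ip D v (e i)) He).
move=> i; rewrite ip_res//; last exact: (Vh_L2 Hv).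
by rewrite ip_proj_e subrr.
Qed.

(** Parseval with only one argument in V_h: the residual of [v] has norm zero, hence is orthogonal
    to every [u] in L^2. *)
Lemma ip_Vh u v : L2 D u -> Vh D T v ->
  ip D u v = \sum_i ip D u (e i) * ip D v (e i).
Proof.
move=> Lu Hv; have Lv := Vh_L2 Hv.
have := ip_eq0 mD Lu (res_L2 Lv) (res_null Hv).
rewrite ipC ip_res// ip_proj// => /eqP; rewrite subr_eq0 ipC => /eqP ->.
by apply: eq_bigr => i _; rewrite mulrC.
Qed.

(** Lets the nonlinear coefficients of the scheme be evaluated on a finite coordinate expansion in
    place of the abstract element of V_h. *)
Lemma Vh_ae_proj v : Vh D T v -> {ae mu, forall x, D x -> v x = Vh_proj v x}.
Proof.
move=> Hv; have Lv := Vh_L2 Hv.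
have := L2_ae_eq0 mD (res_L2 Lv) (res_null Hv).
apply: (@filterS _ _ (ae_filter_ringOfSetsType mu)) => x h Dx; have := h Dx.
by rewrite /res mulN1r addrC => /eqP; rewrite subr_eq0 => /eqP.
Qed.

End orthonormal_coordinates.

Lemma ae_eq_ip (R : realType) (d : nat) (D : set 'rV[R]_d) (u u' v : 'rV[R]_d -> R) :
  measurable (D : set (borelRd R d)) ->
  measurable_fun (D : set (borelRd R d)) (u : borelRd R d -> R) ->
  measurable_fun (D : set (borelRd R d)) (u' : borelRd R d -> R) ->
  measurable_fun (D : set (borelRd R d)) (v : borelRd R d -> R) ->
  ae_eq_on D u u' -> ip D u v = ip D u' v.
Proof.
move=> mD mu_ mu' mv uu'; rewrite /ip /Rintegral; congr fine.
apply: ae_eq_integral => //.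
- by apply/measurable_EFinP; exact: measurable_funM.
- by apply/measurable_EFinP; exact: measurable_funM.
- move: uu'; apply: (@filterS _ _ (ae_filter_ringOfSetsType (lebesgue_Rd R d))) => x h Dx.
  by rewrite h.
Qed.

(** * Pointwise directional derivatives of continuous functions *)

Section directional_derivative.
Context {R : realType} {d : nat}.
Local Notation E := 'rV[R]_d.
Variables (f : E -> R) (v : E).
Hypothesis cf : continuous f.

Let quot (h : R) (x : E) : R := h^-1 * (f (h *: v + x) - f x).

Let derivableE x : derivable f x v = cvg (quot h x @[h --> 0^']).
Proof. by []. Qed.

Let continuous_quot h : continuous (quot h).
Proof.
move=> x; have c1 : f (h *: v + y) @[y --> x] --> f (h *: v + x).
  apply: (@continuous_comp _ _ _ (fun x : E => h *: v + x) f); last exact: cf.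
  by apply: continuousD; [exact: cst_continuous|exact: cvg_id].
apply: (@continuousM _ _ (fun=> h^-1) (fun y => f (h *: v + y) - f y)).
  exact: cst_continuous.
apply: (@continuousB _ _ _ (fun y => f (h *: v + y)) f); [exact: c1|exact: cf].
Qed.

(** The Cauchy criterion with thresholds [1 / (n + 1)] and [1 / (m + 1)], so that differentiability
    at [x] becomes a condition with countable outer quantifiers. *)
Let quot_cauchy x : cvg (quot h x @[h --> 0^']) <->
  forall n : nat, exists m : nat, forall h h', 0 < `|h| < m.+1%:R^-1 ->
    0 < `|h'| < m.+1%:R^-1 -> `|quot h x - quot h' x| <= n.+1%:R^-1.
Proof.
split.
  move=> /cvg_ex[L cL] n.
  have e0 : 0 < (n.+1%:R^-1 / 2 : R) by rewrite divr_gt0// invr_gt0.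
  move/cvgrPdist_lt : cL => /(_ _ e0)[r /= r0 hr].
  have [N _ hN] := near_infty_natSinv_lt (PosNum r0).
  exists N => h h' /andP[h0 hm] /andP[h0' hm'].
  have aux k : 0 < `|k| -> `|k| < N.+1%:R^-1 -> `|L - quot k x| < n.+1%:R^-1 / 2.
    move=> k0 kN; apply: hr => /=; last by rewrite -normr_gt0.
    by rewrite sub0r normrN (lt_trans kN)//; exact: (hN N (leqnn N)).
  have := aux _ h0 hm; have := aux _ h0' hm' => a1 a2.
  rewrite -(subrKA L) (le_trans (ler_normD _ _))// [leRHS]splitr.
  by rewrite lerD// ltW// distrC.
move=> H; apply/cauchy_cvgP/cauchy_ballP => eps eps0.
have [N _ hN] := near_infty_natSinv_lt (PosNum eps0).
have [m Hm] := H N.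
have m0 : 0 < (m.+1%:R^-1 : R) by rewrite invr_gt0.
have A0 : nbhs (0 : R)^' [set h : R | 0 < `|h| < m.+1%:R^-1].
  exists m.+1%:R^-1 => //= h /=; rewrite sub0r normrN => hm h0.
  by rewrite normr_gt0 h0.
exists ((quot^~ x) @` [set h : R | 0 < `|h| < m.+1%:R^-1],
        (quot^~ x) @` [set h : R | 0 < `|h| < m.+1%:R^-1]).
  by split; apply: filterS A0 => h hh; exists h.
move=> [_ _] [[/= h hm <-] [h' hm' <-]].
rewrite /ball/= (le_lt_trans (Hm _ _ hm hm'))//; exact: (hN N (leqnn N)).
Qed.

Lemma continuous_measurable_Rd (g : E -> R) : continuous g ->
  measurable_fun setT (g : borelRd R d -> R).
Proof.
move=> cg; apply: (measurability _ (RGenOpens.measurableE R)) => _ [_ [a [b ->] <-]].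
rewrite setTI; apply: sub_sigma_algebra.
by apply: open_comp => [? _|]; [exact: cg|exact: interval_open].
Qed.

(** The intersection over the increments [h], [h'] is uncountable, but each of its members is closed
    because [f] is continuous; only the operations over [n] and [m] have to be countable. *)
Let measurable_derivable : measurable ([set x | derivable f x v] : set (borelRd R d)).
Proof.
rewrite (_ : [set x | derivable f x v] = \bigcap_n \bigcup_m
  \bigcap_(hh in [set hh : R * R | 0 < `|hh.1| < m.+1%:R^-1 /\ 0 < `|hh.2| < m.+1%:R^-1])
    [set x | `|quot hh.1 x - quot hh.2 x| <= n.+1%:R^-1]).
  apply: bigcapT_measurable => n; apply: bigcupT_measurable => m.
  rewrite -[X in measurable X]setCK; apply: measurableC; apply: sub_sigma_algebra.
  apply: closed_openC; apply: closed_bigI => -[h h'] _ /=.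
  rewrite -[X in closed X](_ : (fun x => `|quot h x - quot h' x|) @^-1` [set y | y <= n.+1%:R^-1] = _)//.
  apply: preimage_closed; last exact: closed_le.
  move=> x _; apply: (@continuous_comp _ _ _ (fun x => quot h x - quot h' x) (@Num.norm _ R));
    last exact: norm_continuous.
  by apply: (@continuousB _ _ _ (quot h) (quot h')); exact: continuous_quot.
apply/seteqP; split => x /=.
  rewrite derivableE => /quot_cauchy H n _; have [m Hm] := H n.
  by exists m => // -[h h'] /= [h1 h2]; exact: Hm.
move=> H; rewrite derivableE; apply/quot_cauchy => n.
have [m _ Hm] := H n Logic.I; exists m => h h' h1 h2.
exact: (Hm (h, h')).
Qed.

Let seq0 (n : nat) : R := n.+1%:R^-1.

Let quot_seq x : derivable f x v -> quot (seq0 n) x @[n --> \oo] --> 'D_v f x.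
Proof.
move=> /cvgr_dnbhsP; apply; split; last exact: cvg_harmonic.
by move=> n; rewrite /seq0 invr_eq0.
Qed.

(** A pointwise limit of the quotients along [1 / (n + 1)] where [f] is derivable; elsewhere the
    derivative has the default value [point]. *)
Lemma measurable_derive : measurable_fun setT ((fun x => 'D_v f x) : borelRd R d -> R).
Proof.
pose C := [set x | derivable f x v].
pose h n x : R := if x \in C then quot (seq0 n) x else point.
apply: (@measurable_fun_cvg _ (borelRd R d) R setT h).
  move=> n; apply: measurable_fun_ifT => //.
  - by apply: (@measurable_fun_bool _ _ _ _ true); rewrite setTI (_ : _ @^-1` _ = C)//;
      apply/seteqP; split => x /=; [exact: set_mem|exact: mem_set].
  - exact: continuous_measurable_Rd.
move=> x _; rewrite /h; have [xC|xC] := boolP (x \in C).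
  by apply: quot_seq; exact: set_mem xC.
rewrite (_ : 'D_v f x = point); first exact: cvg_cst.
rewrite /derive; apply: dvgP => /=.
by move=> dx; move/negP : xC; apply; exact: mem_set.
Qed.

(** A convergent sequence that takes a value infinitely often converges to that value. Applied to
    the values of [f] and then to its quotients, this requires agreement with the affine function at
    infinitely many points only, not near [x]; curved cells and points on interfaces are thereby
    covered. *)
Lemma derive_frequently_affine (x a : E) (b : R) :
  derivable f x v ->
  (forall N, exists n, (N <= n)%N /\
     f (seq0 n *: v + x) = \sum_i a ord0 i * (seq0 n *: v + x) ord0 i + b) ->
  'D_v f x = \sum_i a ord0 i * v ord0 i.
Proof.
move=> dx fr.
have freq (u : nat -> R) l c : u @ \oo --> l ->
    (forall N, exists n, (N <= n)%N /\ u n = c) -> l = c.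
  move=> ul ufr; apply: contrapT => /eqP lc.
  have : 0 < `|l - c| by rewrite normr_gt0 subr_eq0.
  move/cvgrPdist_lt : ul => /[apply] -[N _ hN].
  by have [n [Nn uc]] := ufr N; have := hN n Nn; rewrite /= uc ltxx.
pose A (y : E) := \sum_i a ord0 i * y ord0 i.
have Alin h y : A (h *: v + y) = h * A v + A y.
  rewrite /A mulr_sumr -big_split/=; apply: eq_bigr => i _.
  by rewrite !mxE; ring.
have fx : f x = A x + b.
  apply/eqP; rewrite -subr_eq0; apply/eqP.
  apply: (freq (fun n => f (seq0 n *: v + x) - (seq0 n * A v + A x + b))).
    apply: cvgB.
      have cs : seq0 n *: v + x @[n --> \oo] --> 0 *: v + x.
        apply: cvgD; last exact: cvg_cst.
        by apply: cvgZr_tmp; exact: cvg_harmonic.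
      rewrite scale0r add0r in cs.
      by apply: (@cvg_comp _ _ _ (fun n => seq0 n *: v + x) f _ _ _ cs); exact: cf.
    have cA : seq0 n * A v + A x + b @[n --> \oo] --> 0 * A v + A x + b.
      apply: cvgD; last exact: cvg_cst.
      apply: cvgD; last exact: cvg_cst.
      by apply: cvgM; [exact: cvg_harmonic|exact: cvg_cst].
    by rewrite mul0r add0r in cA.
  move=> N; have [n [Nn fn]] := fr N; exists n; split => //.
  by rewrite fn -/(A (seq0 n *: v + x)) Alin subrr.
apply: (freq _ _ _ (quot_seq dx)) => N.
have [n [Nn fn]] := fr N; exists n; split => //.
rewrite /quot fn fx -/(A (seq0 n *: v + x)) Alin.
have -> : seq0 n * A v + A x + b - (A x + b) = seq0 n * A v by ring.
by rewrite mulKf// invr_eq0.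
Qed.

End directional_derivative.

Section bounded_lebesgue.
Context {R : realType}.

Lemma measurable_tuple_cube (d : nat) (r : R) :
  measurable ([set t | forall i, `|tnth t i| <= r] : set (d.-tuple (measurableTypeR R))).
Proof.
rewrite (_ : [set t | _] = \bigcap_(i in [set: 'I_d])
    (fun t : d.-tuple (measurableTypeR R) => tnth t i) @^-1` `[- r, r]%classic).
  apply: fin_bigcap_measurable => // i _.
  rewrite -[X in measurable X]setTI; exact: measurable_tnth.
apply/seteqP; split => [t h i _|t h i] /=; first by rewrite in_itv/= -ler_norml.
by have := h i Logic.I; rewrite /= in_itv/= -ler_norml.
Qed.

Lemma lebesgue_tuple_cube_lty (d : nat) (r : R) :
  (@lebesgue_tuple R d [set t | forall i, (`|tnth t i| <= r)%R] < +oo)%E.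
Proof.
elim: d => [|d IH].
  by rewrite /lebesgue_tuple /= diracE; case: (_ \in _); rewrite ltry.
have [m mE] := lebesgue_tuple_sfm (R := R) d.
rewrite /= /pushforward -mE.
pose I : set R := `[- r, r]%classic.
have mI : measurable (I : set (measurableTypeR R)) by exact: measurable_itv.
have fI : (lebesgue_measure I < +oo)%E.
  by rewrite /I lebesgue_measure_itv/=; case: ifP => // _; rewrite ltry.
rewrite (_ : _ @^-1` _ = I `*` [set t | forall i, (`|tnth t i| <= r)%R]).
  rewrite product_measure1E//; last exact: measurable_tuple_cube.
  by rewrite lte_mul_pinfty ?ge0_fin_numE// mE.
apply/seteqP; split => [[x t] /= h|[x t] /= [h1 h2] i].
  split; first by rewrite /I/= in_itv/= -ler_norml; have := h ord0; rewrite /tcons tnth0.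
  by move=> i; have := h (lift ord0 i); rewrite /tcons tnthS.
have [j ->|->] := unliftP ord0 i; last first.
  by rewrite /tcons tnth0; move: h1; rewrite /I/= in_itv/= -ler_norml.
by rewrite /tcons tnthS.
Qed.

(** The norm on row vectors is the maximum norm, so a bounded set lies in a cube, whose product
    measure is finite. *)
Lemma bounded_lebesgue_Rd_lty (d : nat) (D : set 'rV[R]_d) :
  measurable (D : set (borelRd R d)) -> bounded_set D -> (lebesgue_Rd R d D < +oo)%E.
Proof.
move=> mD [M [Mr bM]].
pose r := `|M| + 1.
have Dr x : D x -> `|x| <= r.
  by move=> Dx; apply: (bM r) => //; rewrite /r (le_lt_trans (ler_norm _))// ltrDl.
have mC := @measurable_tuple_cube d r; have Cfin := @lebesgue_tuple_cube_lty d r.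
have [m mE] := lebesgue_tuple_sfm (R := R) d.
apply: le_lt_trans Cfin; rewrite /lebesgue_Rd /pushforward -mE.
apply: le_measure; rewrite ?inE//.
  by rewrite -[X in measurable X]setTI; exact: measurable_row_of_tuple.
move=> t /= /Dr tr i; apply: le_trans tr.
rewrite [leRHS]/Num.norm /= mx_normrE; apply/bigmax_geP; right => /=.
by exists (ord0, i) => //=; rewrite mxE.
Qed.

End bounded_lebesgue.

(** * Measurability and conditional expectation *)

Section complete_sub_sigma_algebra.
Context {dO : measure_display} {Omega : measurableType dO} {R : realType}.
Variables (P : probability Omega R) (G : set (set Omega)).
Hypotheses (sG : sigma_algebra setT G).
Hypothesis negG : forall A, P.-negligible A -> G A.
Implicit Types (X Y : Omega -> R).

Let mG A : G A <-> measurable (A : set (g_sigma_algebraType G)).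
Proof. by rewrite measurable_g_measurableTypeE. Qed.

(** The preimages under [X] and [Y] differ inside a negligible set, and [G] contains all of
    these. *)
Lemma ae_sub_measurable X Y : sub_measurable G X -> {ae P, forall w, X w = Y w} ->
  sub_measurable G Y.
Proof.
move=> mX XY B mB.
pose N := ~` [set w | X w = Y w].
have -> : Y @^-1` B = (X @^-1` B `\` N) `|` (N `&` Y @^-1` B).
  apply/seteqP; split => [w Bw|w [[Bw /contrapT /= e]|[_ ?]]//]; last by rewrite /= -e.
  have [e|ne] := pselect (X w = Y w); [left|by right].
  by split; [rewrite /= e|exact].
apply/mG; apply: measurableU.
  by apply: measurableD; apply/mG; [exact: mX|exact: negG].
by apply/mG; apply: negG; apply: negligibleS XY => w [].
Qed.

Lemma cvg_sub_measurable (X : nat -> Omega -> R) Y : (forall k, sub_measurable G (X k)) ->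
  {ae P, forall w, X k w @[k --> \oo] --> Y w} -> sub_measurable G Y.
Proof.
move=> mX XY.
pose N := ~` [set w | X k w @[k --> \oo] --> Y w].
pose X' k w := if w \in N then 0 else X k w.
pose Y' w := if w \in N then 0 else Y w.
have XX' (Z : Omega -> R) : {ae P, forall w, Z w = if w \in N then 0 else Z w}.
  by apply: filterS XY => w h; rewrite memNset// => /(_ h).
have mX' k : sub_measurable G (X' k) by apply: (ae_sub_measurable (mX k)); exact: XX'.
have mY' : sub_measurable G Y'.
  apply/(sub_measurableP _ sG); apply: (@measurable_fun_cvg _ (g_sigma_algebraType G) R setT X').
    by move=> k; exact/(sub_measurableP _ sG).
  move=> w _; rewrite /X' /Y'; have [wN|wN] := boolP (w \in N); first exact: cvg_cst.
  by move/negP: wN => wN; apply: contrapT => h; apply: wN; exact: mem_set.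
apply: (ae_sub_measurable mY').
by move: (XX' Y); apply: filterS => w e; rewrite /Y' -e.
Qed.

(* Yields adaptedness of the implicit step without inverting id - tau A_h: its
   solution depends 1-Lipschitz continuously on the explicit part. *)
Lemma ae_lipschitz_sub_measurable (K : nat) (z y : 'I_K -> Omega -> R) (N : set Omega) :
  P.-negligible N -> (forall i, sub_measurable G (z i)) ->
  (forall w w', ~ N w -> ~ N w' ->
    \sum_i (y i w - y i w') ^+ 2 <= \sum_i (z i w - z i w') ^+ 2) ->
  forall i, sub_measurable G (y i).
Proof.
move=> nN mz lip j.
pose zv (w : g_sigma_algebraType G) : borelRd R K :=
  row_of_tuple [tuple z i w | i < K].
have mzv : measurable_fun setT zv.
  apply: (@measurableT_comp _ _ _ _ _ _ (@row_of_tuple R K)); first exact: measurable_row_of_tuple.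
  apply/measurable_fun_tnthP => i.
  rewrite (_ : _ \o _ = z i); last by apply/funext => w /=; rewrite tnth_mktuple.
  exact/(sub_measurableP _ sG).
apply/(sub_measurableP _ sG).
apply: (measurability _ (RGenInftyO.measurableE R)) => _ [_ [c ->] <-].
rewrite setTI.
pose dist2 (w0 : Omega) (v : 'rV[R]_K) := \sum_i (v ord0 i - z i w0) ^+ 2.
have cdist w0 : continuous (dist2 w0).
  rewrite /dist2; apply: continuous_big => [|i _ v].
    exact: add_continuous.
  have c1 : {for v, continuous (fun v : 'rV[R]_K => v ord0 i - z i w0)}.
    apply: (@continuousB _ _ _ (fun v : 'rV[R]_K => v ord0 i) (fun=> z i w0)).
      exact: coord_continuous.
    exact: cst_continuous.
  apply: (@continuous_comp _ _ _ (fun v : 'rV[R]_K => v ord0 i - z i w0)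
    (fun t : R => t ^+ 2)) => //; exact: exprn_continuous.
(* If [z w] lies closer to [z w0] than [c - y j w0], the Lipschitz bound gives [y j w < c]. The
   union of these balls is uncountable but open, hence Borel, and off [N] its preimage is the event
   [y j < c]. *)
pose U := \bigcup_(w0 in [set w0 | ~ N w0 /\ y j w0 < c])
  [set v : 'rV[R]_K | dist2 w0 v < (c - y j w0) ^+ 2].
have oU : open U.
  apply: bigcup_open => w0 _.
  rewrite -[X in open X](_ : dist2 w0 @^-1` [set t | t < (c - y j w0) ^+ 2] = _)//.
  by apply: open_comp => [? _|]; [exact: cdist|exact: open_lt].
have mU : measurable (zv @^-1` U).
  by rewrite -[X in measurable X]setTI; apply: mzv => //; exact: sub_sigma_algebra.
rewrite (_ : y j @^-1` _ = (zv @^-1` U `\` N) `|` (N `&` y j @^-1` [set` `]-oo, c[])).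
  apply: measurableU; first by apply: measurableD => //; apply/mG; exact: negG.
  by apply/mG; apply: negG; apply: negligibleS nN => w [].
apply/seteqP; split => w /=; rewrite in_itv/=.
  move=> yc; have [Nw|Nw] := pselect (N w); [by right|left; split => //].
  exists w => //=; rewrite /dist2 big1 ?exprn_gt0 ?subr_gt0// => i _.
  by rewrite !mxE tnth_mktuple subrr expr0n.
move=> [[[w0 [Nw0 yc0] /= dw] Nw]|[]//].
have : (y j w - y j w0) ^+ 2 < (c - y j w0) ^+ 2.
  apply: le_lt_trans dw; apply: (@le_trans _ _ (\sum_i (y i w - y i w0) ^+ 2)).
    by rewrite (bigD1 j)//= lerDl sumr_ge0// => i _; exact: sqr_ge0.
  rewrite (le_trans (lip _ _ Nw Nw0))// le_eqVlt; apply/orP; left; apply/eqP.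
  by apply: eq_bigr => i _; rewrite !mxE tnth_mktuple.
have c0 : 0 < c - y j w0 by rewrite subr_gt0.
move=> h; rewrite ltNge; apply/negP => cy.
by move: h; apply/negP; rewrite -leNgt ler_sqr ?nnegrE ?lerB// ltW// subr_gt0 (lt_le_trans yc0).
Qed.

End complete_sub_sigma_algebra.

Section conditional_expectation.
Context {dO : measure_display} {Omega : measurableType dO} {R : realType}.
Variables (P : probability Omega R) (G : set (set Omega)).
Hypotheses (sG : sigma_algebra setT G) (Gm : G `<=` measurable).
Implicit Types (X Y Z : Omega -> R).

Let mG A : G A <-> measurable (A : set (g_sigma_algebraType G)).
Proof. by rewrite measurable_g_measurableTypeE. Qed.

Lemma sub_measurable_measurable X : sub_measurable G X -> measurable_fun setT X.
Proof. by move=> mX _ B mB; rewrite setTI; apply: Gm; exact: mX. Qed.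

(** The charge that maps an event to the integral of [X] over it, and [P] itself, are pushed forward
    by the identity to the coarser space; the Radon-Nikodym derivative taken there is measurable for
    [G]. *)
Lemma cond_exp_exists X : P.-integrable setT (EFin \o X) -> exists Z, is_cond_exp P G X Z.
Proof.
move=> iX.
have mid : measurable_fun setT (id : Omega -> g_sigma_algebraType G).
  by move=> _ B /mG GB; rewrite setTI; exact: Gm.
pose xi : {mfun Omega >-> g_sigma_algebraType G} := HB.pack (id : Omega -> g_sigma_algebraType G)
  (isMeasurableFun.Build _ _ _ _ _ mid).
pose mu := distribution P xi.
pose nu := measure_function_pushforward__canonical__charge_Charge (induced_charge iX) mid.
have numu : nu `<< mu.
  apply: dominates_pushforward => //; apply/null_content_dominatesP => A mA PA.
  apply: null_set_integral => //; apply: measurable_funTS; exact: measurable_int iX.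
pose Z := Radon_Nikodym nu mu.
have fZ x : Z x \is a fin_num by exact: Radon_Nikodym_fin_num.
have iZ : mu.-integrable setT Z by exact: Radon_Nikodym_integrable.
have mZ : measurable_fun setT Z by exact: measurable_int iZ.
have mfZ : measurable_fun setT (fine \o Z : g_sigma_algebraType G -> R).
  exact: measurableT_comp mZ.
have EZ : EFin \o (fine \o Z) = Z by apply/funext => x /=; rewrite fineK.
have iPZ : P.-integrable setT (Z : Omega -> \bar R).
  have mZO : measurable_fun setT (Z : Omega -> \bar R) by exact: (measurableT_comp mZ mid).
  apply/integrableP; split => //.
  have /integrableP[_] := iZ.
  by rewrite (ge0_integral_distribution xi)//; exact: measurableT_comp.
exists (fine \o Z); split => //.
- exact/(sub_measurableP _ sG).
- by rewrite EZ.
- move=> A GA.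
  transitivity (nu A) => //.
  rewrite (Radon_Nikodym_integral numu); last exact/mG.
  rewrite integral_pushforward//; last exact/mG.
    by apply: eq_integral => w _ /=; rewrite fineK.
  by apply: integrableS iPZ => //; exact: Gm.
Qed.

(** Tested on the event [Y < Z], which lies in [G]: there [Z - Y] is positive and yet has a
    nonpositive integral. *)
Lemma cond_exp_le X Y Z : is_cond_exp P G X Z -> sub_measurable G Y ->
  (forall A, G A -> \int[P]_(w in A) (X w)%:E <= \int[P]_(w in A) (Y w)%:E)%E ->
  P.-integrable setT (EFin \o Y) ->
  {ae P, forall w, Z w <= Y w}.
Proof.
move=> [iX mZ iZ ZX] mY XY iY.
pose A := [set w | Y w < Z w].
have GA : G A.
  have mYG := (sub_measurableP Y sG).1 mY; have mZG := (sub_measurableP Z sG).1 mZ.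
  apply/mG; rewrite -[X in measurable X]setTI.
  exact: (measurable_fun_ltr mYG mZG).
have mA : measurable A by exact: Gm.
have iYA : P.-integrable A (EFin \o Y) by exact: integrableS iY.
have iZA : P.-integrable A (EFin \o Z) by exact: integrableS iZ.
have h : (\int[P]_(w in A) ((Z w)%:E - (Y w)%:E) <= 0)%E.
  rewrite integralB// -(fineK (integrable_fin_num mA iYA)) leeBlDr// add0e fineK ?integrable_fin_num//.
  by rewrite ZX// XY.
have : (\int[P]_(w in A) `|(Z w)%:E - (Y w)%:E| = 0)%E.
  apply/eqP; rewrite eq_le integral_ge0// andbT (le_trans _ h)//.
  rewrite le_eqVlt; apply/orP; left; apply/eqP; apply: eq_integral => w.
  by rewrite inE => YZ; rewrite gee0_abs// -EFinB lee_fin subr_ge0 ltW.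
have mZY : measurable_fun A (fun w => (Z w)%:E - (Y w)%:E)%E.
  by apply: emeasurable_funB; [exact: measurable_int iZA|exact: measurable_int iYA].
move/(ae_eq_integral_abs _ mA mZY); apply: filterS => w /= hw.
rewrite leNgt; apply/negP => YZ; have := hw YZ.
by move/eqP; rewrite -EFinB eqe subr_eq0 => /eqP ZY; move: YZ; rewrite ZY ltxx.
Qed.

End conditional_expectation.

Section parametric_integral.
Context {d1 d2 : measure_display} {T1 : measurableType d1} {T2 : measurableType d2}
  {R : realType}.
Variable mu : {sigma_finite_measure set T2 -> \bar R}.

Lemma measurable_Rintegral_param (f : T1 * T2 -> R) : measurable_fun setT f ->
  measurable_fun setT (fun w => \int[mu]_x f (w, x)).
Proof.
move=> mf; apply: measurableT_comp => //.
have mE : measurable_fun setT (EFin \o f) by exact/measurable_EFinP.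
rewrite (_ : (fun w => _) = (fun w => \int[mu]_x (EFin \o f)^\+ (w, x) -
    \int[mu]_x (EFin \o f)^\- (w, x))%E); last first.
  apply/funext => w; rewrite [LHS]integralE; congr (_ - _)%E;
    by apply: eq_integral => x _; rewrite ?funeposE ?funenegE.
have mp := @measurable_fun_fubini_tonelli_F _ _ _ _ _ mu _ (measurable_funepos mE)
  (fun x => funepos_ge0 _ x).
have mn := @measurable_fun_fubini_tonelli_F _ _ _ _ _ mu _ (measurable_funeneg mE)
  (fun x => funeneg_ge0 _ x).
exact: emeasurable_funB.
Qed.

End parametric_integral.

Section superposition.
Context {R : realType} {d : nat} {d1 : measure_display} {T1 : measurableType d1}.
Local Notation E := 'rV[R]_d.
Local Notation mu := (lebesgue_Rd R d).
Variables (D : set E) (K : nat) (e : 'I_K -> E -> R) (y : 'I_K -> T1 -> R).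
Hypothesis mD : measurable (D : set (borelRd R d)).
Hypothesis ce : forall i, continuous (e i).
Hypothesis my : forall i, measurable_fun setT (y i).

(** Written through coordinates, a random element of V_h is jointly measurable in [(w, x)], which is
    what Tonelli arguments require. *)
Definition superpose (w : T1) : E -> R := fun x => \sum_i y i w * e i x.

Lemma measurable_superpose (phi : R -> R) (psi : E -> R) :
  measurable_fun setT phi ->
  measurable_fun (D : set (borelRd R d)) (psi : borelRd R d -> R) ->
  measurable_fun setT (fun z : T1 * borelRd R d =>
    phi (superpose z.1 z.2) * (psi \_ D : borelRd R d -> R) z.2).
Proof.
move=> mphi mpsi; apply: measurable_funM.
  apply: measurableT_comp => //; apply: measurable_sum => i; apply: measurable_funM.
    exact: measurableT_comp (my i) measurable_fst.
  apply: (measurableT_comp (f := (e i : borelRd R d -> R))); last exact: measurable_snd.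
  exact: continuous_measurable_Rd.
have mr : measurable_fun setT (psi \_ D : borelRd R d -> R).
  exact/(measurable_restrictT _ mD).
exact: (measurableT_comp mr measurable_snd).
Qed.

Lemma measurable_ip_superpose (phi : R -> R) (psi : E -> R) :
  measurable_fun setT phi ->
  measurable_fun (D : set (borelRd R d)) (psi : borelRd R d -> R) ->
  measurable_fun setT (fun w => ip D (fun x => phi (superpose w x)) psi).
Proof.
move=> mphi mpsi.
have := measurable_Rintegral_param mu (measurable_superpose mphi mpsi).
congr (measurable_fun _ _); apply/funext => w.
rewrite /ip [RHS]Rintegral_mkcond; apply: eq_Rintegral => x _ /=.
by rewrite !patchE; case: ifP => _; rewrite ?mulr0.
Qed.

End superposition.

(** * Convergence of the noise series *)

Section summable_integrals.
Context {d : measure_display} {T : measurableType d} {R : realType}.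
Variables (mu : {measure set T -> \bar R}) (D : set T).
Hypothesis mD : measurable D.
Local Open Scope ereal_scope.

Lemma integrable_nneseries (U : nat -> T -> \bar R) :
  (forall k, measurable_fun D (U k)) -> (forall k x, D x -> 0 <= U k x) ->
  \sum_(0 <= k <oo) \int[mu]_(x in D) U k x < +oo ->
  mu.-integrable D (fun x => \sum_(0 <= k <oo) U k x).
Proof.
move=> mU U0 Ufin; apply/integrableP; split.
  exact: (@ge0_emeasurable_sum _ _ _ D U xpredT (fun k x Dx _ => U0 k x Dx) (fun k _ => mU k)).
rewrite (eq_integral (fun x => \sum_(0 <= k <oo) U k x)); first by rewrite integral_nneseries.
move=> x; rewrite inE => Dx; rewrite gee0_abs//; apply: nneseries_ge0 => k _ _.
exact: U0.
Qed.

(** A form of the Borel-Cantelli argument: summable means force a finite sum almost everywhere, and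
    hence terms tending to 0. *)
Lemma ae_nneseries_lty (U : nat -> T -> \bar R) :
  (forall k, measurable_fun D (U k)) -> (forall k x, D x -> 0 <= U k x) ->
  \sum_(0 <= k <oo) \int[mu]_(x in D) U k x < +oo ->
  {ae mu, forall x, D x -> \sum_(0 <= k <oo) U k x < +oo}.
Proof.
move=> mU U0 Ufin; have := integrable_ae mD (integrable_nneseries mU U0 Ufin).
apply: filterS => x h Dx; have := h Dx.
by rewrite ltey_eq => ->.
Qed.

Lemma cvg_nneseries_term (u : nat -> \bar R) : (forall k, 0 <= u k) ->
  \sum_(0 <= k <oo) u k < +oo -> u k @[k --> \oo] --> 0.
Proof.
move=> u0 ufin; have tail := nneseries_tail_cvg ufin (fun k _ => u0 k).
apply: (squeeze_cvge _ (cvg_cst 0) tail); apply: nearW => k.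
rewrite u0/= (nneseries_split k 1)// addn1 big_nat1 leeDl//.
by apply: nneseries_ge0 => n _ _.
Qed.

End summable_integrals.

Lemma sum_half_pow_le2 (R : realFieldType) (n : nat) : \sum_(j < n) (2 : R) ^- j <= 2.
Proof.
suff -> : \sum_(j < n) (2 : R) ^- j = 2 - 2 * 2 ^- n.
  by rewrite gerBl mulr_ge0// invr_ge0 exprn_ge0.
elim: n => [|n IH]; first by rewrite big_ord0 expr0 invr1 mulr1 subrr.
by rewrite big_ord_recr/= IH exprS; field; rewrite expf_neq0.
Qed.

Lemma nneseries_geometric_lty (R : realType) (u : nat -> \bar R) (C : R) :
  0 <= C -> (forall k, 0 <= u k)%E -> (forall k, u k <= (C * 2 ^- k)%:E)%E ->
  (\sum_(0 <= k <oo) u k < +oo)%E.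
Proof.
move=> C0 u0 uC; apply: (@le_lt_trans _ _ (C * 2)%:E); last by rewrite ltry.
apply: lime_le; first by apply: is_cvg_ereal_nneg_natsum => n _.
apply: nearW => n; apply: (@le_trans _ _ (\sum_(k < n) (C * 2 ^- k)%:E)%E).
  by rewrite big_mkord; apply: lee_sum => k _.
by rewrite sumEFin lee_fin -mulr_sumr ler_wpM2l// sum_half_pow_le2.
Qed.

(** Cauchy-Schwarz with weights [2^j] and [2^-j], the latter of total mass at most 2. It bounds all
    partial sums by one weighted series, uniformly in [k]. *)
Lemma sqr_sum_le_weighted (R : realFieldType) (b : nat -> R) (k : nat) :
  (\sum_(j < k) b j) ^+ 2 <= 2 * \sum_(j < k) 2 ^+ j * b j ^+ 2.
Proof.
apply: (@le_trans _ _ ((\sum_(j < k) 2 ^+ j * b j ^+ 2) * \sum_(j < k) (2 : R) ^- j)).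
  apply: discriminant_le => [|x].
    by apply: sumr_ge0 => i _; rewrite invr_ge0 exprn_ge0.
  rewrite mulr_sumr !mulr_suml -!big_split/=; apply: sumr_ge0 => i _.
  have p0 : 0 < (2 : R) ^+ i by rewrite exprn_gt0.
  have -> : 2 ^+ i * b i ^+ 2 + 2 * b i * x + 2 ^- i * x ^+ 2 =
    2 ^- i * (2 ^+ i * b i + x) ^+ 2 by field; rewrite gt_eqF.
  by rewrite mulr_ge0 ?sqr_ge0// invr_ge0 ltW.
rewrite mulrC ler_wpM2r ?sum_half_pow_le2// sumr_ge0// => i _.
by rewrite mulr_ge0 ?sqr_ge0// exprn_ge0.
Qed.

Section dominated_inner_products.
Context {R : realType} {d : nat}.
Local Notation E := 'rV[R]_d.
Local Notation mu := (lebesgue_Rd R d).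
Variables (D : set E) (B W v : E -> R) (S : nat -> E -> R).
Hypothesis mD : measurable (D : set (borelRd R d)).

Local Notation measurable_D u :=
  (measurable_fun (D : set (borelRd R d)) (u : borelRd R d -> R)).

Lemma ae_cvg_of_summable :
  (forall k, measurable_D (S k)) -> measurable_D W ->
  (\sum_(0 <= k <oo) \int[mu]_(x in D) ((S k x - W x) ^+ 2)%:E < +oo)%E ->
  {ae mu, forall x, D x -> S k x @[k --> \oo] --> W x}.
Proof.
move=> mS mW sfin.
have mU k : measurable_fun (D : set (borelRd R d))
    (fun x : borelRd R d => ((S k x - W x) ^+ 2)%:E).
  by apply/measurable_EFinP; apply: measurable_funX; exact: measurable_funB.
have U0 k (x : borelRd R d) : D x -> (0 <= ((S k x - W x) ^+ 2)%:E)%E.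
  by move=> _; rewrite lee_fin sqr_ge0.
have := ae_nneseries_lty mD mU U0 sfin.
apply: (@filterS _ _ (ae_filter_ringOfSetsType mu)) => x h Dx.
have c0 := cvg_nneseries_term (fun k => U0 k x Dx) (h Dx).
have {}c0 : (S k x - W x) ^+ 2 @[k --> \oo] --> 0 by exact: fine_cvg c0.
apply/cvgrPdist_lt => eps eps0.
move/cvgrPdist_lt : c0 => /(_ _ (exprn_gt0 2 eps0))[N _ HN].
exists N => // k Nk; have := HN k Nk; rewrite /= sub0r normrN.
rewrite distrC normrX ltr_sqr// nnegrE ?ltW//.
Qed.

(** Pointwise convergence identifies the limit; the weighted summability of the increments supplies
    an integrable majorant for all [B S_k v] at once, by telescoping. *)
Lemma cvg_ip_dominated : measurable_D B ->
  (forall k, measurable_D (S k)) -> measurable_D W -> L2 D v ->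
  (forall k, L2 D (fun x => B x * S k x)) ->
  {ae mu, forall x, D x -> S k x @[k --> \oo] --> W x} ->
  (\sum_(0 <= k <oo) \int[mu]_(x in D)
     (2 ^+ k * (B x * (S k.+1 x - S k x)) ^+ 2)%:E < +oo)%E ->
  ip D (fun x => B x * S k x) v @[k --> \oo] --> ip D (fun x => B x * W x) v.
Proof.
move=> mB mS mW Lv LBS aecv sfin.
pose U k (x : borelRd R d) := (2 ^+ k * (B x * (S k.+1 x - S k x)) ^+ 2)%:E.
have mU k : measurable_fun (D : set (borelRd R d)) (U k).
  apply/measurable_EFinP; apply: measurable_funM => //; apply: measurable_funX.
  by apply: measurable_funM => //; exact: measurable_funB.
have U0 k (x : borelRd R d) : D x -> (0 <= U k x)%E.
  by move=> _; rewrite lee_fin mulr_ge0 ?sqr_ge0// exprn_ge0.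
have iH := integrable_nneseries mD mU U0 sfin.
(* Obtained from [|a v| <= a^2 + v^2] with [a = B S_k] split into its initial value and the
   telescoped increments. *)
pose g (x : borelRd R d) : \bar R := (2%:E * ((B x * S 0%N x) ^+ 2)%:E +
  (v x ^+ 2)%:E + 4%:E * \sum_(0 <= k <oo) U k x)%E.
have ig : mu.-integrable D g.
  apply: integrableD => //; last exact: integrableZl.
  apply: integrableD => //; last exact: L2_integrable_sqr.
  by apply: integrableZl => //; exact: (L2_integrable_sqr mD (LBS 0%N)).
have mv := L2_measurable Lv.
have [] := @dominated_convergence _ _ _ mu D mD
  (fun k (x : borelRd R d) => (B x * S k x * v x)%:E)
  (fun x : borelRd R d => (B x * W x * v x)%:E) g.
- move=> k; apply/measurable_EFinP; apply: measurable_funM => //.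
  exact: measurable_funM.
- by apply/measurable_EFinP; apply: measurable_funM => //; exact: measurable_funM.
- move: aecv; apply: (@filterS _ _ (ae_filter_ringOfSetsType mu)) => x h Dx.
  apply: cvg_EFin; first exact: nearW.
  by apply: cvgM; [apply: cvgM; [exact: cvg_cst|exact: h]|exact: cvg_cst].
- exact: ig.
- apply: aeW => x k Dx.
  apply: (@le_trans _ _ (2 * (B x * S 0%N x) ^+ 2 + v x ^+ 2 +
      4 * \sum_(j < k) 2 ^+ j * (B x * (S j.+1 x - S j x)) ^+ 2)%:E).
    rewrite lee_fin.
    have tel : B x * S k x = B x * S 0%N x + \sum_(j < k) B x * (S j.+1 x - S j x).
      elim: k => [|k IH]; first by rewrite big_ord0 addr0.
      by rewrite big_ord_recr/= addrA -IH; ring.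
    rewrite tel; have := sqr_sum_le_weighted (fun j => B x * (S j.+1 x - S j x)) k.
    set s1 := \sum_(j < k) _; set s2 := \sum_(j < k) _; set b0 := B x * S 0%N x.
    move=> hs; rewrite normrM.
    have := sqr_ge0 (`|b0 + s1| - `|v x|); have := sqr_ge0 (b0 - s1).
    rewrite -[v x ^+ 2](@real_normK _ (v x)) ?num_real// => h1.
    rewrite sqrrB (@real_normK _ (b0 + s1)) ?num_real//.
    move=> h2; have := normr_ge0 (b0 + s1); have := normr_ge0 (v x); nra.
  rewrite !EFinD leeD//; last first.
    rewrite EFinM lee_wpmul2l// ?lee_fin//.
    apply: le_trans (nneseries_lim_ge k _); last by move=> n _ _; exact: U0.
    by rewrite big_mkord -sumEFin.
- move=> iW _.
  rewrite -[X in _ --> X -> _]fineK; last exact: (integrable_fin_num mD iW).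
  exact: fine_cvg.
Qed.

End dominated_inner_products.

(* Otherwise ring and lra unfold inner products down to Lebesgue integrals. *)
#[local] Opaque ip.

(** * The discrete Laplacian *)

Section discrete_laplacian.
Context {R : realType} {d : nat}.
Local Notation E := 'rV[R]_d.
Local Notation mu := (lebesgue_Rd R d).
Variables (D : set E) (T : @mesh R d).
Hypotheses (oD : open D) (bD : bounded_set D).
Hypothesis coverD : D `<=` \bigcup_(k : 'I_(ncells T)) cell k.
Implicit Types (u v y z a : E -> R).

Let mD : measurable (D : set (borelRd R d)).
Proof. exact: sub_sigma_algebra. Qed.

(** Wherever the derivative exists, it equals the slope of [v] on one of finitely many cells. *)
Lemma Vh_partial_bounded v (i : 'I_d) : Vh D T v ->
  exists M : R, forall x : E, D x -> `|partial i v x| <= M.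
Proof.
move=> [_ cv _ av].
have /choice[ab abP] : forall k : 'I_(ncells T), exists ab : 'rV[R]_d * R,
    forall x, cell k x -> v x = \sum_i ab.1 ord0 i * x ord0 i + ab.2.
  by move=> k; have [a [b h]] := av k; exists (a, b).
pose e : E := delta_mx ord0 i.
(* The first summand accounts for the default value of the derivative at points where it does not
   exist. *)
exists (`|point : R| + \sum_k `|(ab k).1 ord0 i|) => x Dx.
have [dx|ndx] := pselect (derivable v x e); last first.
  rewrite /partial (_ : 'D_e v x = point) ?lerDl ?sumr_ge0//.
  rewrite /derive; apply: dvgP; exact: ndx.
(* Pigeonhole: the points [x + e / (n + 1)] eventually lie in the open set [D], hence in cells, so
   some cell contains infinitely many of them. *)
have [k fr] : exists k : 'I_(ncells T), forall N : nat, exists n, (N <= n)%N /\ cell k (n.+1%:R^-1 *: e + x).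
  apply: contrapT => /forallNP nk.
  have H (k : 'I_(ncells T)) : exists N : nat,
      forall n, (N <= n)%N -> ~ cell k (n.+1%:R^-1 *: e + x).
    have /existsNP[N /forallNP HN] := nk k.
    by exists N => n Nn kn; apply: (HN n).
  have [N HN] := choice H.
  have cs : n.+1%:R^-1 *: e + x @[n --> \oo] --> (0 : R) *: e + x.
    apply: cvgD; last exact: cvg_cst.
    by apply: cvgZr_tmp; exact: cvg_harmonic.
  rewrite scale0r add0r in cs.
  have [N0 _ HN0] : \forall n \near \oo, D (n.+1%:R^-1 *: e + x).
    by apply: cs; exact: open_nbhs_nbhs.
  pose n := maxn N0 (\max_k N k).
  have /coverD[k _ kn] := HN0 n (leq_maxl _ _).
  by apply: (HN k n) kn; rewrite (leq_trans _ (leq_maxr _ _))// leq_bigmax.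
have -> : partial i v x = (ab k).1 ord0 i.
  rewrite /partial (@derive_frequently_affine _ _ v e cv x (ab k).1 (ab k).2)//.
    rewrite (bigD1 i)//= mxE !eqxx mulr1 big1 ?addr0// => j ji.
    by rewrite mxE (negbTE ji) andbF mulr0.
  move=> N; have [n [Nn kn]] := fr N; exists n; split => //.
  exact: abP.
rewrite (bigD1 k)//= addrCA lerDl addr_ge0// sumr_ge0//.
Qed.

Lemma Vh_partial_L2 v (i : 'I_d) : Vh D T v -> L2 D (partial i v).
Proof.
move=> Hv; have [M HM] := Vh_partial_bounded i Hv; case: Hv => _ cv _ _.
have mp : measurable_fun (D : set (borelRd R d)) (partial i v : borelRd R d -> R).
  by apply: measurable_funTS; exact: measurable_derive.
split => //.
apply: (@le_lt_trans _ _ (\int[mu]_(x in D) (M ^+ 2)%:E)%E).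
  apply: ge0_le_integral => //.
  - by move=> x _; rewrite lee_fin sqr_ge0.
  - by apply/measurable_EFinP; exact: measurable_funX.
  - move=> x Dx; rewrite lee_fin -(@real_normK _ (partial i v x)) ?num_real//.
    by rewrite ler_sqr ?nnegrE ?HM// (le_trans _ (HM x Dx)).
rewrite integral_cst// lte_mul_pinfty// ?lee_fin ?sqr_ge0//.
exact: bounded_lebesgue_Rd_lty.
Qed.

Lemma Ah_nonpos y a : Vh D T y -> is_Ah D T y a -> ip D a y <= 0.
Proof.
move=> Hy [_ Ha]; rewrite Ha// oppr_le0 sumr_ge0// => i _; exact: ip_ge0.
Qed.

(** Stated by four inner products because [partial] need not be additive at points where a
    derivative is missing. The square that appears is that of the difference of the gradients, not
    of the gradient of the difference. *)
Lemma Ah_monotone y y' a a' : Vh D T y -> Vh D T y' -> is_Ah D T y a -> is_Ah D T y' a' ->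
  ip D a y - ip D a y' - ip D a' y + ip D a' y' <= 0.
Proof.
move=> Hy Hy' [_ Ha] [_ Ha'].
(* An opaque name for the Dirichlet form, so that the arithmetic sees only atoms. *)
have [S SE] : exists S, forall u v, \sum_(i < d) ip D (partial i u) (partial i v) = S u v.
  by eexists.
have : 0 <= S y y - S y y' - S y' y + S y' y'.
  have -> : S y y - S y y' - S y' y + S y' y' =
      \sum_(i < d) ip D (fun x => -1 * partial i y' x + partial i y x)
        (fun x => -1 * partial i y' x + partial i y x).
    rewrite -!SE -sumrB -sumrB -big_split/=; apply: eq_bigr => i _.
    have L := Vh_partial_L2 i Hy; have L' := Vh_partial_L2 i Hy'.
    rewrite ip_lin ?ip_linr//; last exact: L2_lin.
    move: (ip D (partial i y') (partial i y')) (ip D (partial i y') (partial i y))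
      (ip D (partial i y) (partial i y')) (ip D (partial i y) (partial i y)).
    by move=> t1 t2 t3 t4; ring.
  by apply: sumr_ge0 => i _; exact: ip_ge0.
have e1 : ip D a y = - S y y by rewrite -SE; exact: Ha.
have e2 : ip D a y' = - S y y' by rewrite -SE; exact: Ha.
have e3 : ip D a' y = - S y' y by rewrite -SE; exact: Ha'.
have e4 : ip D a' y' = - S y' y' by rewrite -SE; exact: Ha'.
rewrite e1 e2 e3 e4 {e1 e2 e3 e4}.
move: (S y y) (S y y') (S y' y) (S y' y') => t1 t2 t3 t4; lra.
Qed.

End discrete_laplacian.

(** The rate [4^-k] stays summable after multiplication by the weights [2^k]; accumulating the
    thresholds makes the subsequence monotone. *)
Lemma vanishing_subsequence (R : realType) (a : nat -> \bar R) :
  a k @[k --> \oo] --> 0%E ->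
  exists M : nat -> nat, (forall k, (M k <= M k.+1)%N) /\
    forall k, (a (M k) <= (4 ^- k)%:E)%E.
Proof.
move=> /fine_cvgP[[N0 _ HN0] ca].
have H k : exists N, forall n, (N <= n)%N -> (a n <= (4 ^- k)%:E)%E.
  have e0 : 0 < (4 : R) ^- k by rewrite invr_gt0 exprn_gt0.
  move/cvgrPdist_lt : ca => /(_ _ e0)[N _ HN].
  exists (maxn N N0) => n; rewrite geq_max => /andP[Nn N0n].
  rewrite -(fineK (HN0 n N0n)) lee_fin ltW// (le_lt_trans (ler_norm _))//.
  by have := HN n Nn; rewrite /= sub0r normrN.
have [N HN] := choice H.
exists (fun k => \sum_(j < k.+1) N j)%N; split => k.
  by rewrite [leqRHS]big_ord_recr/= leq_addr.
by apply: HN; rewrite big_ord_recr/= leq_addl.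
Qed.

Section L2_random_variables.
Context {R : realType} {d : nat}.
Local Notation E := 'rV[R]_d.
Context {dO : measure_display} {Omega : measurableType dO}.
Variables (D : set E) (G : set (set Omega)) (X : Omega -> E -> R).
Hypothesis mD : measurable (D : set (borelRd R d)).
Hypothesis sG : sigma_algebra setT G.
Hypothesis rvX : L2_random_variable D G X.

Let LX w : L2 D (X w). Proof. by case: rvX. Qed.

Let normX a : L2 D a -> sub_measurable G (fun w => normL2 D (fun x => X w x - a x)).
Proof.
move=> La; apply/(sub_measurableP _ sG).
apply: (measurability _ (RGenInftyO.measurableE R)) => _ [_ [c ->] <-].
rewrite setTI measurable_g_measurableTypeE//.
rewrite (_ : _ @^-1` _ = [set w | normL2 D (fun x => X w x - a x) < c]).
  by case: rvX => _; exact.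
by apply/seteqP; split => w /=; rewrite in_itv.
Qed.

(** Measurability is given for distances to fixed elements only; polarization expresses the inner
    product through the distances to [v] and [- v]. *)
Lemma L2_random_variable_ip v : L2 D v -> sub_measurable G (fun w => ip D (X w) v).
Proof.
move=> Lv.
have Lm := normX (L2_scale mD (-1) Lv); have Lp := normX Lv.
have -> : (fun w => ip D (X w) v) = (fun w =>
    (normL2 D (fun x => X w x - -1 * v x) ^+ 2 - normL2 D (fun x => X w x - v x) ^+ 2) * 4^-1).
  apply/funext => w; rewrite !normL2_sqr.
  have -> : (fun x => X w x - -1 * v x) = fun x => 1 * v x + X w x.
    by apply/funext => x; ring.
  have -> : (fun x => X w x - v x) = fun x => -1 * v x + X w x.
    by apply/funext => x; ring.
  have L1 := L2_lin mD 1 Lv (LX w); have L2' := L2_lin mD (-1) Lv (LX w).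
  rewrite !(ip_lin mD)// !(ip_linr mD)// (ipC D v (X w)).
  move: (ip D v v) (ip D (X w) v) (ip D (X w) (X w)) => t1 t2 t3; lra.
apply/(sub_measurableP _ sG); apply: measurable_funM => //.
by apply: measurable_funB; apply: measurable_funX; exact/(sub_measurableP _ sG).
Qed.

Lemma L2_random_variable_normsq : sub_measurable G (fun w => ip D (X w) (X w)).
Proof.
have -> : (fun w => ip D (X w) (X w)) = (fun w => normL2 D (fun x => X w x - 0) ^+ 2).
  apply/funext => w; rewrite normL2_sqr.
  by have -> : (fun x => X w x - 0) = X w by apply/funext => x; rewrite subr0.
apply/(sub_measurableP _ sG); apply: measurable_funX.
by apply/(sub_measurableP _ sG); apply: normX; exact: L2_0.
Qed.

(** Here the centre is itself random, so the square is expanded into scalar products with fixed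
    elements. *)
Lemma L2_random_variable_dist2 (M : nat) (c : nat -> Omega -> R) (g : nat -> E -> R) :
  (forall m, sub_measurable G (c m)) -> (forall m, L2 D (g m)) ->
  sub_measurable G (fun w =>
    ip D (fun x => -1 * (\sum_(m < M) c m w * g m x) + X w x)
         (fun x => -1 * (\sum_(m < M) c m w * g m x) + X w x)).
Proof.
move=> mc Lg.
have -> : (fun w => ip D (fun x => -1 * (\sum_(m < M) c m w * g m x) + X w x)
    (fun x => -1 * (\sum_(m < M) c m w * g m x) + X w x)) =
  (fun w => \sum_(m < M) c m w * (\sum_(n < M) c n w * ip D (g n) (g m))
    - 2 * (\sum_(m < M) c m w * ip D (X w) (g m)) + ip D (X w) (X w)).
  apply/funext => w.
  have LS : L2 D (fun x => \sum_(m < M) c m w * g m x).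
    exact: (L2_sum mD _ (fun m : 'I_M => c m w) (fun m => Lg m)).
  have L1 := L2_lin mD (-1) LS (LX w).
  rewrite (ip_lin mD)// !(ip_linr mD)//.
  have ipS v : L2 D v -> ip D (fun x => \sum_(m < M) c m w * g m x) v =
      \sum_(m < M) c m w * ip D (g m) v.
    by move=> Lv; exact: (ip_sum mD _ (fun m : 'I_M => c m w) (fun m => Lg m) Lv).
  rewrite (ipC D (X w)) ipS// ipS//.
  have -> : \sum_(m < M) c m w * ip D (g m) (fun x => \sum_(m0 < M) c m0 w * g m0 x) =
      \sum_(m < M) c m w * (\sum_(n < M) c n w * ip D (g n) (g m)).
    by apply: eq_bigr => m _; rewrite (ipC D (g m)) ipS.
  have -> : \sum_(m < M) c m w * ip D (g m) (X w) = \sum_(m < M) c m w * ip D (X w) (g m).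
    by apply: eq_bigr => m _; rewrite (ipC D (g m)).
  move: (\sum_(m < M) _) (\sum_(m < M) _) (ip D (X w) (X w)) => t1 t2 t3; ring.
apply/(sub_measurableP _ sG); apply: measurable_funD; last first.
  by apply/(sub_measurableP _ sG); exact: L2_random_variable_normsq.
apply: measurable_funB.
  apply: measurable_sum => m; apply: measurable_funM; first exact/(sub_measurableP _ sG).
  by apply: measurable_sum => n; apply: measurable_funM => //; exact/(sub_measurableP _ sG).
apply: measurable_funM => //; apply: measurable_sum => m; apply: measurable_funM.
  exact/(sub_measurableP _ sG).
by apply/(sub_measurableP _ sG); exact: L2_random_variable_ip.
Qed.

End L2_random_variables.

Section noise_increment.
Context {R : realType} {d : nat}.
Local Notation E := 'rV[R]_d.
Local Notation mu := (lebesgue_Rd R d).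
Context {dO : measure_display} {Omega : measurableType dO}.
Variables (P : probability Omega R) (D : set E) (F : R -> set (set Omega)).
Variables (qe : nat -> R) (ge : nat -> E -> R) (beta : nat -> R -> Omega -> R)
  (W : R -> Omega -> E -> R).
Hypothesis mD : measurable (D : set (borelRd R d)).
Hypothesis hF : normal_filtration P F.
Hypothesis Lge : forall m, L2 D (ge m).
Hypothesis hW : Q_wiener P D F qe ge beta W.
Variables (s t : R).
Hypotheses (s0 : 0 <= s) (st : s < t).

Let t0 : 0 <= t. Proof. exact: le_trans (ltW st). Qed.
Let sG u : 0 <= u -> sigma_algebra setT (F u).
Proof. by move=> u0; case: hF => /(_ u u0)[]. Qed.
Let Gm u : 0 <= u -> F u `<=` measurable.
Proof. by move=> u0; case: hF => /(_ u u0)[]. Qed.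
Let Fst : F s `<=` F t.
Proof. by case: hF => _ h _ _; apply: h; rewrite s0 (ltW st). Qed.

Definition increment (m : nat) (w : Omega) : R := beta m t w - beta m s w.

Lemma beta_sub_measurable m u : 0 <= u -> sub_measurable (F u) (beta m u).
Proof. by case: hW => -[h _ _ _ _] _ _ _; exact: h. Qed.

Lemma increment_sub_measurable m : sub_measurable (F t) (increment m).
Proof.
apply/(sub_measurableP _ (sG t0)); apply: measurable_funB;
  apply/(sub_measurableP _ (sG t0)); first exact: beta_sub_measurable.
by move=> B mB; apply: Fst; exact: beta_sub_measurable.
Qed.

Let sg := Num.sqrt (t - s).

Let sg0 : 0 < sg. Proof. by rewrite sqrtr_gt0 subr_gt0. Qed.

Lemma increment_moment_le (K M : nat) (r : R) (a : 'I_K -> Omega -> R)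
    (b : nat -> 'I_K -> Omega -> R) (A : set Omega) : 1 <= r -> F s A ->
  (forall i, sub_measurable (F s) (a i)) -> (forall m i, sub_measurable (F s) (b m i)) ->
  (\int[P]_(w in A) ((\sum_i (a i w + \sum_(m < M) increment m w * b m i w) ^+ 2) `^ r)%:E <=
   \int[P]_(w in A) ((\sum_i a i w ^+ 2 +
     (2 * r - 1) * (t - s) * \sum_(m < M) \sum_i b m i w ^+ 2) `^ r)%:E)%E.
Proof.
move=> r1 FA ma mb.
have := @gaussian_moment_le _ Omega R P (F s) increment sg sg0 (sG s0) (Gm s0).
rewrite /sg sqr_sqrtr ?subr_ge0 ?(ltW st)//; apply => //.
- by move=> m; apply: sub_measurable_measurable (Gm t0) _ (increment_sub_measurable m).
- by case: hW => -[_ _ _ law _] _ _ _ m B mB; apply: law => //; rewrite s0 st.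
- case: hW => -[_ _ _ _ ind] _ _ _ M' A' B' FA' mB'.
  by apply: ind => //; rewrite s0 st.
Qed.

Definition noise_sum (u : R) (M : nat) (w : Omega) : E -> R :=
  fun x => \sum_(m < M) Num.sqrt (qe m) * beta m u w * ge m x.

Lemma noise_sum_L2 u M w : L2 D (noise_sum u M w).
Proof.
exact: (L2_sum mD _ (fun m : 'I_M => Num.sqrt (qe m) * beta m u w) (fun m => Lge m)).
Qed.

Let W_L2 u w : 0 <= u -> L2 D (W u w).
Proof. by move=> u0; case: hW => _ /(_ u u0)[]. Qed.

Definition noise_error (u : R) (M : nat) (w : Omega) : R :=
  ip D (fun x => -1 * noise_sum u M w x + W u w x) (fun x => -1 * noise_sum u M w x + W u w x).

Lemma noise_error_sub_measurable u M : 0 <= u -> sub_measurable (F u) (noise_error u M).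
Proof.
move=> u0; have rvW : L2_random_variable D (F u) (W u) by case: hW => _ /(_ u u0).
apply: (L2_random_variable_dist2 mD (sG u0) rvW M
  (c := fun m w => Num.sqrt (qe m) * beta m u w)) => // m.
apply/(sub_measurableP _ (sG u0)); apply: measurable_funM => //.
by apply/(sub_measurableP _ (sG u0)); exact: beta_sub_measurable.
Qed.

Lemma noise_error_cvg u : 0 <= u ->
  (\int[P]_w (noise_error u M w)%:E @[M --> \oo] --> 0)%E.
Proof.
move=> u0; case: hW => _ _ _ /(_ u u0).
rewrite (_ : (fun M => \int[P]_w (normL2 D (fun x => W u w x -
   \sum_(m < M) Num.sqrt (qe m) * beta m u w * ge m x)%R ^+ 2)%:E)%E =
   (fun M => \int[P]_w (noise_error u M w)%:E)%E)//.
apply/funext => M; apply: eq_integral => w _.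
rewrite normL2_sqr /noise_error.
by rewrite (_ : (fun x => -1 * noise_sum u M w x + W u w x) = fun x => W u w x -
   \sum_(m < M) Num.sqrt (qe m) * beta m u w * ge m x)//; apply/funext => x; rewrite /noise_sum; ring.
Qed.

(** Two passages from summable means to pointwise convergence: first over [Omega] for the squared
    errors, then over [D] for almost every fixed [w]. *)
Lemma noise_sum_ae_cvg u (M : nat -> nat) : 0 <= u ->
  (forall k, (\int[P]_w (noise_error u (M k) w)%:E <= (4 ^- k)%:E)%E) ->
  {ae P, forall w, {ae mu, forall x, D x ->
    noise_sum u (M k) w x @[k --> \oo] --> W u w x}}.
Proof.
move=> u0 HM.
have mU k : measurable_fun setT (fun w => (noise_error u (M k) w)%:E).
  by apply/measurable_EFinP; apply: sub_measurable_measurable (Gm u0) _ (noise_error_sub_measurable _ u0).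
have U0 k w : setT w -> (0 <= (noise_error u (M k) w)%:E)%E.
  by move=> _; rewrite lee_fin ip_ge0.
have sfin : (\sum_(0 <= k <oo) \int[P]_w (noise_error u (M k) w)%:E < +oo)%E.
  apply: (@nneseries_geometric_lty _ _ 1) => // k.
    by apply: integral_ge0 => w; exact: U0.
  rewrite (le_trans (HM k))// lee_fin mul1r lef_pV2 ?posrE ?exprn_gt0//.
  by rewrite lerXn2r// ?nnegrE//; lra.
have := ae_nneseries_lty measurableT mU U0 sfin.
apply: filterS => w /(_ Logic.I) h.
have Le k := noise_sum_L2 u (M k) w.
apply: (ae_cvg_of_summable mD (S := fun k => noise_sum u (M k) w)).
- by move=> k; exact: L2_measurable.
- exact: L2_measurable (W_L2 w u0).
- rewrite (eq_eseriesr (g := fun k => (noise_error u (M k) w)%:E))// => k _.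
  rewrite /noise_error -L2_sqr//; last by apply: L2_lin => //; exact: W_L2.
  by apply: eq_integral => x _; congr EFin; ring.
Qed.

End noise_increment.

(** Turns a block of the noise series into a sum starting at 0, the shape in which the moment
    estimate applies. *)
Lemma sum_tail_indicator (R : pzRingType) (a : nat -> R) (M M' : nat) : (M <= M')%N ->
  \sum_(m < M') a m - \sum_(m < M) a m = \sum_(m < M') (M <= m)%N%:R * a m.
Proof.
move=> MM'; elim: M' MM' => [|n IH].
  by rewrite leqn0 => /eqP ->; rewrite !big_ord0 subrr.
rewrite leq_eqVlt => /predU1P[->|].
  rewrite subrr big1// => m _; rewrite leqNgt ltn_ord/= mul0r//.
by rewrite ltnS => Mn; rewrite !big_ord_recr/= -IH// Mn mul1r addrAC.
Qed.

(** * Truncation of the multiplicative noise *)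

Section multiplicative_noise.
Context {R : realType} {d : nat}.
Local Notation E := 'rV[R]_d.
Local Notation mu := (lebesgue_Rd R d).
Context {dO : measure_display} {Omega : measurableType dO}.
Variables (P : probability Omega R) (D : set E) (F : R -> set (set Omega)).
Variables (qe : nat -> R) (ge : nat -> E -> R) (beta : nat -> R -> Omega -> R)
  (W : R -> Omega -> E -> R).
Hypothesis mD : measurable (D : set (borelRd R d)).
Hypothesis hF : normal_filtration P F.
Hypothesis Lge : forall m, L2 D (ge m).
Hypothesis hW : Q_wiener P D F qe ge beta W.
Variables (s t : R).
Hypotheses (s0 : 0 <= s) (st : s < t).
Variables (K : nat) (e : 'I_K -> E -> R) (y : 'I_K -> Omega -> R) (gt : R -> R).
Hypothesis ce : forall i, continuous (e i).
Hypothesis my : forall i, sub_measurable (F s) (y i).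
Hypothesis mgt : measurable_fun setT gt.
Local Notation u := (superpose (T1 := Omega) e y).
Hypothesis HSu : forall w, hilbert_schmidt D qe ge (G_op gt (u w)).

Let sG : sigma_algebra setT (F s). Proof. by case: hF => /(_ s s0)[]. Qed.
Let Gm : F s `<=` measurable. Proof. by case: hF => /(_ s s0)[]. Qed.
Let sgx m : E -> R := fun x => Num.sqrt (qe m) * ge m x.

Definition noise_mode (m : nat) (w : Omega) : E -> R :=
  G_op gt (u w) (fun x => Num.sqrt (qe m) * ge m x).

Lemma noise_mode_L2 m w : L2 D (noise_mode m w).
Proof. by have [h _] := HSu w; exact: h. Qed.

Definition mode_energy (m : nat) (w : Omega) : R := ip D (noise_mode m w) (noise_mode m w).

Definition hs_energy (w : Omega) : R := fine (HS_norm2 D qe ge (G_op gt (u w))).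

Lemma mode_energy_ge0 m w : 0 <= mode_energy m w. Proof. exact: ip_ge0. Qed.

Let HS_series w : HS_norm2 D qe ge (G_op gt (u w)) = (\sum_(0 <= m <oo) (mode_energy m w)%:E)%E.
Proof.
apply: eq_eseriesr => m _; rewrite /mode_energy -L2_sqr//.
exact: noise_mode_L2.
Qed.

Let HS_fin w : HS_norm2 D qe ge (G_op gt (u w)) \is a fin_num.
Proof.
have [_ h] := HSu w; rewrite ge0_fin_numE// HS_series.
by apply: nneseries_ge0 => m _ _; rewrite lee_fin mode_energy_ge0.
Qed.

Lemma hs_energy_ge0 w : 0 <= hs_energy w.
Proof.
rewrite fine_ge0// HS_series.
by apply: nneseries_ge0 => m _ _; rewrite lee_fin mode_energy_ge0.
Qed.

Lemma sum_mode_energy_le M w : \sum_(m < M) mode_energy m w <= hs_energy w.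
Proof.
rewrite -lee_fin fineK ?HS_fin// HS_series -sumEFin -(big_mkord xpredT (fun m => (mode_energy m w)%:E)).
by apply: nneseries_lim_ge => m _ _; rewrite lee_fin mode_energy_ge0.
Qed.

Lemma sum_mode_energy_cvg w : \sum_(m < M) mode_energy m w @[M --> \oo] --> hs_energy w.
Proof.
have cv : (\sum_(m < M) mode_energy m w)%:E @[M --> \oo] --> (hs_energy w)%:E.
  rewrite fineK ?HS_fin// HS_series.
  rewrite (_ : (fun M => _) = (fun M => \sum_(0 <= m < M) (mode_energy m w)%:E)%E).
    by apply: is_cvg_ereal_nneg_natsum => m _; rewrite lee_fin mode_energy_ge0.
  by apply/funext => M; rewrite big_mkord sumEFin.
exact: fine_cvg cv.
Qed.

Lemma mode_energy_sub_measurable m : sub_measurable (F s) (mode_energy m).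
Proof.
apply/(sub_measurableP _ sG).
have myG i : measurable_fun setT (y i : g_sigma_algebraType (F s) -> R).
  exact/(sub_measurableP _ sG).
have mg2 : measurable_fun setT (fun a : R => gt a ^+ 2) by exact: measurable_funX.
have mgm : measurable_fun (D : set (borelRd R d)) (fun x : borelRd R d => sgx m x ^+ 2).
  apply: measurable_funX; apply: measurable_funM => //; exact: L2_measurable.
have := measurable_ip_superpose mD ce myG mg2 mgm.
congr (measurable_fun _ _); apply/funext => w.
rewrite /mode_energy; apply: eq_Rintegral => x _.
by rewrite /noise_mode /G_op /sgx /superpose; ring.
Qed.

Lemma hs_energy_sub_measurable : sub_measurable (F s) hs_energy.
Proof.
apply/(sub_measurableP _ sG).
apply: (@measurable_fun_cvg _ (g_sigma_algebraType (F s)) R setT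
  (fun M w => \sum_(m < M) mode_energy m w)); last by move=> w _; exact: sum_mode_energy_cvg.
move=> M; apply: measurable_sum => m.
by apply/(sub_measurableP _ sG); exact: mode_energy_sub_measurable.
Qed.

(* The energy of gt (u w) need not have a finite mean; this weight, known at
   time s, bounds the tails of the noise series by 1. *)
Let wt (w : Omega) : R := (1 + hs_energy w)^-1.

Let wt_gt0 w : 0 < wt w.
Proof. by rewrite invr_gt0 ltr_pwDl// hs_energy_ge0. Qed.

Let wt_sub_measurable : sub_measurable (F s) wt.
Proof.
apply/(sub_measurableP _ sG).
have -> : wt = (fun a : R => a `^ (-1)) \o (fun w => 1 + hs_energy w).
  by apply/funext => w /=; rewrite powR_inv1// addr_ge0// hs_energy_ge0.
apply: (@measurableT_comp _ _ _ _ _ _ (fun a : R => a `^ (-1))); first exact: measurable_powR.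
apply: measurable_funD => //.
by apply/(sub_measurableP _ sG); exact: hs_energy_sub_measurable.
Qed.

Let tail (M : nat) (w : Omega) : R := wt w * (hs_energy w - \sum_(m < M) mode_energy m w).

Let tail01 M w : 0 <= tail M w <= 1.
Proof.
have h1 := sum_mode_energy_le M w.
have h2 : 0 <= \sum_(m < M) mode_energy m w by apply: sumr_ge0 => m _; exact: mode_energy_ge0.
rewrite mulr_ge0 ?(ltW (wt_gt0 w)) ?subr_ge0//=.
rewrite /tail /wt mulrC ler_pdivrMr ?mul1r; last by rewrite ltr_pwDl// hs_energy_ge0.
by move: h2; lra.
Qed.

Let tail_sub_measurable M : sub_measurable (F s) (tail M).
Proof.
apply/(sub_measurableP _ sG); apply: measurable_funM; first exact/(sub_measurableP _ sG).
apply: measurable_funB.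
  by apply/(sub_measurableP _ sG); exact: hs_energy_sub_measurable.
apply: measurable_sum => m.
by apply/(sub_measurableP _ sG); exact: mode_energy_sub_measurable.
Qed.

(** Dominated convergence with the constant 1, which is available thanks to the weight. *)
Let tail_cvg : (\int[P]_w (tail M w)%:E @[M --> \oo] --> 0)%E.
Proof.
have m1 M : measurable_fun setT (fun w => (tail M w)%:E).
  by apply/measurable_EFinP; exact: sub_measurable_measurable Gm _ (tail_sub_measurable M).
have [] := @dominated_convergence _ _ _ P setT measurableT (fun M w => (tail M w)%:E)
  (fun=> 0%E) (fun=> 1%E).
- exact: m1.
- exact: measurable_cst.
- apply: aeW => w _; apply: cvg_EFin; first exact: nearW.
  rewrite /tail /comp/= -[X in _ --> X](mulr0 (wt w)); apply: cvgM; first exact: cvg_cst.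
  rewrite -[X in _ --> X](subrr (hs_energy w)); apply: cvgB; first exact: cvg_cst.
  exact: sum_mode_energy_cvg.
- exact: finite_measure_integrable_cst.
- by apply: aeW => w M _; case/andP: (tail01 M w) => a b; rewrite gee0_abs lee_fin.
- by move=> _ _; rewrite integral0.
Qed.

Let S (M : nat) (w : Omega) : E -> R := fun x => \sum_(m < M) increment beta s t m w * sgx m x.

(** Coefficient of the m-th increment in the weighted tail at the point [x]. The square root of the
    weight sits inside because the estimate is quadratic, and the restriction by [D] allows
    integration over the whole space. *)
Let bb (M : nat) (m : nat) (w : Omega) (x : E) : R :=
  (M <= m)%N%:R * (Num.sqrt (wt w) * (gt (u w x) * (sgx m \_ D) x)).

Let Omega_y i : measurable_fun setT (y i).
Proof. exact: sub_measurable_measurable Gm _ (my i). Qed.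

Let measurable_sgx m : measurable_fun (D : set (borelRd R d)) (sgx m : borelRd R d -> R).
Proof. by apply: measurable_funM => //; exact: L2_measurable. Qed.

Let measurable_sqrt_wt : measurable_fun setT (fun w : g_sigma_algebraType (F s) => Num.sqrt (wt w)).
Proof.
have -> : (fun w : g_sigma_algebraType (F s) => Num.sqrt (wt w)) = (fun a : R => a `^ 2^-1) \o wt.
  by apply/funext => w /=; rewrite powR12_sqrt// ltW.
apply: (@measurableT_comp _ _ _ _ _ _ (fun a : R => a `^ 2^-1)); first exact: measurable_powR.
exact/(sub_measurableP _ sG).
Qed.

Let bb_sub_measurable M m x : sub_measurable (F s) (bb M m ^~ x).
Proof.
apply/(sub_measurableP _ sG); apply: measurable_funM => //; apply: measurable_funM => //.
apply: measurable_funM => //; apply: measurableT_comp => //.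
apply: measurable_sum => i; apply: measurable_funM => //.
exact/(sub_measurableP _ sG).
Qed.

Let bb_measurable M m : measurable_fun setT
  (fun z : Omega * borelRd R d => bb M m z.1 z.2).
Proof.
apply: measurable_funM => //; apply: measurable_funM; last exact: measurable_superpose.
have h : measurable_fun setT (fun w : Omega => Num.sqrt (wt w)).
  by apply: sub_measurable_measurable Gm _ _; exact/(sub_measurableP _ sG).
exact: (measurableT_comp h measurable_fst).
Qed.

Let increment_measurable m : measurable_fun setT (increment beta s t m).
Proof.
have t0 : 0 <= t by exact: le_trans (ltW st).
apply: sub_measurable_measurable _ _ (increment_sub_measurable hF hW s0 st m).
by case: hF => /(_ t t0)[].
Qed.

Let bb_sqr M m w :
  (\int[mu]_x (bb M m w x ^+ 2)%:E = ((M <= m)%N%:R * wt w * mode_energy m w)%:E)%E.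
Proof.
have c0 : 0 <= (M <= m)%N%:R * wt w by rewrite mulr_ge0// ltW.
transitivity (\int[mu]_(x in D) (((M <= m)%N%:R * wt w)%:E * (noise_mode m w x ^+ 2)%:E))%E.
  rewrite [RHS]integral_mkcond; apply: eq_integral => x _.
  rewrite /bb !exprMn sqr_sqrtr ?(ltW (wt_gt0 w))//.
  rewrite !patchE; case: ifP => _; rewrite ?expr0n ?mulr0 ?mule0//.
  rewrite -EFinM; congr EFin; rewrite /noise_mode /G_op /sgx.
  by case: (M <= m)%N; rewrite ?expr1n ?expr0n ?mul1r ?mul0r//; ring.
rewrite ge0_integralZl//.
- by rewrite L2_sqr//; exact: noise_mode_L2.
- by apply/measurable_EFinP; apply: measurable_funX; exact: L2_measurable (noise_mode_L2 m w).
- by move=> x _; rewrite lee_fin sqr_ge0.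
Qed.

Let measurable_gtu w : measurable_fun setT (fun x : borelRd R d => gt (u w x)).
Proof.
apply: measurableT_comp => //; apply: measurable_sum => i.
by apply: measurable_funM => //; exact: continuous_measurable_Rd.
Qed.

Let S_measurable M w : measurable_fun (D : set (borelRd R d)) (S M w : borelRd R d -> R).
Proof. by apply: measurable_sum => m; apply: measurable_funM. Qed.

Let h (M M' : nat) (z : Omega * borelRd R d) : \bar R :=
  ((\sum_(m < M') increment beta s t m z.1 * bb M m z.1 z.2) ^+ 2)%:E.

Let mh M M' : measurable_fun setT (h M M').
Proof.
apply/measurable_EFinP; apply: measurable_funX; apply: measurable_sum => m.
apply: measurable_funM => //; exact: (measurableT_comp (increment_measurable m) measurable_fst).
Qed.

Let h0 M M' z : (0 <= h M M' z)%E. Proof. by rewrite lee_fin sqr_ge0. Qed.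

Let int_h M M' w : (M <= M')%N ->
  ((wt w)%:E * \int[mu]_(x in D) ((gt (u w x) * (S M' w x - S M w x)) ^+ 2)%:E
    = \int[mu]_x h M M' (w, x))%E.
Proof.
move=> MM'.
have mgS : measurable_fun (D : set (borelRd R d))
    (fun x : borelRd R d => gt (u w x) * (S M' w x - S M w x)).
  apply: measurable_funM; first exact: measurable_funTS.
  by apply: measurable_funB; exact: S_measurable.
rewrite -ge0_integralZl//; last 3 first.
- by apply/measurable_EFinP; exact: measurable_funX.
- by move=> x _; rewrite lee_fin sqr_ge0.
- by rewrite lee_fin ltW.
rewrite integral_mkcond; apply: eq_integral => x _.
rewrite patchE /h /bb/=; case: ifPn => xD; last first.
  rewrite big1 ?expr0n// => m _; rewrite patchE (negbTE xD) !mulr0//.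
rewrite -EFinM; congr EFin.
rewrite /S (sum_tail_indicator (fun m => increment beta s t m w * sgx m x) MM').
rewrite -{1}(@sqr_sqrtr _ (wt w)) ?(ltW (wt_gt0 w))// -exprMn; congr (_ ^+ 2).
rewrite !mulr_sumr; apply: eq_bigr => m _; rewrite patchE xD; ring.
Qed.

Let weighted_energy_measurable M M' : (M <= M')%N -> measurable_fun setT
  (fun w => (wt w)%:E * \int[mu]_(x in D) ((gt (u w x) * (S M' w x - S M w x)) ^+ 2)%:E)%E.
Proof.
move=> MM'; under eq_fun do rewrite (int_h _ MM').
exact: (@measurable_fun_fubini_tonelli_F _ _ _ _ _ mu _ (@mh M M') (@h0 M M')).
Qed.

(** At each fixed [x] the coefficients are known at time [s], and the moment inequality with one
    coordinate and [r = 1] plays the role of the Ito isometry. Tonelli then restores the integral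
    over [x]. *)
Lemma noise_tail_estimate M M' : (M <= M')%N ->
  (\int[P]_w ((wt w)%:E * \int[mu]_(x in D) ((gt (u w x) * (S M' w x - S M w x)) ^+ 2)%:E)
   <= (t - s)%:E * \int[P]_w (tail M w)%:E)%E.
Proof.
move=> MM'.
pose b2 (z : Omega * borelRd R d) : \bar R :=
  ((t - s) * \sum_(m < M') bb M m z.1 z.2 ^+ 2)%:E.
have mb2 : measurable_fun setT b2.
  apply/measurable_EFinP; apply: measurable_funM => //; apply: measurable_sum => m.
  exact: measurable_funX.
have ts0 : 0 <= t - s by rewrite subr_ge0 ltW.
have b20 z : (0 <= b2 z)%E.
  by rewrite lee_fin mulr_ge0// sumr_ge0// => m _; exact: sqr_ge0.
under eq_integral do rewrite (int_h _ MM').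
rewrite (fubini_tonelli (h M M') (@mh M M') (@h0 M M')).
apply: (@le_trans _ _ (\int[mu]_x \int[P]_w b2 (w, x)))%E.
  apply: ge0_le_integral => //.
  - by move=> x _; apply: integral_ge0 => w _; exact: h0.
  - exact: (@measurable_fun_fubini_tonelli_G _ _ _ _ _ P _ (@mh M M') (@h0 M M')).
  - exact: measurable_fun_fubini_tonelli_G.
  move=> x _.
  have G0 : F s setT by have [h0' hC _] := sG; rewrite -(setD0 setT); exact: hC.
  have := increment_moment_le hF hW s0 st M' (a := fun (_ : 'I_1) _ => 0)
    (b := fun m _ => bb M m ^~ x) (lexx 1) G0.
  have -> : (\int[P]_w ((\sum_(i < 1) (0 + \sum_(m < M')
      increment beta s t m w * bb M m w x) ^+ 2) `^ 1)%:E = \int[P]_w h M M' (w, x))%E.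
    by apply: eq_integral => w _; rewrite big_ord1 add0r powRr1 ?sqr_ge0.
  have -> : (\int[P]_w ((\sum_(i < 1) 0 ^+ 2 + (2 * 1 - 1) * (t - s) *
      \sum_(m < M') \sum_(i < 1) bb M m w x ^+ 2) `^ 1)%:E = \int[P]_w b2 (w, x))%E.
    apply: eq_integral => w _; rewrite big_ord1 expr0n add0r.
    have -> : (2 * 1 - 1) * (t - s) = t - s by ring.
    have -> : \sum_(m < M') \sum_(i < 1) bb M m w x ^+ 2 = \sum_(m < M') bb M m w x ^+ 2.
      by apply: eq_bigr => m _; rewrite big_ord1.
    by rewrite powRr1// mulr_ge0// sumr_ge0// => m _; exact: sqr_ge0.
  apply => //.
  move=> _; apply/(sub_measurableP _ sG); exact: measurable_cst.
have mtail : measurable_fun setT (tail M).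
  exact: sub_measurable_measurable Gm _ (tail_sub_measurable M).
have -> : ((t - s)%:E * \int[P]_w (tail M w)%:E = \int[P]_w ((t - s)%:E * (tail M w)%:E))%E.
  rewrite ge0_integralZl//; first exact/measurable_EFinP.
  by move=> w _; rewrite lee_fin; case/andP: (tail01 M w).
rewrite -(fubini_tonelli b2 mb2 b20).
apply: ge0_le_integral => //.
- by move=> w _; apply: integral_ge0 => x _; exact: b20.
- exact: measurable_fun_fubini_tonelli_F.
- by apply/measurable_EFinP; exact: measurable_funM.
move=> w _.
have -> : (\int[mu]_x b2 (w, x) =
    ((t - s) * \sum_(m < M') (M <= m)%N%:R * wt w * mode_energy m w)%:E)%E.
  rewrite /b2/=; under eq_integral do rewrite EFinM -sumEFin.
  have mb m : measurable_fun setT (fun x : borelRd R d => (bb M m w x ^+ 2)%:E).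
    apply/measurable_EFinP; apply: measurable_funX.
    exact: (measurable_fun_pair2 w (bb_measurable M m)).
  have b0 m x : (0 <= (bb M m w x ^+ 2)%:E)%E by rewrite lee_fin sqr_ge0.
  rewrite ge0_integralZl//; last 2 first.
  - exact: emeasurable_sum.
  - by move=> x _; apply: sume_ge0 => m _.
  rewrite ge0_integral_sum// EFinM -sumEFin; congr (_ * _)%E.
  by apply: eq_bigr => m _; exact: bb_sqr.
rewrite -EFinM lee_fin ler_wpM2l//.
have -> : \sum_(m < M') (M <= m)%N%:R * wt w * mode_energy m w =
    wt w * \sum_(m < M') (M <= m)%N%:R * mode_energy m w.
  by rewrite mulr_sumr; apply: eq_bigr => m _; ring.
rewrite -(sum_tail_indicator (mode_energy ^~ w) MM') ler_wpM2l ?(ltW (wt_gt0 w))//.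
by rewrite lerB// sum_mode_energy_le.
Qed.

(** Presents the coordinates of G(u) dW as limits of finite Gaussian sums. The exceptional set does
    not depend on [v]: convergence of the noise and the majorant are both obtained before [v]
    enters. *)
Lemma noise_subsequence : exists Mk : nat -> nat, {ae P, forall w, forall v, L2 D v ->
  \sum_(m < Mk k) increment beta s t m w * ip D (noise_mode m w) v @[k --> \oo] -->
  ip D (G_op gt (u w) (fun x => W t w x - W s w x)) v}.
Proof.
have t0 : 0 <= t by exact: le_trans (ltW st).
(* A single sequence collects the errors of W at both times and the weighted tail, so that one
   extraction serves all three. *)
pose a M := (\int[P]_w (noise_error D qe ge beta W t M w)%:E +
  \int[P]_w (noise_error D qe ge beta W s M w)%:E + \int[P]_w (tail M w)%:E)%E.
have ca : a M @[M --> \oo] --> 0%E.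
  have c1 := noise_error_cvg hW t0; have c2 := noise_error_cvg hW s0.
  have := cvgeD _ (cvgeD _ c1 c2) tail_cvg.
  by rewrite !adde0; apply.
have err0 r M : (0 <= \int[P]_w (noise_error D qe ge beta W r M w)%:E)%E.
  by apply: integral_ge0 => w _; rewrite lee_fin ip_ge0.
have tail0 M : (0 <= \int[P]_w (tail M w)%:E)%E.
  by apply: integral_ge0 => w _; rewrite lee_fin; case/andP: (tail01 M w).
have [Mk [Mk_incr Mk_le]] := vanishing_subsequence ca.
have at_ := noise_sum_ae_cvg mD hF Lge hW t0 (M := Mk)
  (fun k => le_trans (le_trans (leeDl _ (err0 s (Mk k))) (leeDl _ (tail0 (Mk k)))) (Mk_le k)).
have as_ := noise_sum_ae_cvg mD hF Lge hW s0 (M := Mk)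
  (fun k => le_trans (le_trans (leeDr _ (err0 t (Mk k))) (leeDl _ (tail0 (Mk k)))) (Mk_le k)).
have tl k : (\int[P]_w (tail (Mk k) w)%:E <= (4 ^- k)%:E)%E.
  by apply: le_trans (Mk_le k); rewrite leeDr// adde_ge0.
pose V k w : \bar R :=
  (\int[mu]_(x in D) ((gt (u w x) * (S (Mk k.+1) w x - S (Mk k) w x)) ^+ 2)%:E)%E.
have V0 k w : (0 <= V k w)%E by apply: integral_ge0 => x _; rewrite lee_fin sqr_ge0.
(* The factor [2^k] is the one demanded by the majorant; against [4^-k] it leaves a geometric
   series. *)
pose U k w : \bar R := ((2 ^+ k)%:E * ((wt w)%:E * V k w))%E.
have U0 k w : setT w -> (0 <= U k w)%E.
  by move=> _; rewrite !mule_ge0// lee_fin ?exprn_ge0// ltW.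
have mwV k : measurable_fun setT (fun w => (wt w)%:E * V k w)%E.
  exact: weighted_energy_measurable (Mk_incr k).
have mU k : measurable_fun setT (U k) by exact: emeasurable_funM.
have Ufin : (\sum_(0 <= k <oo) \int[P]_w U k w < +oo)%E.
  apply: (@nneseries_geometric_lty _ _ (t - s)) => [|k|k].
  - by rewrite subr_ge0 ltW.
  - by apply: integral_ge0 => w _; exact: U0.
  rewrite ge0_integralZl//; last by move=> w _; rewrite mule_ge0// lee_fin ltW.
  apply: (@le_trans _ _ ((2 ^+ k)%:E * ((t - s)%:E * (4 ^- k)%:E)))%E.
    rewrite lee_wpmul2l ?lee_fin ?exprn_ge0//.
    apply: (le_trans (noise_tail_estimate (Mk_incr k))).
    by rewrite lee_wpmul2l// lee_fin subr_ge0 ltW.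
  rewrite -!EFinM lee_fin mulrCA ler_wpM2l ?subr_ge0 ?(ltW st)//.
  have -> : (4 : R) = 2 * 2 by ring.
  by rewrite exprMn invfM mulrA divff ?mul1r// expf_neq0.
have au := ae_nneseries_lty measurableT mU U0 Ufin.
exists Mk; move: at_ as_ au; apply: filterS3 => w ht hs hu v Lv.
(* For fixed [w] the weight is a positive constant, so finiteness of the weighted series passes to
   the unweighted one. *)
have Vfin : (\sum_(0 <= k <oo) (2 ^+ k)%:E * V k w < +oo)%E.
  move: (hu Logic.I); rewrite /U.
  under eq_eseriesr do rewrite muleCA.
  rewrite nneseriesZl; last by move=> k _; rewrite mule_ge0// lee_fin exprn_ge0.
  have : (0 <= \sum_(0 <= k <oo) (2 ^+ k)%:E * V k w)%E.
    by apply: nneseries_ge0 => k _ _; rewrite mule_ge0// lee_fin exprn_ge0.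
  case: (\sum_(0 <= k <oo) _)%E => [x _ _|_|]//; first by rewrite ltry.
  by rewrite gt0_muley ?lte_fin.
have W_L2 r : 0 <= r -> L2 D (W r w) by move=> r0; case: hW => _ /(_ r r0)[].
have mB := measurable_funTS (measurable_gtu w) : measurable_fun (D : set (borelRd R d)) _.
have LBS M : L2 D (fun x => gt (u w x) * S M w x).
  have -> : (fun x => gt (u w x) * S M w x) = fun x => \sum_(m < M)
      increment beta s t m w * noise_mode m w x.
    apply/funext => x; rewrite /S mulr_sumr; apply: eq_bigr => m _.
    by rewrite /noise_mode /G_op /sgx; ring.
  exact: (L2_sum mD _ (fun m : 'I_M => increment beta s t m w) (fun m => noise_mode_L2 m w)).
have := @cvg_ip_dominated _ _ D (fun x => gt (u w x)) (fun x => W t w x - W s w x) v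
  (fun k => S (Mk k) w) mD mB (fun k => S_measurable (Mk k) w).
have -> : (fun k => ip D (fun x => gt (u w x) * S (Mk k) w x) v) = fun k =>
    \sum_(m < Mk k) increment beta s t m w * ip D (noise_mode m w) v.
  apply/funext => k.
  have <- := ip_sum mD (index_enum _) (fun m : 'I_(Mk k) => increment beta s t m w)
    (fun m => noise_mode_L2 m w) Lv.
  apply: eq_ip => // x _; rewrite /S mulr_sumr; apply: eq_bigr => m _.
  by rewrite /noise_mode /G_op /sgx; ring.
apply => //.
- by apply: measurable_funB; apply: L2_measurable; exact: W_L2.
- move: ht hs; apply: (@filterS2 _ _ (ae_filter_ringOfSetsType mu)) => x htx hsx Dx.
  have -> : (fun k => S (Mk k) w x) = fun k => noise_sum qe ge beta t (Mk k) w x -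
      noise_sum qe ge beta s (Mk k) w x.
    apply/funext => k; rewrite /S /noise_sum -sumrB; apply: eq_bigr => m _.
    by rewrite /increment /sgx; ring.
  by apply: cvgB; [exact: htx|exact: hsx].
- rewrite (eq_eseriesr (g := fun k => (2 ^+ k)%:E * V k w)%E)// => k _.
  rewrite /V -ge0_integralZl//.
    by apply/measurable_EFinP; apply: measurable_funX; apply: measurable_funM => //;
      apply: measurable_funB; exact: S_measurable.
  by move=> x _; rewrite lee_fin sqr_ge0.
Qed.

End multiplicative_noise.

(** * One step of the scheme *)

Lemma cvg_powR (R : realType) (r l : R) (x : nat -> R) : 1 <= r ->
  (forall n, 0 <= x n) -> x n @[n --> \oo] --> l ->
  x n `^ r @[n --> \oo] --> l `^ r.
Proof.
move=> r1 x0 xl; have r0 : 0 < r by exact: lt_le_trans r1.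
have l0 : 0 <= l.
  rewrite -(cvg_lim _ xl)//; apply: limr_ge; last exact: nearW.
  by apply/cvg_ex; exists l.
(* The derivative of the power is used for a positive limit only; at limit 0, [x^r <= x] for [x]
   below 1 squeezes instead. *)
move: l0; rewrite le_eqVlt => /predU1P[l0|l0].
  rewrite -l0 powR0 ?gt_eqF//; rewrite -l0 in xl.
  apply: (@squeeze_cvgr _ _ _ _ (fun=> 0) x) => //; last exact: cvg_cst.
  move/cvgrPdist_lt : (xl) => /(_ 1 ltr01)[N _ HN].
  exists N => // n Nn /=; rewrite powR_ge0/=.
  have := HN n Nn; rewrite /= sub0r normrN ger0_norm// => x1.
  have := x0 n; rewrite le_eqVlt => /predU1P[<-|xn0]; first by rewrite powR0 ?gt_eqF.
  by rewrite ge1r_powR// xn0 ltW.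
have dl : derivable (fun y : R => y `^ r) l (1 : R).
  by apply: derivable_powR; rewrite in_itv/= andbT.
have cl : {for l, continuous (fun y : R => y `^ r)}.
  exact/differentiable_continuous/derivable1_diffP.
exact: (@cvg_comp _ _ _ x (fun y : R => y `^ r) _ _ _ xl cl).
Qed.

Lemma powR_convex_combination (R : realType) (r a b th : R) : 1 <= r -> 0 <= a -> 0 <= b ->
  0 <= th <= 1 -> ((1 - th) * a + th * b) `^ r <= (1 - th) * a `^ r + th * b `^ r.
Proof.
move=> r1 a0 b0 /andP[th0 th1].
have h0 : 0 <= 1 - th by rewrite subr_ge0.
have h1 : 1 - th <= 1 by rewrite gerBl.
have := @convex_powR R r r1 (Itv01 h0 h1) a b.
rewrite !inE/= !in_itv/= !andbT a0 b0 => /(_ isT isT).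
rewrite !convRE/= (_ : unstable.onem (1 - th) = th); last by rewrite /unstable.onem subKr.
have e : conv (Itv01 h0 h1 : {i01 R}) (a : R^o) b = (1 - th) * a + th * b.
  by rewrite convRE/= /unstable.onem subKr.
by rewrite -e.
Qed.

Lemma fatou_le (d : measure_display) (T : measurableType d) (R : realType)
    (mu : {measure set T -> \bar R}) (D : set T) (f : nat -> T -> R) (g : T -> R) (C : \bar R) :
  measurable D -> (forall n, measurable_fun D (f n)) -> measurable_fun D g ->
  (forall n x, 0 <= f n x) -> (forall x, 0 <= g x) ->
  {ae mu, forall x, f n x @[n --> \oo] --> g x} ->
  (forall n, \int[mu]_(x in D) (f n x)%:E <= C)%E ->
  (\int[mu]_(x in D) (g x)%:E <= C)%E.
Proof.
move=> mD mf mg f0 g0 fg fC.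
pose h n x := (f n x)%:E.
have mh n : measurable_fun D (h n) by exact/measurable_EFinP.
have -> : (\int[mu]_(x in D) (g x)%:E = \int[mu]_(x in D) limn_einf (h^~ x))%E.
  apply: ge0_ae_eq_integral => //.
  - exact/measurable_EFinP.
  - apply: (measurableT_comp (@oppe_measurable _ _)).
    by apply: measurable_fun_limn_esup => n; exact: measurableT_comp.
  - by move=> x _; rewrite lee_fin.
  - move=> x _; rewrite limn_einf_lim; apply: lime_ge; first exact: is_cvg_einfs.
    by apply: nearW => n; apply: le_ereal_inf_tmp => _ [m _ <-]; rewrite lee_fin.
  - apply: filterS fg => x fgx Dx.
    have cE : h n x @[n --> \oo] --> (g x)%:E by apply: cvg_EFin => //; exact: nearW.
    by rewrite /h is_cvg_limn_einfE; [rewrite (cvg_lim _ cE)|apply/cvg_ex; exists (g x)%:E].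
have h0 n x : D x -> (0 <= h n x)%E by move=> _; rewrite lee_fin.
apply: (le_trans (fatou mu mD mh h0)).
rewrite limn_einf_lim; apply: lime_le; first exact: is_cvg_einfs.
apply: nearW => n; apply: le_trans (fC n).
by apply: ereal_inf_lbound; exists n => /=.
Qed.

Section explicit_step.
Context {R : realType} {d : nat}.
Local Notation E := 'rV[R]_d.
Local Notation mu := (lebesgue_Rd R d).
Context {dO : measure_display} {Omega : measurableType dO}.
Variables (P : probability Omega R) (D : set E) (T : @mesh R d) (F : R -> set (set Omega)).
Variables (qe : nat -> R) (ge : nat -> E -> R) (beta : nat -> R -> Omega -> R)
  (W : R -> Omega -> E -> R).
Hypothesis mD : measurable (D : set (borelRd R d)).
Hypothesis hF : normal_filtration P F.
Hypothesis Lge : forall m, L2 D (ge m).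
Hypothesis hW : Q_wiener P D F qe ge beta W.
Variables (s t : R).
Hypotheses (s0 : 0 <= s) (st : s < t).
Variables (K : nat) (e : 'I_K -> E -> R) (ft gt : R -> R).
Hypothesis He : forall i, Vh D T (e i).
Hypothesis orth_e : forall i j, ip D (e i) (e j) = (i == j)%:R.
Hypotheses (mft : measurable_fun setT ft) (mgt : measurable_fun setT gt).
Variables (r N0 N0s : R).
Hypotheses (r1 : 1 <= r) (N0s_gt0 : 0 < N0s) (N0s_le : N0s * (t - s) <= 1).
Hypothesis diss : forall v, Vh D T v ->
  [/\ L2 D (F_op ft v), hilbert_schmidt D qe ge (G_op gt v) &
      2 * ip D (F_op ft v) v + (t - s) * ip D (F_op ft v) (F_op ft v)
        + (2 * r - 1) * fine (HS_norm2 D qe ge (G_op gt v))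
      <= N0 - N0s * ip D v v].
Variable y : 'I_K -> Omega -> R.
Hypothesis my : forall i, sub_measurable (F s) (y i).
Local Notation u := (superpose (T1 := Omega) e y).

Let t0 : 0 <= t. Proof. exact: le_trans (ltW st). Qed.
Let sG v : 0 <= v -> sigma_algebra setT (F v).
Proof. by move=> v0; case: hF => /(_ v v0)[]. Qed.
Let Gm v : 0 <= v -> F v `<=` measurable.
Proof. by move=> v0; case: hF => /(_ v v0)[]. Qed.
Let Fst : F s `<=` F t.
Proof. by case: hF => _ h _ _; apply: h; rewrite s0 (ltW st). Qed.
Let ce i : continuous (e i). Proof. by case: (He i). Qed.
Let Le i : L2 D (e i). Proof. exact: Vh_L2. Qed.
Let Vu w : Vh D T (u w). Proof. exact: (Vh_sum mD _ (fun i => y i w) He). Qed.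
Let HSu w : hilbert_schmidt D qe ge (G_op gt (u w)).
Proof. by case: (diss (Vu w)). Qed.
Let Lf w : L2 D (F_op ft (u w)). Proof. by case: (diss (Vu w)). Qed.

Definition drift (i : 'I_K) (w : Omega) : R := ip D (F_op ft (u w)) (e i).

Definition kick (i : 'I_K) (w : Omega) : R :=
  ip D (G_op gt (u w) (fun x => W t w x - W s w x)) (e i).

Definition explicit_step (i : 'I_K) (w : Omega) : R := y i w + (t - s) * drift i w + kick i w.

Let mode (m : nat) (i : 'I_K) (w : Omega) : R :=
  ip D (noise_mode qe ge e y gt m w) (e i).

Let myG i : measurable_fun setT (y i : g_sigma_algebraType (F s) -> R).
Proof. exact/(sub_measurableP _ (sG s0)). Qed.

Let drift_sub_measurable i : sub_measurable (F s) (drift i).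
Proof.
apply/(sub_measurableP _ (sG s0)).
exact: (measurable_ip_superpose mD ce myG mft (L2_measurable (Le i))).
Qed.

Let mode_sub_measurable m i : sub_measurable (F s) (mode m i).
Proof.
apply/(sub_measurableP _ (sG s0)).
have mpsi : measurable_fun (D : set (borelRd R d))
    (fun x : borelRd R d => Num.sqrt (qe m) * ge m x * e i x).
  apply: measurable_funM; last exact: L2_measurable (Le i).
  apply: measurable_funM => //; exact: L2_measurable.
have := measurable_ip_superpose mD ce myG mgt mpsi.
congr (measurable_fun _ _); apply/funext => w.
rewrite /mode; apply: eq_Rintegral => x _.
by rewrite /noise_mode /G_op /superpose; ring.
Qed.

Let base (i : 'I_K) (w : Omega) : R := y i w + (t - s) * drift i w.

Let base_sub_measurable i : sub_measurable (F s) (base i).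
Proof.
apply/(sub_measurableP _ (sG s0)); apply: measurable_funD => //.
by apply: measurable_funM => //; apply/(sub_measurableP _ (sG s0)).
Qed.

(** The explicit step with the noise cut at [M] modes: [base] and [mode] are known at time [s], only
    the increments are random given the past. *)
Let noisy M (i : 'I_K) (w : Omega) : R :=
  base i w + \sum_(m < M) increment beta s t m w * mode m i w.

Let noisy_sub_measurable M i : sub_measurable (F t) (noisy M i).
Proof.
have FF (X : Omega -> R) : sub_measurable (F s) X -> sub_measurable (F t) X.
  by move=> mX B mB; apply: Fst; exact: mX.
apply/(sub_measurableP _ (sG t0)); apply: measurable_funD.
  by apply/(sub_measurableP _ (sG t0)); exact: FF.
apply: measurable_sum => m; apply: measurable_funM; apply/(sub_measurableP _ (sG t0)).
  by have := increment_sub_measurable hF hW s0 st m.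
exact: FF.
Qed.

Let noisy_cvg : exists Mk, {ae P, forall w, forall i,
  noisy (Mk k) i w @[k --> \oo] --> explicit_step i w}.
Proof.
have [Mk H] := noise_subsequence mD hF Lge hW s0 st ce my mgt HSu.
exists Mk; apply: filterS H => w h i.
by apply: cvgD; [exact: cvg_cst|exact: h].
Qed.

Let negF v : 0 <= v -> forall A, P.-negligible A -> F v A.
Proof.
move=> v0 A nA; case: hF => _ h _ h0; apply: (h 0); last exact: h0.
by rewrite lexx.
Qed.

Lemma explicit_step_sub_measurable i : sub_measurable (F t) (explicit_step i).
Proof.
have [Mk H] := noisy_cvg.
apply: (cvg_sub_measurable (sG t0) (negF t0) (fun k => noisy_sub_measurable (Mk k) i)).
by apply: filterS H => w; exact.
Qed.

Let ip_uu w : ip D (u w) (u w) = \sum_i y i w ^+ 2.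
Proof.
rewrite {1}/superpose (ip_sum mD _ (fun i => y i w) Le (Vh_L2 (Vu w))).
apply: eq_bigr => i _; rewrite ipC /superpose (ip_sum mD _ (fun i => y i w) Le (Le i)).
rewrite (bigD1 i)//= orth_e eqxx mulr1 big1 ?addr0 ?expr2// => j ji.
by rewrite orth_e (negbTE ji) mulr0.
Qed.

Let ip_fu w : ip D (F_op ft (u w)) (u w) = \sum_i y i w * drift i w.
Proof.
rewrite ipC {1}/superpose (ip_sum mD _ (fun i => y i w) Le (Lf w)).
by apply: eq_bigr => i _; rewrite ipC.
Qed.

(** By Bessel the coordinates of drift and noise carry at most the full L^2 and Hilbert-Schmidt
    energies, whose coefficients are nonnegative; the dissipativity inequality, multiplied by the
    step size, then applies. *)
Let energy_le M w : \sum_i base i w ^+ 2 +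
    (2 * r - 1) * (t - s) * \sum_(m < M) \sum_i mode m i w ^+ 2 <=
  (1 - N0s * (t - s)) * (\sum_i y i w ^+ 2) + N0 * (t - s).
Proof.
have ts : 0 < t - s by rewrite subr_gt0.
have bE : \sum_i base i w ^+ 2 = \sum_i y i w ^+ 2 +
    2 * (t - s) * (\sum_i y i w * drift i w) + (t - s) ^+ 2 * \sum_i drift i w ^+ 2.
  rewrite !mulr_sumr -!big_split/=; apply: eq_bigr => i _.
  by rewrite /base; move: (drift i w) (y i w) => a b; ring.
have [_ _] := diss (Vu w).
have hE := sum_mode_energy_le mD HSu M w.
have hM : \sum_(m < M) \sum_i mode m i w ^+ 2 <= \sum_(m < M) mode_energy D qe ge e y gt m w.
  apply: ler_sum => m _; apply: (Bessel mD He orth_e).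
  exact: noise_mode_L2.
have hB : \sum_i drift i w ^+ 2 <= ip D (F_op ft (u w)) (F_op ft (u w)).
  exact: (Bessel mD He orth_e).
have := le_trans hM hE; rewrite /hs_energy ip_uu ip_fu bE.
move: hB.
move: (fine _) (\sum_(m < M) _) (\sum_i drift i w ^+ 2) (ip D _ _) (\sum_i y i w * _)
  (\sum_i y i w ^+ 2) => hs sm sf ff yf yy.
move=> hB hS hd.
have hs1 : 0 <= (t - s) * ((2 * r - 1) * (hs - sm)).
  by apply: mulr_ge0; [exact: ltW|apply: mulr_ge0; have := r1; lra].
have hf1 : 0 <= (t - s) * ((t - s) * (ff - sf)).
  by apply: mulr_ge0; [exact: ltW|apply: mulr_ge0; [exact: ltW|lra]].
have hd1 : 0 <= (t - s) * (N0 - N0s * yy - (2 * yf + (t - s) * ff + (2 * r - 1) * hs)).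
  by apply: mulr_ge0; [exact: ltW|lra].
move: hs1 hf1 hd1; move: (t - s) => h; nra.
Qed.

Let energy_ge0 M w : 0 <= \sum_i base i w ^+ 2 + (2 * r - 1) * (t - s) *
    \sum_(m < M) \sum_i mode m i w ^+ 2.
Proof.
apply: addr_ge0; first by apply: sumr_ge0 => i _; exact: sqr_ge0.
apply: mulr_ge0; first by apply: mulr_ge0; rewrite ?subr_ge0 ?ltW//; have := r1; lra.
by apply: sumr_ge0 => m _; apply: sumr_ge0 => i _; exact: sqr_ge0.
Qed.

(** With [th = N0s (t - s)] the additive term is at most [th (|N0| / N0s)], so the right side is a
    convex combination. The absolute value keeps the base of the power nonnegative. *)
Let energy_powR_le M w : (\sum_i base i w ^+ 2 +
    (2 * r - 1) * (t - s) * \sum_(m < M) \sum_i mode m i w ^+ 2) `^ r <=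
  (1 - N0s * (t - s)) * (\sum_i y i w ^+ 2) `^ r + N0s * (`|N0| / N0s) `^ r * (t - s).
Proof.
have ts : 0 < t - s by rewrite subr_gt0.
have c0 : 0 <= `|N0| / N0s by rewrite divr_ge0// ltW.
have y0 : 0 <= \sum_i y i w ^+ 2 by apply: sumr_ge0 => i _; exact: sqr_ge0.
have th : 0 <= N0s * (t - s) <= 1 by rewrite N0s_le mulr_ge0// ltW.
have le1 : \sum_i base i w ^+ 2 + (2 * r - 1) * (t - s) * \sum_(m < M) \sum_i mode m i w ^+ 2 <=
    (1 - N0s * (t - s)) * (\sum_i y i w ^+ 2) + N0s * (t - s) * (`|N0| / N0s).
  apply: (le_trans (energy_le M w)); rewrite lerD2l.
  have -> : N0s * (t - s) * (`|N0| / N0s) = `|N0| * (t - s) by field; rewrite gt_eqF.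
  by rewrite ler_wpM2r ?ler_norm// ltW.
have -> : N0s * (`|N0| / N0s) `^ r * (t - s) = N0s * (t - s) * (`|N0| / N0s) `^ r by ring.
apply: le_trans (powR_convex_combination r1 y0 c0 th).
have r0 : 0 <= r by exact: le_trans r1.
by apply: ge0_ler_powR => //; rewrite nnegrE ?energy_ge0// (le_trans (energy_ge0 M w)).
Qed.

Lemma explicit_step_moment_le A : F s A ->
  (\int[P]_(w in A) ((\sum_i explicit_step i w ^+ 2) `^ r)%:E <=
   \int[P]_(w in A) ((1 - N0s * (t - s)) * (\sum_i y i w ^+ 2) `^ r +
     N0s * (`|N0| / N0s) `^ r * (t - s))%:E)%E.
Proof.
move=> FA; have [Mk H] := noisy_cvg.
have mA : measurable A by exact: Gm FA.
have msq (X : 'I_K -> Omega -> R) v : 0 <= v -> (forall i, sub_measurable (F v) (X i)) ->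
    measurable_fun setT (fun w => (\sum_i X i w ^+ 2)).
  move=> v0 mX; apply: measurable_sum => i; apply: measurable_funX.
  exact: sub_measurable_measurable (Gm v0) _ (mX i).
have mpow (X : Omega -> R) : measurable_fun setT X -> measurable_fun A (fun w => X w `^ r).
  move=> mX; apply: measurable_funTS.
  by apply: (@measurableT_comp _ _ _ _ _ _ (fun a : R => a `^ r)) => //; exact: measurable_powR.
apply: (@fatou_le _ _ _ P A (fun k w => (\sum_i noisy (Mk k) i w ^+ 2) `^ r)) => //.
- by move=> k; apply: mpow; apply: (msq _ t) => // i; exact: noisy_sub_measurable.
- by apply: mpow; apply: (msq _ t) => // i; exact: explicit_step_sub_measurable.
- by move=> n w; exact: powR_ge0.
- by move=> w; exact: powR_ge0.
- apply: filterS H => w h; apply: cvg_powR => //.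
    by move=> k; apply: sumr_ge0 => i _; exact: sqr_ge0.
  apply: cvg_big => [|i _]; first exact: add_continuous.
  by apply: cvgM; exact: h.
move=> k.
apply: le_trans (increment_moment_le hF hW s0 st (Mk k) r1 FA base_sub_measurable
  mode_sub_measurable) _.
apply: ge0_le_integral => //.
- by move=> w _; rewrite lee_fin powR_ge0.
- apply/measurable_EFinP; apply: mpow; apply: measurable_funD.
    by apply: (msq _ s) => // i.
  apply: measurable_funM => //; apply: measurable_sum => m; apply: (msq _ s) => // i.
- apply/measurable_EFinP; apply: measurable_funD => //; apply: measurable_funM => //.
  by apply: mpow; apply: (msq _ s).
- by move=> w _; rewrite lee_fin; exact: energy_powR_le.
Qed.

End explicit_step.

(** * The implicit part of a step *)

Section implicit_euler.
Context {R : realType} {d : nat}.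
Local Notation E := 'rV[R]_d.
Local Notation mu := (lebesgue_Rd R d).
Variables (D : set E) (T : @mesh R d).
Hypotheses (oD : open D) (bD : bounded_set D).
Hypothesis coverD : D `<=` \bigcup_(k : 'I_(ncells T)) cell k.
Variables (K : nat) (e : 'I_K -> E -> R).
Hypothesis He : forall i, Vh D T (e i).
Hypothesis orth_e : forall i j, ip D (e i) (e j) = (i == j)%:R.
Hypothesis total_e : forall v, Vh D T v -> (forall i, ip D v (e i) = 0) -> ip D v v = 0.

Let mD : measurable (D : set (borelRd R d)).
Proof. exact: sub_sigma_algebra. Qed.

(** Since [z = y - tau a], its squared norm is [|y|^2 - 2 tau <a, y> + tau^2 |a|^2], where [<a, y>]
    is nonpositive. *)
Lemma implicit_euler_norm_le (tau : R) (y a : E -> R) (z : 'I_K -> R) : 0 <= tau ->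
  Vh D T y -> is_Ah D T y a -> (forall i, ip D y (e i) = z i + tau * ip D a (e i)) ->
  \sum_i ip D y (e i) ^+ 2 <= \sum_i z i ^+ 2.
Proof.
move=> tau0 Hy Ha yE; have := Ah_nonpos Hy Ha.
rewrite (ip_Vh mD He orth_e total_e (Vh_L2 Ha.1) Hy) => nonpos.
have -> : \sum_i z i ^+ 2 = \sum_i ip D y (e i) ^+ 2 -
    2 * tau * (\sum_i ip D a (e i) * ip D y (e i)) + tau ^+ 2 * \sum_i ip D a (e i) ^+ 2.
  rewrite !mulr_sumr -sumrB -big_split/=; apply: eq_bigr => i _.
  rewrite yE; move: (ip D a (e i)) (z i) => t1 t2; ring.
have : 0 <= tau ^+ 2 * \sum_i ip D a (e i) ^+ 2.
  by apply: mulr_ge0; rewrite ?sqr_ge0// sumr_ge0// => i _; exact: sqr_ge0.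
have := mulr_ge0_le0 tau0 nonpos.
set S1 := \sum_i _; set S2 := \sum_i _; set S3 := \sum_i _.
by move: S1 S2 S3 (tau ^+ 2) => S1 S2 S3 t2; lra.
Qed.

(** The same expansion for the difference of two steps, with monotonicity replacing the sign of
    [<a, y>]. It is what makes the implicit step measurable. *)
Lemma implicit_euler_contraction (tau : R) (y y' a a' : E -> R) (z z' : 'I_K -> R) :
  0 <= tau -> Vh D T y -> Vh D T y' -> is_Ah D T y a -> is_Ah D T y' a' ->
  (forall i, ip D y (e i) = z i + tau * ip D a (e i)) ->
  (forall i, ip D y' (e i) = z' i + tau * ip D a' (e i)) ->
  \sum_i (ip D y (e i) - ip D y' (e i)) ^+ 2 <= \sum_i (z i - z' i) ^+ 2.
Proof.
move=> tau0 Hy Hy' Ha Ha' yE yE'; have := Ah_monotone oD bD coverD Hy Hy' Ha Ha'.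
have La := Vh_L2 Ha.1; have La' := Vh_L2 Ha'.1.
rewrite !(ip_Vh mD He orth_e total_e)// => nonpos.
have nonpos' : \sum_i (ip D a (e i) - ip D a' (e i)) * (ip D y (e i) - ip D y' (e i)) <= 0.
  apply: le_trans nonpos; rewrite -!sumrB -big_split/=; apply: ler_sum => i _.
  move: (ip D a _) (ip D a' _) (ip D y _) (ip D y' _) => t1 t2 t3 t4; lra.
have -> : \sum_i (z i - z' i) ^+ 2 = \sum_i (ip D y (e i) - ip D y' (e i)) ^+ 2 -
    2 * tau * (\sum_i (ip D a (e i) - ip D a' (e i)) * (ip D y (e i) - ip D y' (e i))) +
    tau ^+ 2 * \sum_i (ip D a (e i) - ip D a' (e i)) ^+ 2.
  rewrite !mulr_sumr -sumrB -big_split/=; apply: eq_bigr => i _.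
  rewrite yE yE'; move: (ip D a (e i)) (ip D a' (e i)) (z i) (z' i) => t1 t2 t3 t4; ring.
have : 0 <= tau ^+ 2 * \sum_i (ip D a (e i) - ip D a' (e i)) ^+ 2.
  by apply: mulr_ge0; rewrite ?sqr_ge0// sumr_ge0// => i _; exact: sqr_ge0.
have := mulr_ge0_le0 tau0 nonpos'.
set S1 := \sum_i _; set S2 := \sum_i _; set S3 := \sum_i _.
by move: S1 S2 S3 (tau ^+ 2) => S1 S2 S3 t2; lra.
Qed.

Lemma normL2_powR (r : R) (v : E -> R) : Vh D T v ->
  normL2 D v `^ (2 * r) = (\sum_i ip D v (e i) ^+ 2) `^ r.
Proof.
move=> Hv; rewrite powRrM powR_mulrn ?normL2_ge0// normL2_sqr.
rewrite (ip_Vh mD He orth_e total_e (Vh_L2 Hv) Hv); congr (_ `^ r).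
Qed.

End implicit_euler.

Section tamed_step.
Context {R : realType} {d : nat}.
Local Notation E := 'rV[R]_d.
Local Notation mu := (lebesgue_Rd R d).
Context {dO : measure_display} {Omega : measurableType dO}.
Variables (P : probability Omega R) (D : set E) (T : @mesh R d) (F : R -> set (set Omega)).
Variables (qe : nat -> R) (ge : nat -> E -> R) (beta : nat -> R -> Omega -> R)
  (W : R -> Omega -> E -> R).
Hypotheses (oD : open D) (bD : bounded_set D).
Hypothesis coverD : D `<=` \bigcup_(k : 'I_(ncells T)) cell k.
Hypothesis hF : normal_filtration P F.
Hypothesis Lge : forall m, L2 D (ge m).
Hypothesis hW : Q_wiener P D F qe ge beta W.
Variables (K : nat) (e : 'I_K -> E -> R).
Hypothesis He : forall i, Vh D T (e i).
Hypothesis orth_e : forall i j, ip D (e i) (e j) = (i == j)%:R.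
Hypothesis total_e : forall v, Vh D T v -> (forall i, ip D v (e i) = 0) -> ip D v v = 0.
Variables (s t : R) (ft gt : R -> R).
Hypotheses (s0 : 0 <= s) (st : s < t).
Hypotheses (mft : measurable_fun setT ft) (mgt : measurable_fun setT gt).
Variables (r N0 N0s : R).
Hypotheses (r1 : 1 <= r) (N0s_gt0 : 0 < N0s) (N0s_le : N0s * (t - s) <= 1).
Hypothesis diss : forall v, Vh D T v ->
  [/\ L2 D (F_op ft v), hilbert_schmidt D qe ge (G_op gt v) &
      2 * ip D (F_op ft v) v + (t - s) * ip D (F_op ft v) (F_op ft v)
        + (2 * r - 1) * fine (HS_norm2 D qe ge (G_op gt v))
      <= N0 - N0s * ip D v v].
Variables Y Y' : Omega -> E -> R.
Hypotheses (VY : forall w, Vh D T (Y w)) (VY' : forall w, Vh D T (Y' w)).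
Hypothesis mY : forall i, sub_measurable (F s) (fun w => ip D (Y w) (e i)).
Hypothesis stepY : {ae P, forall w, exists a b c : E -> R,
  [/\ is_Ah D T (Y' w) a, is_Ph D T (F_op ft (Y w)) b,
      is_Ph D T (G_op gt (Y w) (fun x => W t w x - W s w x)) c &
      forall x, Y' w x = Y w x + (t - s) * a x + (t - s) * b x + c x]}.

Let mD : measurable (D : set (borelRd R d)).
Proof. exact: sub_sigma_algebra. Qed.
Let t0 : 0 <= t. Proof. exact: le_trans (ltW st). Qed.
Let ts0 : 0 <= t - s. Proof. by rewrite subr_ge0 ltW. Qed.
Let sG v : 0 <= v -> sigma_algebra setT (F v).
Proof. by move=> v0; case: hF => /(_ v v0)[]. Qed.
Let Gm v : 0 <= v -> F v `<=` measurable.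
Proof. by move=> v0; case: hF => /(_ v v0)[]. Qed.
Let negF A : P.-negligible A -> F t A.
Proof.
move=> nA; case: hF => _ h _ h0; apply: (h 0); last exact: h0.
by rewrite lexx.
Qed.
Let Le i : L2 D (e i). Proof. exact: Vh_L2. Qed.
Let y i w := ip D (Y w) (e i).
Let z := explicit_step D W s t e ft gt y.

Let mW v w : 0 <= v -> measurable_fun (D : set (borelRd R d)) (W v w : borelRd R d -> R).
Proof. by move=> v0; apply: L2_measurable; case: hW => _ /(_ v v0)[]. Qed.

Let measurable_Vh v : Vh D T v -> measurable_fun (D : set (borelRd R d)) (v : borelRd R d -> R).
Proof. by move=> Hv; apply: L2_measurable; exact: Vh_L2 Hv. Qed.

(** The scheme tested against [e i]. The projections disappear because [e i] lies in V_h, and [Y w]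
    may be replaced by its coordinate expansion, which agrees with it almost everywhere on [D]. *)
Let implicit_equation : {ae P, forall w, exists2 a, is_Ah D T (Y' w) a &
  forall i, ip D (Y' w) (e i) = z i w + (t - s) * ip D a (e i)}.
Proof.
apply: filterS stepY => w [a [b [c [Ha Hb Hc YE]]]]; exists a => // i.
have La := Vh_L2 Ha.1; have Lb := Vh_L2 Hb.1; have Lc := Vh_L2 Hc.1.
have LY := Vh_L2 (VY w).
have Y'E : ip D (Y' w) (e i) =
    ip D (fun x => (t - s) * a x + ((t - s) * b x + (1 * c x + Y w x))) (e i).
  apply: eq_ip => // x _; rewrite YE; ring.
have L1 := L2_lin mD 1 Lc LY.
rewrite Y'E (ip_lin mD (t - s) La (L2_lin mD (t - s) Lb L1) (Le i)).
rewrite (ip_lin mD (t - s) Lb L1 (Le i)) (ip_lin mD 1 Lc LY (Le i)).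
rewrite (Hb.2 _ (He i)) (Hc.2 _ (He i)) /pairing.
have aeY : ae_eq_on D (Y w) (superpose (T1 := Omega) e y w).
  by have := Vh_ae_proj mD He orth_e total_e (VY w).
have Vu : Vh D T (superpose (T1 := Omega) e y w) by exact: (Vh_sum mD _ (fun i => y i w) He).
have mcomp phi v : measurable_fun setT phi -> Vh D T v ->
    measurable_fun (D : set (borelRd R d)) (phi \o v : borelRd R d -> R).
  by move=> mphi Hv; apply: measurableT_comp => //; exact: measurable_Vh.
have -> : ip D (F_op ft (Y w)) (e i) = drift D e ft y i w.
  apply: (ae_eq_ip mD (mcomp _ _ mft (VY w)) (mcomp _ _ mft Vu) (measurable_Vh (He i))).
  move: aeY; apply: (@filterS _ _ (ae_filter_ringOfSetsType mu)) => x h Dx.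
  by rewrite /F_op/= (h Dx).
have -> : ip D (G_op gt (Y w) (fun x => W t w x - W s w x)) (e i) = kick D W s t e gt y i w.
  have mdW : measurable_fun (D : set (borelRd R d))
      (fun x : borelRd R d => W t w x - W s w x).
    by apply: measurable_funB; exact: mW.
  apply: (ae_eq_ip mD (measurable_funM (mcomp _ _ mgt (VY w)) mdW)
    (measurable_funM (mcomp _ _ mgt Vu) mdW) (measurable_Vh (He i))).
  move: aeY; apply: (@filterS _ _ (ae_filter_ringOfSetsType mu)) => x h Dx.
  by rewrite /G_op/= (h Dx).
rewrite /z /explicit_step /y.
move: (ip D a (e i)) (ip D (Y w) (e i)) (drift _ _ _ _ _ _) (kick _ _ _ _ _ _ _ _ _) => x1 x2 x3 x4.
ring.
Qed.

Let mz i : sub_measurable (F t) (z i).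
Proof. by have := explicit_step_sub_measurable mD hF Lge hW s0 st He mft mgt diss mY i. Qed.

Lemma tamed_step_sub_measurable i : sub_measurable (F t) (fun w => ip D (Y' w) (e i)).
Proof.
move: i; apply: (ae_lipschitz_sub_measurable (sG t0) negF implicit_equation mz) => w w'.
move=> /contrapT [a Ha aE] /contrapT [a' Ha' aE'].
exact: (implicit_euler_contraction oD bD coverD He orth_e total_e ts0 (VY' w) (VY' w') Ha Ha').
Qed.

Lemma tamed_step_moment_le A : F s A ->
  (\int[P]_(w in A) (normL2 D (Y' w) `^ (2 * r))%:E <=
   \int[P]_(w in A) ((1 - N0s * (t - s)) * normL2 D (Y w) `^ (2 * r) +
     N0s * (`|N0| / N0s) `^ r * (t - s))%:E)%E.
Proof.
move=> FA; have mA : measurable A by exact: Gm FA.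
under eq_integral do rewrite (normL2_powR oD He orth_e total_e)//.
under [leRHS]eq_integral do rewrite (normL2_powR oD He orth_e total_e)//.
apply: le_trans (explicit_step_moment_le mD hF Lge hW s0 st He orth_e mft mgt r1 N0s_gt0 N0s_le
  diss mY FA).
have mpow (X : 'I_K -> Omega -> R) : (forall i, sub_measurable (F t) (X i)) ->
    measurable_fun A (fun w => ((\sum_i X i w ^+ 2) `^ r)%:E).
  move=> mX; apply/measurable_EFinP; apply: measurable_funTS.
  apply: (@measurableT_comp _ _ _ _ _ _ (fun a : R => a `^ r)) => //.
  apply: measurable_sum => i; apply: measurable_funX.
  exact: sub_measurable_measurable (Gm t0) _ (mX i).
apply: ae_ge0_le_integral => //.
- by move=> w _; rewrite lee_fin powR_ge0.
- exact: mpow tamed_step_sub_measurable.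
- by move=> w _; rewrite lee_fin powR_ge0.
- exact: mpow mz.
apply: filterS implicit_equation => w [a Ha aE] _.
rewrite lee_fin; apply: ge0_ler_powR; rewrite ?nnegrE.
- exact: le_trans r1.
- by apply: sumr_ge0 => i _; exact: sqr_ge0.
- by apply: sumr_ge0 => i _; exact: sqr_ge0.
exact: (implicit_euler_norm_le oD He orth_e total_e ts0 (VY' w) Ha).
Qed.

End tamed_step.

(** * Iteration over the time steps *)

Section tamed_scheme.
Context {R : realType} {d : nat}.
Local Notation E := 'rV[R]_d.
Local Notation mu := (lebesgue_Rd R d).
Context {dO : measure_display} {Omega : measurableType dO}.
Variables (P : probability Omega R) (D : set E) (T : @mesh R d) (F : R -> set (set Omega)).
Variables (qe : nat -> R) (ge : nat -> E -> R) (beta : nat -> R -> Omega -> R)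
  (W : R -> Omega -> E -> R).
Hypotheses (oD : open D) (bD : bounded_set D).
Hypothesis coverD : D `<=` \bigcup_(k : 'I_(ncells T)) cell k.
Hypothesis hF : normal_filtration P F.
Hypothesis Lge : forall m, L2 D (ge m).
Hypothesis hW : Q_wiener P D F qe ge beta W.
Variables (tau : R) (ft gt : R -> R).
Hypothesis tau0 : 0 < tau.
Hypotheses (mft : measurable_fun setT ft) (mgt : measurable_fun setT gt).
Variables (r N0 N0s : R).
Hypotheses (r1 : 1 <= r) (N0s_gt0 : 0 < N0s) (N0s_le : N0s * tau <= 1).
Hypothesis diss : forall v, Vh D T v ->
  [/\ L2 D (F_op ft v), hilbert_schmidt D qe ge (G_op gt v) &
      2 * ip D (F_op ft v) v + tau * ip D (F_op ft v) (F_op ft v)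
        + (2 * r - 1) * fine (HS_norm2 D qe ge (G_op gt v))
      <= N0 - N0s * ip D v v].
Variables (X0 : Omega -> E -> R) (Y : nat -> Omega -> E -> R).
Hypothesis hX0 : Lp_initial P D F (2 * r) X0.
Hypothesis hY : tamed_FEM P D T tau ft gt W X0 Y.

Let mD : measurable (D : set (borelRd R d)).
Proof. exact: sub_sigma_algebra. Qed.
Let time n : R := n%:R * tau.
Let time0 n : 0 <= time n. Proof. by rewrite mulr_ge0// ltW. Qed.
Let timeS n : time n.+1 - time n = tau.
Proof. by rewrite /time -mulrBl -natrB// subSnn mul1r. Qed.
Let time_lt n : time n < time n.+1. Proof. by rewrite -subr_gt0 timeS. Qed.
Let sG n : sigma_algebra setT (F (time n)).
Proof. by case: hF => /(_ _ (time0 n))[]. Qed.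
Let Gm n : F (time n) `<=` measurable.
Proof. by case: hF => /(_ _ (time0 n))[]. Qed.
Let FT n : F (time n) setT.
Proof. by case: (sG n) => h0 hC _; rewrite -(setD0 setT); exact: hC. Qed.
Let VY n w : Vh D T (Y n w). Proof. by case: hY. Qed.

Let stepY n : {ae P, forall w, exists a b c : E -> R,
  [/\ is_Ah D T (Y n.+1 w) a, is_Ph D T (F_op ft (Y n w)) b,
      is_Ph D T (G_op gt (Y n w) (fun x => W (time n.+1) w x - W (time n) w x)) c &
      forall x, Y n.+1 w x = Y n w x + (time n.+1 - time n) * a x +
        (time n.+1 - time n) * b x + c x]}.
Proof. by rewrite timeS; case: hY => _ _ /(_ n.+1 isT). Qed.

Let c : R := N0s * (`|N0| / N0s) `^ r.

Let bound n w : R := (1 - N0s * tau) * normL2 D (Y n w) `^ (2 * r) + c * tau.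

Let c0 : 0 <= c. Proof. by rewrite mulr_ge0 ?powR_ge0// ltW. Qed.

Let bound_ge0 n w : 0 <= bound n w.
Proof.
apply: addr_ge0; last by rewrite mulr_ge0// ltW.
by rewrite mulr_ge0 ?powR_ge0// subr_ge0.
Qed.

Section coordinates.
Variables (K : nat) (e : 'I_K -> E -> R).
Hypothesis He : forall i, Vh D T (e i).
Hypothesis orth_e : forall i j, ip D (e i) (e j) = (i == j)%:R.
Hypothesis total_e : forall v, Vh D T v -> (forall i, ip D v (e i) = 0) -> ip D v v = 0.

Let Le i : L2 D (e i). Proof. exact: Vh_L2. Qed.

Let normL2_powR_sub_measurable n G : sigma_algebra setT G ->
  (forall i, sub_measurable G (fun w => ip D (Y n w) (e i))) ->
  sub_measurable G (fun w => normL2 D (Y n w) `^ (2 * r)).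
Proof.
move=> sGG mY; apply/(sub_measurableP _ sGG).
have -> : (fun w : g_sigma_algebraType G => normL2 D (Y n w) `^ (2 * r)) =
    (fun a : R => a `^ r) \o (fun w => \sum_i ip D (Y n w) (e i) ^+ 2).
  by apply/funext => w /=; rewrite (normL2_powR oD He orth_e total_e).
apply: (@measurableT_comp _ _ _ _ _ _ (fun a : R => a `^ r)); first exact: measurable_powR.
apply: measurable_sum => i; apply: measurable_funX.
exact/(sub_measurableP _ sGG).
Qed.

Let diss' n v : Vh D T v ->
  [/\ L2 D (F_op ft v), hilbert_schmidt D qe ge (G_op gt v) &
      2 * ip D (F_op ft v) v + (time n.+1 - time n) * ip D (F_op ft v) (F_op ft v)
        + (2 * r - 1) * fine (HS_norm2 D qe ge (G_op gt v))
      <= N0 - N0s * ip D v v].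
Proof. by rewrite timeS; exact: diss. Qed.

Let N0s_le' n : N0s * (time n.+1 - time n) <= 1. Proof. by rewrite timeS. Qed.

Let initial_sub_measurable i : sub_measurable (F (time 0)) (fun w => ip D (Y 0 w) (e i)).
Proof.
have t00 : time 0 = 0 by rewrite /time mul0r.
have negF A : P.-negligible A -> F (time 0) A by rewrite t00; case: hF => _ _ _; exact.
have rvX : L2_random_variable D (F (time 0)) X0 by rewrite t00; case: hX0.
have := ae_sub_measurable (sG 0) negF (L2_random_variable_ip mD (sG 0) rvX (Le i)).
apply; case: hY => _ + _; apply: filterS => w [_ h].
by rewrite (h _ (He i)).
Qed.

(** Adaptedness of the scheme, started from the coordinates of [X0], which almost surely coincide
    with those of its projection. *)
Let sub_measurable_coord n : forall i, sub_measurable (F (time n)) (fun w => ip D (Y n w) (e i)).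
Proof.
elim: n => [|n IH i]; first exact: initial_sub_measurable.
by have := tamed_step_sub_measurable oD bD coverD hF Lge hW He orth_e total_e (time0 n) (time_lt n)
  mft mgt (diss' n) (VY n) (VY n.+1) IH (stepY n) i.
Qed.

Let step_le n A : F (time n) A ->
  (\int[P]_(w in A) (normL2 D (Y n.+1 w) `^ (2 * r))%:E <= \int[P]_(w in A) (bound n w)%:E)%E.
Proof.
have := tamed_step_moment_le oD bD coverD hF Lge hW He orth_e total_e (time0 n) (time_lt n)
  mft mgt r1 N0s_gt0 (N0s_le' n) (diss' n) (VY n) (VY n.+1) (sub_measurable_coord n) (stepY n).
by rewrite timeS; exact.
Qed.

Let norm_measurable n : measurable_fun setT (EFin \o (fun w => normL2 D (Y n w) `^ (2 * r))).
Proof.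
apply/measurable_EFinP.
exact: sub_measurable_measurable (@Gm n) _
  (normL2_powR_sub_measurable (sG n) (sub_measurable_coord n)).
Qed.

Let ge0_integrable (X : Omega -> R) : (forall w, 0 <= X w) ->
  measurable_fun setT (EFin \o X) -> (\int[P]_w (X w)%:E < +oo)%E ->
  P.-integrable setT (EFin \o X).
Proof.
move=> X0' mX iX; apply/integrableP; split => //.
by under eq_integral do rewrite gee0_abs ?lee_fin//.
Qed.

Let bound_integrable n :
  P.-integrable setT (EFin \o (fun w => normL2 D (Y n w) `^ (2 * r))) ->
  P.-integrable setT (EFin \o bound n).
Proof.
move=> IH; have ic := finite_measure_integrable_cst P (c * tau) measurableT.
have := integrableD measurableT (integrableZl measurableT (1 - N0s * tau) IH) ic.
by congr (_.-integrable _ _); apply/funext => w.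
Qed.

(** Integrability is part of the notion of conditional expectation. It starts from Bessel's
    inequality for the projected initial value and propagates through the step estimate on the whole
    space. *)
Let moment_integrable n : P.-integrable setT (EFin \o (fun w => normL2 D (Y n w) `^ (2 * r))).
Proof.
elim: n => [|n IH]; apply: ge0_integrable (norm_measurable _) _; try by move=> w; exact: powR_ge0.
  have [[LX rvX] iX] := hX0; apply: le_lt_trans iX.
  apply: ae_ge0_le_integral => //.
  - by move=> w _; rewrite lee_fin powR_ge0.
  - exact: norm_measurable.
  - by move=> w _; rewrite lee_fin powR_ge0.
  - have F0 : sigma_algebra setT (F 0) by case: hF => /(_ _ (lexx 0))[].
    have -> : (fun w => (normL2 D (X0 w) `^ (2 * r))%:E) =
        EFin \o (fun w => ip D (X0 w) (X0 w) `^ r).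
      by apply/funext => w /=; rewrite powRrM powR_mulrn ?normL2_ge0// normL2_sqr.
    apply/measurable_EFinP.
    apply: (@measurableT_comp _ _ _ _ _ _ (fun a : R => a `^ r)); first exact: measurable_powR.
    apply: sub_measurable_measurable (L2_random_variable_normsq F0 (conj LX rvX)).
    by case: hF => /(_ _ (lexx 0))[].
  - case: hY => _ + _; apply: filterS => w [_ h] _.
    rewrite lee_fin (normL2_powR oD He orth_e total_e)// powRrM powR_mulrn ?normL2_ge0// normL2_sqr.
    apply: ge0_ler_powR; rewrite ?nnegrE ?ip_ge0//; first exact: le_trans r1.
      by apply: sumr_ge0 => i _; exact: sqr_ge0.
    apply: le_trans (Bessel mD He orth_e (LX w)).
    by under eq_bigr do rewrite (h _ (He _)).
apply: le_lt_trans (step_le (FT n)) _.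
have /integrableP[_] := bound_integrable IH; apply: le_lt_trans.
by under [leRHS]eq_integral do rewrite gee0_abs ?lee_fin ?bound_ge0//.
Qed.

Lemma tamed_scheme_cond_exp_le_coord n :
  (exists Z, is_cond_exp P (F (time n)) (fun w => normL2 D (Y n.+1 w) `^ (2 * r)) Z) /\
  forall Z, is_cond_exp P (F (time n)) (fun w => normL2 D (Y n.+1 w) `^ (2 * r)) Z ->
    {ae P, forall w, Z w <= bound n w}.
Proof.
split; first exact: cond_exp_exists (moment_integrable n.+1).
move=> Z HZ; apply: (cond_exp_le (sG n) (@Gm n) HZ).
- apply/(sub_measurableP _ (sG n)); apply: measurable_funD => //; apply: measurable_funM => //.
  apply/(sub_measurableP _ (sG n)).
  by have := normL2_powR_sub_measurable (sG n) (sub_measurable_coord n).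
- by move=> A FA; exact: step_le.
- exact: bound_integrable (moment_integrable n).
Qed.

End coordinates.

Lemma tamed_scheme_cond_exp_le n :
  (exists Z, is_cond_exp P (F (n%:R * tau)) (fun w => normL2 D (Y n.+1 w) `^ (2 * r)) Z) /\
  forall Z, is_cond_exp P (F (n%:R * tau)) (fun w => normL2 D (Y n.+1 w) `^ (2 * r)) Z ->
    {ae P, forall w, Z w <= (1 - N0s * tau) * normL2 D (Y n w) `^ (2 * r) +
      N0s * (`|N0| / N0s) `^ r * tau}.
Proof.
have [K [e [He orth_e total_e]]] := Vh_orthonormal_basis mD coverD.
exact: tamed_scheme_cond_exp_le_coord He orth_e total_e n.
Qed.

End tamed_scheme.

Theorem theorem6 (R : realType) (d : nat) (hd : (1 <= d <= 3)%N)
    (D : set 'rV[R]_d) (hD : bounded_domain D)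
    (q : R) (hq : 1 < q) (hq3 : d = 3%N -> q <= 3)
    (dO : measure_display) (Omega : measurableType dO)
    (P : probability Omega R) (hP : measure_is_complete P)
    (F : R -> set (set Omega)) (hF : normal_filtration P F)
    (Q : ('rV[R]_d -> R) -> 'rV[R]_d -> R)
    (qe : nat -> R) (ge : nat -> 'rV[R]_d -> R)
    (hQ : covariance_operator D Q qe ge) (hreg : noise_regularity D qe ge)
    (beta : nat -> R -> Omega -> R) (W : R -> Omega -> 'rV[R]_d -> R)
    (hW : Q_wiener P D F qe ge beta W)
    (Hs : set R) (T : R -> @mesh R d)
    (hT : regular_quasiuniform_family D Hs T)
    (p : R) (hp : 2 <= p)
    (X0 : Omega -> 'rV[R]_d -> R) (hX0 : Lp_initial P D F p X0)
    (f g : R -> R)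
    (hfg : coefficient_assumption (fine (CQ D qe ge)) p q f g)
    (ftau gtau : R -> R -> R)
    (hftau : forall tau, 0 < tau < 1 -> measurable_fun setT (ftau tau))
    (hgtau : forall tau, 0 < tau < 1 -> measurable_fun setT (gtau tau))
    (hdiss : tamed_dissipativity D qe ge p ftau gtau) :
  exists T1 T2 tau1 : R, [/\ 0 < T1, 0 < T2, 0 < tau1 <= 1 &
    forall (tau h : R) (Y : nat -> Omega -> 'rV[R]_d -> R),
      0 < tau < tau1 -> Hs h ->
      tamed_FEM P D (T h) tau (ftau tau) (gtau tau) W X0 Y ->
      forall n : nat, (0 < n)%N ->
        (exists Z, is_cond_exp P (F (n.-1%:R * tau))
                     (fun w => normL2 D (Y n w) `^ p) Z) /\
        forall Z, is_cond_exp P (F (n.-1%:R * tau))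
                    (fun w => normL2 D (Y n w) `^ p) Z ->
          {ae P, forall w,
            Z w <= T1 * tau + (1 - T2 * tau) * normL2 D (Y n.-1 w) `^ p}].
Proof.
have [tau0 [N0 [N0s [/andP[tau0_gt0 tau0_le1] N0s_gt0 diss]]]] := hdiss.
have [oD _ _ bD _] := hD.
have [_ _ _ [[Lge _ _] _] _] := hQ.
have [_ /= partT _ _] := hT.
pose r := p / 2.
have pE : p = 2 * r by rewrite /r mulrC divfK.
have r1 : 1 <= r by rewrite /r ler_pdivlMr// mul1r.
have c0 : 0 <= N0s * (`|N0| / N0s) `^ r by rewrite mulr_ge0 ?powR_ge0// ltW.
have N1 : 0 < 1 + N0s by rewrite addr_gt0.
(* The summand 1 makes the first constant positive even when [N0 = 0]. The bound [1 / (1 + N0s)] on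
   the step gives [N0s tau <= 1], as the convex weights require. *)
exists (N0s * (`|N0| / N0s) `^ r + 1), N0s, (Num.min tau0 (1 + N0s)^-1); split => //.
- by rewrite ltr_wpDl.
- by rewrite lt_min tau0_gt0 invr_gt0 N1 ge_min tau0_le1.
move=> tau h Y /andP[tau_gt0]; rewrite lt_min => /andP[tau_lt tau_ltN] Hh hY [//|n] _.
have [[_ _ coverT _] _] := partT h Hh.
have coverD : D `<=` \bigcup_(k : 'I_(ncells (T h))) cell k.
  by rewrite coverT; exact: subset_closure.
have tau01 : 0 < tau < 1 by rewrite tau_gt0 (lt_le_trans tau_lt).
have N0s_le : N0s * tau <= 1.
  have : tau * (1 + N0s) <= 1 by rewrite -ler_pdivlMr// div1r ltW.
  by move: tau_gt0; lra.
have dissV v : Vh D (T h) v ->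
    [/\ L2 D (F_op (ftau tau) v), hilbert_schmidt D qe ge (G_op (gtau tau) v) &
        2 * ip D (F_op (ftau tau) v) v + tau * ip D (F_op (ftau tau) v) (F_op (ftau tau) v)
          + (2 * r - 1) * fine (HS_norm2 D qe ge (G_op (gtau tau) v)) <= N0 - N0s * ip D v v].
  move=> [Hv _ _ _]; have [] := diss tau v _ Hv; first by rewrite tau_gt0.
  by rewrite !normL2_sqr pE.
rewrite pE in hX0 *.
have [ex le] := tamed_scheme_cond_exp_le oD bD coverD hF Lge hW tau_gt0 (hftau _ tau01)
  (hgtau _ tau01) r1 N0s_gt0 N0s_le dissV hX0 hY n.
split=> // Z /le; apply: filterS => w; rewrite addrC => /le_trans; apply.
by rewrite lerD2r ler_wpM2r ?lerDl// ltW.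
Qed.
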